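(* Take $z=0$. Then $$\liminf_{s\to1^+}\mathbb{E}_{\mathbb{P}_{K_{\mathbb{D}}}}\Big(\sup_{f\in\mathcal{B}(W_{\mathrm{cr}})}\Big|\frac{g_X(s,z;f)}{g_{\mathbb{P}_{K_{\mathbb{D}}}}(s)}-f(z)\Big|^2\Big)>0,$$ where $W_{\mathrm{cr}}(z)=\frac{1}{(1-|z|^2)\log^2\left(\frac{4}{1-|z|^2}\right)}$ for $z\in\mathbb{D}$.
   Context: $\mathbb{D}$ is the open unit disk in $\mathbb{C}$, $dA$ is Lebesgue measure on $\mathbb{D}$ normalized so that $A(\mathbb{D})=1$, and $K_{\mathbb{D}}(z,w)=(1-z\bar w)^{-2}$ is the Bergman kernel. $\mathrm{Conf}(\mathbb{D})$ is the space of (locally finite) configurations $X$ on $\mathbb{D}$, and $\mathbb{P}_{K_{\mathbb{D}}}$ is the determinantal point process induced by $K_{\mathbb{D}}$: the unique simple point process (Borel probability measure on $\mathrm{Conf}(\mathbb{D})$) whose $n$-th correlation function with respect to $dA$ is $\det(K_{\mathbb{D}}(x_i,x_j))_{1\le i,j\le n}$ for all $n\ge1$. The Poincaré metric is $d_{\mathbb{D}}(x,z)=\log\frac{1+|\varphi_x(z)|}{1-|\varphi_x(z)|}$ with $\varphi_x(z)=\frac{z-x}{1-\bar x z}$. For $k\in\mathbb{N}=\{0,1,2,\dots\}$, $z\in\mathbb{D}$: $\mathbb{A}_k(z)=\{x\in\mathbb{D}:k\le d_{\mathbb{D}}(z,x)<k+1\}$. For a weight $W$ ($W\ge0$, $W\in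 L^1(\mathbb{D},dA)$), $A^2(\mathbb{D},W)$ is the space of holomorphic $f:\mathbb{D}\to\mathbb{C}$ with $\|f\|_W^2:=\int_{\mathbb{D}}|f|^2W\,dA<\infty$, and $\mathcal{B}(W)=\{f\in A^2(\mathbb{D},W):\|f\|_W<1\}$. For $s>1$: $g_X(s,z)=\sum_{x\in X}e^{-s d_{\mathbb{D}}(x,z)}$, $g_{\mathbb{P}_{K_{\mathbb{D}}}}(s)=\mathbb{E}_{\mathbb{P}_{K_{\mathbb{D}}}}[g_X(s,z)]$ (independent of $z$), and $g_X(s,z;f)=\sum_{k=0}^\infty\ \sum_{x\in X\cap\mathbb{A}_k(z)}e^{-s d_{\mathbb{D}}(z,x)}f(x)$; for fixed $s>1$, $z\in\mathbb{D}$, for $\mathbb{P}_{K_{\mathbb{D}}}$-almost every $X$ the outer series over $k$ converges simultaneously for all $f\in A^2(\mathbb{D},W_{\mathrm{cr}})$. *)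

(* Defs.v *)
From HB Require Import structures.
From mathcomp Require Import all_boot all_order all_algebra.
From mathcomp Require Export complex.
From mathcomp Require Import all_classical all_reals all_analysis measurable_realfun.
Set Implicit Arguments.
Unset Strict Implicit.
Unset Printing Implicit Defensive.
Import Order.TTheory GRing.Theory Num.Theory numFieldNormedType.Exports.
Local Open Scope classical_set_scope.
Local Open Scope ring_scope.
Local Open Scope complex_scope.
Local Open Scope card_scope.

(* The norm topology on C, as carried by every numeric field K through K^o.   *)
HB.instance Definition _ (R : realType) := NormedModule.copy R[i] R[i]^o.

(* `|z| lives in R[i]; cmod z is the same modulus as an element of R.         *)
Notation cmod := ComplexField.Normc.normc.

Section plane.
Variable R : realType.

Definition plane (p : R * R) : R[i] := p.1 +i* p.2.

(* The Borel sets of C, transported from R * R. The library's product         *)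
(* sigma-algebra on R * R is its Borel sigma-algebra, R being second          *)
(* countable.                                                                 *)
Definition cmeasurable : set (set R[i]) := [set A | measurable (plane @^-1` A)].

Let cmeasurable0 : cmeasurable set0.
Proof. by rewrite /cmeasurable/= preimage_set0; exact: measurable0. Qed.

Let cmeasurableC A : cmeasurable A -> cmeasurable (~` A).
Proof. by move=> mA; rewrite /cmeasurable/= preimage_setC; exact: measurableC. Qed.

Let cmeasurable_bigcup (F : (set R[i])^nat) :
  (forall i, cmeasurable (F i)) -> cmeasurable (\bigcup_i F i).
Proof.
by move=> mF; rewrite /cmeasurable/= preimage_bigcup; exact: bigcupT_measurable.
Qed.

HB.instance Definition _ := @isMeasurable.Build default_measure_display
  R[i] cmeasurable cmeasurable0 cmeasurableC cmeasurable_bigcup.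

Lemma measurable_plane : measurable_fun setT plane.
Proof. by move=> _ B mB; rewrite setTI; exact: mB. Qed.

Local Open Scope ereal_scope.

Definition clebesgue : set R[i] -> \bar R :=
  pushforward (@lebesgue_measure R \x @lebesgue_measure R) plane.

Let clebesgue0 : clebesgue set0 = 0.
Proof. by rewrite /clebesgue/pushforward preimage_set0 measure0. Qed.

Let clebesgue_ge0 A : 0 <= clebesgue A.
Proof. by rewrite /clebesgue/pushforward measure_ge0. Qed.

Let clebesgue_sigma_additive : semi_sigma_additive clebesgue.
Proof.
move=> F mF tF mUF; rewrite /clebesgue/pushforward preimage_bigcup.
apply: measure_semi_sigma_additive => //.
apply/trivIsetP => i j _ _ ij; rewrite -preimage_setI.
by move/trivIsetP : tF => /(_ _ _ _ _ ij) ->//; rewrite preimage_set0.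
Qed.

HB.instance Definition _ := isMeasure.Build _ _ _ clebesgue
  clebesgue0 clebesgue_ge0 clebesgue_sigma_additive.

End plane.

Section disk.
Variable R : realType.

Definition disk : set R[i] := [set z | `|z| < 1].

Lemma inv_pi_ge0 : 0 <= (pi : R)^-1.
Proof. by rewrite invr_ge0 pi_ge0. Qed.

(* Lebesgue measure on C divided by pi; every integral below is over the disk *)
(* (or a power of it), which has mass 1.                                      *)
Definition dA : {measure set R[i] -> \bar R} :=
  mscale (NngNum inv_pi_ge0) (@clebesgue R).

(* Integral over disk^n with respect to dA^n, as an iterated integral; it is  *)
(* only used for nonnegative measurable functions.                            *)
Fixpoint disk_pow_integral (n : nat) : (n.-tuple R[i] -> \bar R) -> \bar R :=
  match n with
  | 0 => fun F => F [tuple]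
  | m.+1 => fun F => (\int[dA]_(z in disk)
      disk_pow_integral (fun t : m.-tuple R[i] => F [tuple of z :: t]))%E
  end.

Definition bergman (z w : R[i]) : R[i] := ((1 - z * w^*%C) ^+ 2)^-1.

Definition mobius (x z : R[i]) : R[i] := (z - x) / (1 - x^*%C * z).

Definition dist (x z : R[i]) : R :=
  ln ((1 + cmod (mobius x z)) / (1 - cmod (mobius x z))).

Definition annulus (k : nat) (z : R[i]) : set R[i] :=
  [set x | disk x /\ (k%:R <= dist z x < k.+1%:R)].

End disk.

Section configurations.
Variable R : realType.

(* Configurations without multiplicities: this is where the point processes   *)
(* below are simple.                                                          *)
Record config := Config {
  points :> set R[i];
  points_disk : points `<=` @disk R;
  points_locally_finite : forall K : set R[i],
    compact K -> K `<=` @disk R -> finite_set (points `&` K) }.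

Let points_disk0 : set0 `<=` @disk R. Proof. exact: sub0set. Qed.

Let points_locally_finite0 (K : set R[i]) :
  compact K -> K `<=` @disk R -> finite_set (set0 `&` K).
Proof. by move=> _ _; rewrite set0I; exact: finite_set0. Qed.

HB.instance Definition _ := gen_eqMixin config.
HB.instance Definition _ := gen_choiceMixin config.
HB.instance Definition _ :=
  isPointed.Build config (Config points_disk0 points_locally_finite0).

(* The Borel sigma-algebra of the vague topology is the one generated by the  *)
(* counting maps X |-> #(X `&` B), B Borel.                                   *)
Definition counting_events : set (set config) :=
  [set E | exists (B : set R[i]) (n : nat),
    measurable B /\ E = [set X : config | X `&` B #= `I_n]].

Definition conf := g_sigma_algebraType counting_events.

End configurations.

Section determinantal.
Variable R : realType.
Local Open Scope ereal_scope.

Definition distinct_tuples (n : nat) (X : set R[i]) : set (n.-tuple R[i]) :=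
  [set t : n.-tuple R[i] | uniq t /\ forall i : 'I_n, X (tnth t i)].

Definition correlation_function (P : probability (conf R) R) (n : nat)
    (rho : n.-tuple R[i] -> R) : Prop :=
  forall phi : n.-tuple R[i] -> \bar R,
    measurable_fun setT phi -> (forall t, 0 <= phi t) ->
    \int[P]_X (\esum_(t in distinct_tuples (X : config R)) phi t) =
    disk_pow_integral (fun t => phi t * (rho t)%:E).

(* K is meant to be Hermitian nonnegative, so that the determinants are real. *)
Definition determinantal (P : probability (conf R) R)
    (K : R[i] -> R[i] -> R[i]) : Prop :=
  forall n : nat, (0 < n)%N ->
    correlation_function P (fun t : n.-tuple R[i] =>
      complex.Re (\det (\matrix_(i < n, j < n) K (tnth t i) (tnth t j)))).

End determinantal.

Section weighted_bergman.
Variable R : realType.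

Definition holomorphic_disk (f : R[i] -> R[i]) : Prop :=
  forall z, disk z -> derivable f z 1.

Definition wnorm_sq (W : R[i] -> R) (f : R[i] -> R[i]) : \bar R :=
  (\int[@dA R]_(z in @disk R) (cmod (f z) ^+ 2 * W z)%:E)%E.

Definition wnorm (W : R[i] -> R) (f : R[i] -> R[i]) : R :=
  Num.sqrt (fine (wnorm_sq W f)).

(* Elements are total functions; their values outside the disk are never      *)
(* used.                                                                      *)
Definition A2 (W : R[i] -> R) : set (R[i] -> R[i]) :=
  [set f | holomorphic_disk f /\ (wnorm_sq W f < +oo)%E].

Definition A2_ball (W : R[i] -> R) : set (R[i] -> R[i]) :=
  [set f | A2 W f /\ wnorm W f < 1].

Definition Wcr (z : R[i]) : R :=
  ((1 - cmod z ^+ 2) * ln (4 / (1 - cmod z ^+ 2)) ^+ 2)^-1.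

End weighted_bergman.

Section patterson_sullivan.
Variable R : realType.

Definition gX (X : config R) (s : R) (z : R[i]) : \bar R :=
  \esum_(x in (X : set R[i])) (expR (- s * dist x z))%:E.

Definition gP (P : probability (conf R) R) (s : R) (z : R[i]) : R :=
  fine (\int[P]_X gX X s z)%E.

Definition gXf (X : config R) (s : R) (z : R[i]) (f : R[i] -> R[i]) : R[i] :=
  limn (series (fun k : nat =>
    \sum_(x \in (X : set R[i]) `&` annulus k z)
      (expR (- s * dist z x))%:C * f x)).

End patterson_sullivan.

(* Main.v *)
From HB Require Import structures.
Require Import Defs.
From mathcomp Require Import all_boot all_order all_algebra.
From mathcomp Require Import complex finmap zify ring lra.
From mathcomp Require Import separable cyclotomic cyclic.
From mathcomp Require Import all_classical all_reals all_analysis measurable_realfun.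
Set Implicit Arguments.
Unset Strict Implicit.
Unset Printing Implicit Defensive.
Import Order.TTheory GRing.Theory Num.Theory numFieldNormedType.Exports.
Local Open Scope classical_set_scope.
Local Open Scope ring_scope.
Local Open Scope complex_scope.

(** Write e = s - 1, h_n(x) = exp(-s d(0,x)) x^n, and let S_n be the sum of
h_n over the points of X.

The supremum is a dual norm. The monomials are orthogonal in the weighted
Bergman space, because the weight is radial; if w_n is the squared norm of
z^n, testing against polynomials without constant term, for which f(0) = 0,
bounds the squared supremum from below by a constant times
g_P(s)^(-2) sum_n |S_n|^2 / w_n (sup_ge_qform). For the critical weight w_n
is at most 8 / ln n (integral_pow_wcr_le).

The random variables S_n fluctuate. For a determinantal process whose kernel
K is a projection, the variance of the sum of a function h over the points is
half the double integral of |h(x) - h(y)|^2 |K(x,y)|^2, and the inequality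
that makes it at least this much uses only that the integral of
|K(x,y)|^2 in y is at most K(x,x) (bergman_reproducing, variance_ge).
For h = h_n the double integral is bounded from below by confining x to the
ring where 1 - |x|^2 is between 1/(4n) and 1/(2n), and y to a box of side
1/(256 n), placed in the direction of x and so close to the circle that
|h_n(y)| is at most half of |h_n(x)|. There |K|^2 is at least n^4, while the
ring and the box have areas of order 1/n and 1/n^2, so that E|S_n|^2 is at
least c n^(1 - 2s) (hn_energy_ge, powstat_second_moment_ge).

Altogether the expectation is at least a constant times
g_P(s)^(-2) sum_n n^(-1 - 2e) ln n. On the range ln n <= 1/e the factor
n^(-2e) is at least exp(-2), and the sum of (ln n)/n over this range is of
order 1/e^2. As g_P(s) <= 1/e (gP_bounds), the two orders cancel, and the
bound does not depend on s (expectation_sup_ge_const).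

The supremum is over an uncountable family, and the expectation is treated as
the lower integral that it is by definition: a nonnegative measurable
minorant bounds it from below (ge0_le_lower_integral).

The facts of analysis behind these steps are obtained by elementary means.
Rotations of the plane are products of shears, hence preserve area. The law
of |z|^2 under area on the disk is uniform on [0,1[, by homogeneity and the
Gauss integral. Orthogonality of monomials for radial weights follows from
rotation invariance by averaging over roots of unity (disk_parseval). The
reproducing inequality comes from the Taylor polynomials of the kernel. *)

(** * Linear changes of variables in the plane *)

Section plane_lebesgue.
Variable R : realType.
Local Notation lam := (@lebesgue_measure R).
Local Notation mR := (measurableTypeR R).
Local Notation lam2 := (@lebesgue_measure R \x @lebesgue_measure R)%E.

(** The translate of Lebesgue measure agrees with it on intervals, and these determine it. *)
Lemma lebesgue_translate (a : R) (A : set mR) : measurable A ->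
  lam [set x | A (x + a)] = lam A.
Proof.
move=> mA.
have mf : measurable_fun setT (fun x : mR => x + a : mR) by exact: measurable_funD.
apply/esym; rewrite -[RHS]/(pushforward lam (fun x : mR => x + a : mR) A).
pose mf' := isMeasurableFun.Build _ _ _ _ _ mf.
pose F : {mfun _ >-> _} := HB.pack (fun x : mR => x + a : mR) mf'.
rewrite (@lebesgue_measure_unique R (pushforward lam F))//.
move=> _ [[b c]] _ <-.
transitivity (lam `](b - a)%R, (c - a)%R]%classic); last first.
  congr (lam _); apply/seteqP; split => x /=; by rewrite !in_itv/= ltrBlDr lerBrDr.
by rewrite !lebesgue_measure_itv/= !lte_fin ltrD2r -!EFinB; case: ifP => // _; congr EFin; ring.
Qed.

Lemma lebesgue_dilate (a : R) (A : set mR) : 0 < a -> measurable A ->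
  (a%:E * lam [set x | A (a * x)%R])%E = lam A.
Proof.
move=> a0 mA.
have mf : measurable_fun setT (fun x : mR => a * x : mR) by exact: measurable_funM.
pose mf' := isMeasurableFun.Build _ _ _ _ _ mf.
pose F : {mfun _ >-> _} := HB.pack (fun x : mR => a * x : mR) mf'.
rewrite [RHS](@lebesgue_measure_unique R (mscale (NngNum (ltW a0)) (pushforward lam F)))//.
move=> _ [[b c]] _ <-.
transitivity (a%:E * lam `](b / a)%R, (c / a)%R]%classic)%E; last first.
  congr (_ * lam _)%E; apply/seteqP; split => x /=;
    by rewrite !in_itv/= ltr_pdivrMr// ler_pdivlMr// ![x * a]mulrC.
rewrite !lebesgue_measure_itv/= !lte_fin ltr_pM2r ?invr_gt0// -!EFinB; case: ifP => _.
  by rewrite -EFinM; congr EFin; field; rewrite gt_eqF.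
by rewrite mule0.
Qed.

Definition area_preserving (T : R * R -> R * R) :=
  measurable_fun setT (T : mR * mR -> mR * mR) /\
  forall A : set (mR * mR), measurable A -> lam2 (T @^-1` A) = lam2 A.

Lemma area_preserving_comp S T :
  area_preserving S -> area_preserving T -> area_preserving (S \o T).
Proof.
move=> [mS aS] [mT aT]; split; first exact: measurableT_comp.
move=> A mA; rewrite comp_preimage aT ?aS//.
by rewrite -[X in measurable X]setTI; exact: mS.
Qed.

(** On each vertical line a shear is a translation, so the sections of a set keep their length. *)
Lemma area_preserving_shear2 (a : R) :
  area_preserving (fun p => (p.1, p.2 + a * p.1)).
Proof.
have mT : measurable_fun setT ((fun p => (p.1, p.2 + a * p.1)) : mR * mR -> mR * mR).
  apply: measurable_fun_pair; first exact: measurable_fst.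
  by apply: measurable_funD; [exact: measurable_snd|apply: measurable_funM => //; exact: measurable_fst].
split => // A mA; rewrite /= /product_measure1/=.
apply: eq_integral => x _; rewrite /= /xsection/=.
rewrite -[RHS](@lebesgue_translate (a * x)); last exact: measurable_xsection.
by congr (lam _); apply/seteqP; split => y /=; rewrite !inE.
Qed.

Lemma area_preserving_swap : area_preserving (fun p => (p.2, p.1)).
Proof.
have mT : measurable_fun setT ((fun p => (p.2, p.1)) : mR * mR -> mR * mR).
  by apply: measurable_fun_pair; [exact: measurable_snd|exact: measurable_fst].
split => // A mA.
pose mf' := isMeasurableFun.Build _ _ _ _ _ mT.
pose F : {mfun _ >-> _} := HB.pack ((fun p => (p.2, p.1)) : mR * mR -> mR * mR) mf'.
rewrite -[LHS]/(pushforward lam2 F A).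
rewrite -(@product_measure_unique _ _ _ _ _ lam lam (pushforward lam2 F))//.
move=> B C mB mC; transitivity (lam2 (C `*` B)).
  by congr (lam2 _); apply/seteqP; split => -[x y] /= [].
by rewrite product_measure1E// muleC.
Qed.

Lemma area_preserving_shear1 (a : R) :
  area_preserving (fun p => (p.1 + a * p.2, p.2)).
Proof.
have := area_preserving_comp area_preserving_swap
  (area_preserving_comp (area_preserving_shear2 a) area_preserving_swap).
by rewrite /comp/=.
Qed.

(** A rotation that is not a half-turn or the identity is a product of three
shears, with slopes (c - 1)/s, s and (c - 1)/s. *)
Lemma area_preserving_rotation (c s : R) : c ^+ 2 + s ^+ 2 = 1 ->
  area_preserving (fun p => (c * p.1 - s * p.2, s * p.1 + c * p.2)).
Proof.
move=> cs1.
have [s0|s0] := eqVneq s 0.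
  move: cs1; rewrite s0 expr0n/= addr0 => /eqP; rewrite sqrf_eq1 => /orP[|] /eqP ->.
    have -> : (fun p : R * R => (1 * p.1 - 0 * p.2, 0 * p.1 + 1 * p.2)) = id.
      by apply/funext => -[x y]/=; rewrite !mul0r !mul1r subr0 add0r.
    by split => //; exact: measurable_id.
  (* For s = 0 the slopes are undefined; the half-turn is the square of a quarter-turn. *)
  have q : area_preserving (fun p => (- p.2, p.1)).
    have := area_preserving_comp (area_preserving_shear1 (-1))
      (area_preserving_comp (area_preserving_shear2 1) (area_preserving_shear1 (-1))).
    congr area_preserving; apply/funext => -[x y] /=; congr (_, _); ring.
  have := area_preserving_comp q q.
  by congr area_preserving; apply/funext => -[x y] /=; congr (_, _); ring.
have := area_preserving_comp (area_preserving_shear1 ((c - 1) / s))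
  (area_preserving_comp (area_preserving_shear2 s) (area_preserving_shear1 ((c - 1) / s))).
congr area_preserving; apply/funext => -[x y] /=; congr (_, _).
  have -> : x + (c - 1) / s * y + (c - 1) / s * (y + s * (x + (c - 1) / s * y))
    = c * x + (c ^+ 2 - 1) / s * y by field.
  by rewrite -cs1; field.
by field.
Qed.

(** Both sides are measures in A which agree on rectangles. *)
Lemma area_dilate (a : R) (A : set (mR * mR)) : 0 < a -> measurable A ->
  ((a ^+ 2)%:E * lam2 [set p | A (a * p.1, a * p.2)%R])%E = lam2 A.
Proof.
move=> a0 mA.
have mT : measurable_fun setT ((fun p => (a * p.1, a * p.2)) : mR * mR -> mR * mR).
  by apply: measurable_fun_pair; apply: measurable_funM.
pose mf' := isMeasurableFun.Build _ _ _ _ _ mT.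
pose F : {mfun _ >-> _} := HB.pack ((fun p => (a * p.1, a * p.2)) : mR * mR -> mR * mR) mf'.
have a2 : 0 <= a ^+ 2 by exact: sqr_ge0.
rewrite [RHS](@product_measure_unique _ _ _ _ _ lam lam (mscale (NngNum a2) (pushforward lam2 F)))//.
move=> B C mB mC.
transitivity ((a ^+ 2)%:E * lam2 ([set x | B (a * x)%R] `*` [set x | C (a * x)%R]))%E.
  by congr (_ * lam2 _)%E; apply/seteqP; split => -[x y].
have m1 D : measurable D -> measurable [set x : mR | D (a * x)].
  move=> mD; rewrite -[X in measurable X]setTI.
  by have : measurable_fun setT (fun x : mR => a * x : mR); [exact: measurable_funM|exact].
rewrite product_measure1E; [|exact: m1..].
by rewrite expr2 EFinM -muleA [X in (_ * X)%E]muleCA muleA !lebesgue_dilate.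
Qed.

End plane_lebesgue.

(** * Squared modulus, measurability and discs *)

Section disk_measure.
Variable R : realType.
Local Notation mR := (measurableTypeR R).
Local Notation lam2 := (@lebesgue_measure R \x @lebesgue_measure R)%E.

(** The square of the modulus, kept polynomial in the coordinates. *)
Definition sqnorm (z : R[i]) : R := complex.Re z ^+ 2 + complex.Im z ^+ 2.

Lemma sqnorm_ge0 z : 0 <= sqnorm z.
Proof. by rewrite addr_ge0// sqr_ge0. Qed.

Lemma cmodE z : cmod z = Num.sqrt (sqnorm z).
Proof. by case: z. Qed.

Lemma sqr_cmod z : cmod z ^+ 2 = sqnorm z.
Proof. by rewrite cmodE sqr_sqrtr// sqnorm_ge0. Qed.

Lemma cmod_ge0 (z : R[i]) : 0 <= cmod z.
Proof. by rewrite cmodE sqrtr_ge0. Qed.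

Lemma sqnormM z w : sqnorm (z * w) = sqnorm z * sqnorm w.
Proof. by case: z => a b; case: w => c d; rewrite /sqnorm /=; ring. Qed.

Lemma sqnorm_conj z : sqnorm z^*%C = sqnorm z.
Proof. by case: z => a b; rewrite /sqnorm/=; ring. Qed.

Lemma sqnormX z n : sqnorm (z ^+ n) = sqnorm z ^+ n.
Proof.
elim: n => [|n ih]; last by rewrite !exprS sqnormM ih.
by rewrite !expr0 /sqnorm/=; ring.
Qed.

Lemma diskE (z : R[i]) : disk z <-> sqnorm z < 1.
Proof.
rewrite /disk/= normc_def ltcR -/(sqnorm z) /= -[X in _ < X]sqrtr1 ltr_sqrt//.
Qed.

Lemma measurable_Re : measurable_fun setT (@complex.Re R : R[i] -> mR).
Proof.
move=> _ B mB; rewrite setTI; rewrite /measurable/= /cmeasurable/=.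
by rewrite -[X in measurable X]setTI; exact: measurable_fst.
Qed.

Lemma measurable_Im : measurable_fun setT (@complex.Im R : R[i] -> mR).
Proof.
move=> _ B mB; rewrite setTI; rewrite /measurable/= /cmeasurable/=.
by rewrite -[X in measurable X]setTI; exact: measurable_snd.
Qed.

Lemma measurable_complex d (T : measurableType d) (f : T -> R[i]) :
  measurable_fun setT (@complex.Re R \o f : T -> mR) -> measurable_fun setT (@complex.Im R \o f : T -> mR) ->
  measurable_fun setT f.
Proof.
move=> mr mi.
have -> : f = @plane R \o (fun x => (complex.Re (f x), complex.Im (f x))).
  by apply/funext => x /=; rewrite /plane/=; case: (f x).
apply: measurableT_comp; first exact: measurable_plane.
exact: measurable_fun_pair.
Qed.

Lemma measurable_sqnorm d (T : measurableType d) (f : T -> R[i]) :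
  measurable_fun setT f -> measurable_fun setT (sqnorm \o f : T -> mR).
Proof.
move=> mf; apply: (@measurable_funD _ _ _ setT); apply: measurable_funX.
  exact: (measurableT_comp measurable_Re).
exact: (measurableT_comp measurable_Im).
Qed.

Lemma measurable_cmod d (T : measurableType d) (f : T -> R[i]) :
  measurable_fun setT f -> measurable_fun setT ((fun x => cmod (f x)) : T -> mR).
Proof.
move=> mf; under eq_fun do rewrite cmodE.
have -> : (fun x => Num.sqrt (sqnorm (f x))) = (fun x => powR (sqnorm (f x)) 2^-1).
  by apply/funext => x; rewrite powR12_sqrt ?sqnorm_ge0.
apply: (@measurableT_comp _ _ _ _ _ _ (fun x : mR => x `^ 2^-1)); first exact: measurable_powR.
exact: measurable_sqnorm.
Qed.

Lemma measurable_mulc d (T : measurableType d) (f g : T -> R[i]) :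
  measurable_fun setT f -> measurable_fun setT g ->
  measurable_fun setT (fun x => f x * g x).
Proof.
move=> mf mg.
have mfr := measurableT_comp measurable_Re mf; have mfi := measurableT_comp measurable_Im mf.
have mgr := measurableT_comp measurable_Re mg; have mgi := measurableT_comp measurable_Im mg.
apply: measurable_complex.
  have -> : (@complex.Re R \o (fun x => f x * g x)) = (fun x =>
     complex.Re (f x) * complex.Re (g x) - complex.Im (f x) * complex.Im (g x)).
    by apply/funext => x /=; case: (f x); case: (g x).
  by apply: measurable_funB; apply: measurable_funM.
have -> : (@complex.Im R \o (fun x => f x * g x)) = (fun x =>
     complex.Re (f x) * complex.Im (g x) + complex.Im (f x) * complex.Re (g x)).
  by apply/funext => x /=; case: (f x); case: (g x).
by apply: measurable_funD; apply: measurable_funM.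
Qed.

Lemma measurable_addc d (T : measurableType d) (f g : T -> R[i]) :
  measurable_fun setT f -> measurable_fun setT g ->
  measurable_fun setT (fun x => f x + g x).
Proof.
move=> mf mg.
have mfr := measurableT_comp measurable_Re mf; have mfi := measurableT_comp measurable_Im mf.
have mgr := measurableT_comp measurable_Re mg; have mgi := measurableT_comp measurable_Im mg.
apply: measurable_complex.
  have -> : (@complex.Re R \o (fun x => f x + g x)) = (fun x =>
     complex.Re (f x) + complex.Re (g x)).
    by apply/funext => x /=; case: (f x); case: (g x).
  exact: measurable_funD.
have -> : (@complex.Im R \o (fun x => f x + g x)) = (fun x =>
     complex.Im (f x) + complex.Im (g x)).
  by apply/funext => x /=; case: (f x); case: (g x).
exact: measurable_funD.
Qed.

Lemma measurable_conjc d (T : measurableType d) (f : T -> R[i]) :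
  measurable_fun setT f -> measurable_fun setT (fun x => (f x)^*%C).
Proof.
move=> mf.
have mfr := measurableT_comp measurable_Re mf; have mfi := measurableT_comp measurable_Im mf.
apply: measurable_complex.
  have -> // : (@complex.Re R \o (fun x => (f x)^*%C)) = (fun x => complex.Re (f x)).
    by apply/funext => x /=; case: (f x).
have -> : (@complex.Im R \o (fun x => (f x)^*%C)) = (fun x => - complex.Im (f x)).
  by apply/funext => x /=; case: (f x).
exact: measurable_funN.
Qed.

Lemma measurable_expc d (T : measurableType d) (f : T -> R[i]) n :
  measurable_fun setT f -> measurable_fun setT (fun x => f x ^+ n).
Proof.
move=> mf; elim: n => [|n ih].
  by under eq_fun do rewrite expr0; exact: measurable_cst.
by under eq_fun do rewrite exprS; exact: measurable_mulc.
Qed.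

Lemma measurable_disk : measurable (@disk R).
Proof.
have -> : @disk R = setT `&` (sqnorm @^-1` `]-oo, 1[%classic).
  by rewrite setTI; apply/seteqP; split => z /=; rewrite in_itv/= => /diskE.
have /(_ measurableT) := @measurable_sqnorm _ R[i] id (@measurable_id _ _ setT); apply.
exact: measurable_itv.
Qed.

(** The area of the unit disc; only the Gauss integral below reveals that it is pi. *)
Definition disc_area := lam2 [set p | p.1 ^+ 2 + p.2 ^+ 2 <= 1].

Definition sqn2 (p : mR * mR) : mR := p.1 ^+ 2 + p.2 ^+ 2.

Lemma measurable_sqn2 : measurable_fun setT sqn2.
Proof. by apply: (@measurable_funD _ _ _ setT); apply: measurable_funX. Qed.

Lemma measurable_disc u : measurable [set p : mR * mR | p.1 ^+ 2 + p.2 ^+ 2 <= u].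
Proof.
have := @measurable_sqn2 measurableT `]-oo, u]%classic (measurable_itv _).
by rewrite setTI; congr measurable; apply/seteqP; split => p /=; rewrite in_itv.
Qed.

Lemma disc_area_lty : (disc_area < +oo)%E.
Proof.
apply: (@le_lt_trans _ _ (lam2 (`[(-1)%R, 1%R]%classic `*` `[(-1)%R, 1%R]%classic))).
  apply: le_measure; rewrite ?inE.
  - exact: measurable_disc.
  - by apply: measurableX; exact: measurable_itv.
  - move=> [x y] /= h; rewrite !in_itv/=.
    by split; apply/andP; split; nra.
rewrite product_measure1E; [|exact: measurable_itv..].
rewrite /= lebesgue_measure_itv/= lte_fin; case: ifP => _; by rewrite -?EFinB -?EFinM ?ltry// mule0 ltry.
Qed.

Lemma disc_area_gt0 : (0 < disc_area)%E.
Proof.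
apply: (@lt_le_trans _ _ (lam2 (`[0%R, (2^-1)%R]%classic `*` `[0%R, (2^-1)%R]%classic))).
  rewrite product_measure1E; [|exact: measurable_itv..].
  rewrite /= lebesgue_measure_itv/= lte_fin invr_gt0 ltr0n -EFinB -EFinM lte_fin.
  by rewrite subr0 mulr_gt0// invr_gt0.
apply: le_measure; rewrite ?inE.
  - by apply: measurableX; exact: measurable_itv.
  - exact: measurable_disc.
move=> [x y] /=; rewrite !in_itv/= => -[/andP[x0 x1] /andP[y0 y1]].
by nra.
Qed.

(** By the dilation of ratio sqrt u. *)
Lemma disc_area_scale u : 0 <= u ->
  lam2 [set p | p.1 ^+ 2 + p.2 ^+ 2 <= u] = (u%:E * disc_area)%E.
Proof.
rewrite le_eqVlt => /orP[/eqP <-|u0].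
  rewrite mul0e; transitivity (lam2 ([set 0%R] `*` [set 0%R])).
    congr (lam2 _); apply/seteqP; split => -[x y] /=; last first.
      by move=> [-> ->]; rewrite expr0n/= addr0.
    move=> h; split; apply/eqP; rewrite -sqrf_eq0; nra.
  by rewrite product_measure1E//= lebesgue_measure_set1 mul0e.
rewrite -[LHS](@area_dilate _ (Num.sqrt u)); [|by rewrite sqrtr_gt0|exact: measurable_disc].
rewrite (sqr_sqrtr (ltW u0)); congr (_ * lam2 _)%E; apply/seteqP.
have E (x y : R) : (Num.sqrt u * x) ^+ 2 + (Num.sqrt u * y) ^+ 2 = u * (x ^+ 2 + y ^+ 2).
  by rewrite !exprMn sqr_sqrtr ?ltW// mulrDr.
by split => -[x y] /=; rewrite (E x y) -{2}[u]mulr1 ler_pM2l.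
Qed.

End disk_measure.

(** * The law of the squared modulus *)

Section radial.
Variable R : realType.
Local Notation lam := (@lebesgue_measure R).
Local Notation mR := (measurableTypeR R).
Local Notation lam2 := (@lebesgue_measure R \x @lebesgue_measure R)%E.
Local Notation area := (fine (disc_area R)).

Lemma disc_areaK : disc_area R = area%:E.
Proof.
by rewrite fineK// ge0_fin_numE ?disc_area_lty// ltW// disc_area_gt0.
Qed.

Lemma fine_disc_area_gt0 : 0 < area.
Proof. by rewrite -lte_fin -disc_areaK disc_area_gt0. Qed.

(** Discs have area proportional to their squared radius, so |p|^2 has, up to the
factor area, the law of Lebesgue measure on the half-line. To apply uniqueness of
Lebesgue measure on the whole line, the law is completed by Lebesgue measure on the
negative half-line. *)
Lemma sqn2_law (A : set mR) : measurable A -> A `<=` [set u | 0 <= u] ->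
  lam2 (@sqn2 R @^-1` A) = (area%:E * lam A)%E.
Proof.
move=> mA A0.
pose mf' := isMeasurableFun.Build _ _ _ _ _ (@measurable_sqn2 R).
pose F : {mfun _ >-> _} := HB.pack (@sqn2 R) mf'.
have d0 : 0 <= area^-1 by rewrite invr_ge0 ltW// fine_disc_area_gt0.
have mN : measurable (`]-oo, 0[%classic : set mR) by exact: measurable_itv.
have disc0 u : u < 0 -> (@sqn2 R @^-1` `]-oo, u]%classic) = set0.
  move=> u0; apply/seteqP; split => p //=; rewrite in_itv/= => h.
  have : 0 <= sqn2 p by rewrite /sqn2 addr_ge0// sqr_ge0.
  by move=> /le_trans/(_ h); rewrite leNgt u0.
have disc1 u : 0 <= u -> lam2 (@sqn2 R @^-1` `]-oo, u]%classic) = (u * area)%:E.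
  move=> u0; rewrite EFinM -disc_areaK -disc_area_scale//.
have mdisc u : measurable (@sqn2 R @^-1` `]-oo, u]%classic).
  rewrite -[X in measurable X]setTI; apply: measurable_sqn2 => //.
have E : lam A = (area^-1%:E * lam2 (@sqn2 R @^-1` A) + lam (A `&` `]-oo, 0%R[%classic))%E.
  rewrite [LHS](@lebesgue_measure_unique R
    (measure_add (mscale (NngNum d0) (pushforward lam2 F)) (mrestr lam mN)))//; first exact: measure_addE.
  move=> _ [[b c]] _ <-.
  rewrite [RHS]measure_addE.
  rewrite -[RHS]/(area^-1%:E * lam2 (@sqn2 R @^-1` `]b, c]%classic)
    + lam (`]b, c]%classic `&` `]-oo, 0%R[%classic))%E.
  have -> : @sqn2 R @^-1` `]b, c]%classic = ((@sqn2 R @^-1` `]-oo, c]%classic) `\` (@sqn2 R @^-1` `]-oo, b]%classic)).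
    apply/seteqP; split => p /=; rewrite !in_itv/=.
      by move=> /andP[? ?]; split => //; apply/negP; rewrite -ltNge.
    by move=> [? /negP]; rewrite -ltNge => ->.
  have [cb|bc] := leP c b.
    have -> : `]b, c]%classic = set0 :> set R.
      by apply/seteqP; split => x //=; rewrite in_itv/= => /andP[/lt_le_trans h /h]; rewrite ltNge cb.
    rewrite set0I !measure0 adde0.
    have -> : (@sqn2 R @^-1` `]-oo, c]%classic `\` @sqn2 R @^-1` `]-oo, b]%classic) = set0.
      by apply/seteqP; split => p //=; rewrite !in_itv/= => -[/le_trans/(_ cb)].
    by rewrite measure0 mule0.
  have [c0|c0] := ltP c 0.
    rewrite (disc0 _ c0) set0D measure0 mule0 add0e.
    congr (lam _); apply/seteqP; split => x /=; rewrite !in_itv/=; last by case.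
    by move=> /andP[bx xc]; rewrite bx xc (le_lt_trans xc c0).
  have [b0|b0] := ltP b 0.
    rewrite (disc0 _ b0) setD0 disc1// -EFinM.
    have -> : `]b, c]%classic `&` `]-oo, 0%R[%classic = `]b, 0%R[%classic :> set R.
      apply/seteqP; split => x /=; rewrite !in_itv/=; first by move=> [/andP[-> _] ->].
      by move=> /andP[-> x0]; split => //=; rewrite (le_trans (ltW x0)).
    rewrite !lebesgue_measure_itv/= !lte_fin bc b0 -!EFinB -EFinD sub0r; congr EFin.
    by field; rewrite gt_eqF// fine_disc_area_gt0.
  have -> : `]b, c]%classic `&` `]-oo, 0%R[%classic = set0 :> set R.
    apply/seteqP; split => x //=; rewrite !in_itv/= => -[/andP[bx _] x0].
    by move: (lt_trans bx x0); rewrite ltNge b0.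
  rewrite measure0 adde0 measureD//; last first.
    by rewrite [X in (X < _)%E](disc1 _ c0) ltry.
  rewrite setIidr; last first.
    by move=> p /=; rewrite !in_itv/= => /le_trans; apply; exact: ltW.
  rewrite [X in (X - _)%E](disc1 _ c0) [X in (_ - X)%E](disc1 _ b0).
  rewrite lebesgue_measure_itv/= lte_fin bc -!EFinB -EFinM; congr EFin.
  by field; rewrite gt_eqF// fine_disc_area_gt0.
rewrite E.
have -> : A `&` `]-oo, 0%R[%classic = set0.
  by apply/seteqP; split => x //=; rewrite in_itv/= => -[/A0 /=]; rewrite leNgt => /negP.
rewrite measure0 adde0 muleA -EFinM divff ?mul1e//.
by rewrite gt_eqF// fine_disc_area_gt0.
Qed.

Lemma ge0_integral_sqn2 (f : mR -> \bar R) : measurable_fun setT f -> (forall x, 0 <= f x)%E ->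
  (\int[lam2]_p f (sqn2 p) = area%:E * \int[lam]_(x in `[0%R, +oo[) f x)%E.
Proof.
move=> mf f0.
pose mf' := isMeasurableFun.Build _ _ _ _ _ (@measurable_sqn2 R).
pose F : {mfun _ >-> _} := HB.pack (@sqn2 R) mf'.
have mP : measurable (`[0, +oo[%classic : set mR) by exact: measurable_itv.
rewrite -(ge0_integral_mscale _ mP (NngNum (ltW fine_disc_area_gt0)))//; last first.
  exact: measurable_funTS.
transitivity (\int[pushforward lam2 F]_(x in `[0%R, +oo[) f x)%E; last first.
  apply: eq_measure_integral => A mA A0.
  rewrite -[RHS]/(area%:E * lam A)%E -sqn2_law// => x /A0 /=.
  by rewrite in_itv/= andbT.
rewrite ge0_integral_pushforward//; last exact: measurable_funTS.
congr (integral _ _ _); apply/seteqP; split => p //= _.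
by rewrite in_itv/= andbT addr_ge0// sqr_ge0.
Qed.

Lemma integral0y_expRN : (\int[lam]_(x in `[0%R, +oo[) (expR (- x))%:E = 1)%E.
Proof.
rewrite -(integral_exponential_pdf (@ltr01 R)) integral_mkcond.
apply: eq_integral => x _; rewrite /exponential_pdf !patchE.
by case: ifP => // _; rewrite mulNr !mul1r.
Qed.

(** The integral of exp(-|p|^2) over the plane is the area of the unit disc by the radial
law, and the square of the Gauss integral, that is pi, by Fubini. *)
Lemma disc_areaE : area = pi.
Proof.
have mg : measurable_fun setT (fun x : mR => (expR (- x))%:E).
  by apply/measurable_EFinP; apply: (@measurableT_comp _ _ _ _ _ _ expR).
have := @ge0_integral_sqn2 (fun x => (expR (- x))%:E) mg (fun x => expR_ge0 _).
rewrite integral0y_expRN mule1.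
rewrite fubini_tonelli1; last 2 first.
  by apply: (measurableT_comp mg); exact: measurable_sqn2.
  by move=> x; rewrite lee_fin expR_ge0.
rewrite /fubini_F/=.
have E x : (\int[lam]_y (expR (- sqn2 (x, y)))%:E = (gauss_fun x)%:E * (Num.sqrt pi)%:E)%E.
  rewrite -integralT_gauss -ge0_integralZl//.
  - by apply: eq_integral => y _; rewrite -EFinM /gauss_fun -expRD /sqn2/= opprD.
  - by apply/measurable_EFinP; exact: measurable_gauss_fun.
  - by move=> y _; rewrite lee_fin gauss_fun_ge0.
  - by rewrite lee_fin gauss_fun_ge0.
under eq_integral do rewrite E.
rewrite ge0_integralZr//; last 2 first.
  - by apply/measurable_EFinP; exact: measurable_gauss_fun.
  - by move=> y _; rewrite lee_fin gauss_fun_ge0.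
rewrite integralT_gauss -EFinM -expr2 sqr_sqrtr ?pi_ge0// => -[].
by move=> ->.
Qed.

End radial.

(** * Normalized area on the unit disk *)

Section disk_integral.
Variable R : realType.
Local Notation lam := (@lebesgue_measure R).
Local Notation mR := (measurableTypeR R).
Local Notation lam2 := (@lebesgue_measure R \x @lebesgue_measure R)%E.

(** The measure dA restricted to the disk, as a measure on the whole plane: integrals over
the disk become integrals over a type, to which Fubini's theorem applies directly. *)
Definition disk_mu : set R[i] -> \bar R := mrestr (@dA R) (@measurable_disk R).
HB.instance Definition _ := Measure.on disk_mu.

Lemma disk_muE A : disk_mu A = ((pi^-1)%:E * lam2 (@plane R @^-1` (A `&` @disk R)))%E.
Proof. by []. Qed.

(** The normalization by pi cancels the factor of sqn2_law, so that |z|^2 is uniform on [0,1[. *)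
Lemma disk_mu_law (A : set mR) : measurable A ->
  disk_mu (@sqnorm R @^-1` A) = lam (A `&` `[0, 1[%classic).
Proof.
move=> mA; rewrite disk_muE.
have -> : @plane R @^-1` (@sqnorm R @^-1` A `&` @disk R) = @sqn2 R @^-1` (A `&` `[0, 1[%classic).
  apply/seteqP; split => p /=; rewrite in_itv/=.
    by move=> [Ap /diskE p1]; split => //; rewrite p1 andbT addr_ge0// sqr_ge0.
  by move=> [Ap /andP[_ p1]]; split => //; apply/diskE.
rewrite sqn2_law.
- by rewrite disc_areaE muleA -EFinM mulVf ?mul1e// gt_eqF// pi_gt0.
- by apply: measurableI => //; exact: measurable_itv.
- by move=> x [_]; rewrite /= in_itv/= => /andP[].
Qed.

Lemma disk_muT : disk_mu setT = 1%E.
Proof.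
rewrite -(preimage_setT (@sqnorm R)) disk_mu_law// setTI lebesgue_measure_itv/=.
by rewrite lte_fin ltr01 -EFinB subr0.
Qed.

Let disk_mu_fin : fin_num_fun disk_mu.
Proof.
move=> A mA; rewrite ge0_fin_numE ?measure_ge0//.
apply: (@le_lt_trans _ _ (disk_mu setT)); last by rewrite disk_muT ltry.
by apply: le_measure; rewrite ?inE.
Qed.

HB.instance Definition _ := Measure_isFinite.Build _ _ _ disk_mu disk_mu_fin.

Lemma disk_mu_notdisk : disk_mu (~` @disk R) = 0%E.
Proof. by rewrite /disk_mu /mrestr setICl measure0. Qed.

Lemma ge0_integral_disk (f : R[i] -> \bar R) : measurable_fun setT f -> (forall z, 0 <= f z)%E ->
  (\int[@dA R]_(z in @disk R) f z = \int[disk_mu]_z f z)%E.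
Proof.
move=> mf f0.
transitivity (\int[disk_mu]_(z in @disk R) f z)%E.
  by apply: eq_measure_integral => A mA AD; rewrite -[RHS]/(dA R (A `&` @disk R)) setIidl.
rewrite [RHS](@ge0_negligible_integral _ _ _ _ _ (~` @disk R))//.
- by rewrite setTD setCK.
- by apply: measurableC; exact: measurable_disk.
- exact: disk_mu_notdisk.
Qed.

Lemma le_integral_disk (f g : R[i] -> \bar R) : (forall z, disk z -> f z <= g z)%E ->
  measurable_fun setT f -> measurable_fun setT g ->
  (forall z, 0 <= f z)%E -> (forall z, 0 <= g z)%E ->
  (\int[disk_mu]_z f z <= \int[disk_mu]_z g z)%E.
Proof.
move=> fg mf mg f0 g0; rewrite -!ge0_integral_disk//.
apply: ge0_le_integral => //; [exact: measurable_disk|exact: measurable_funTS..].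
Qed.

Lemma ge0_integral_sqnorm (f : mR -> \bar R) : measurable_fun setT f -> (forall x, 0 <= f x)%E ->
  (\int[disk_mu]_z f (sqnorm z) = \int[lam]_(x in `[0%R, 1%R[) f x)%E.
Proof.
move=> mf f0.
have mq : measurable_fun setT (@sqnorm R : R[i] -> mR).
  exact: (@measurable_sqnorm R _ R[i] id (@measurable_id _ _ setT)).
pose mf' := isMeasurableFun.Build _ _ _ _ _ mq.
pose F : {mfun _ >-> _} := HB.pack (@sqnorm R : R[i] -> mR) mf'.
have mI : measurable (`[0, 1[%classic : set mR) by exact: measurable_itv.
transitivity (\int[pushforward disk_mu F]_x f x)%E.
  by rewrite ge0_integral_pushforward.
transitivity (\int[mrestr lam mI]_x f x)%E.
  by apply: eq_measure_integral => A mA _; exact: disk_mu_law.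
rewrite (@ge0_negligible_integral _ _ _ _ _ (~` (`[0, 1[%classic : set mR)))//.
- rewrite setTD setCK; apply: eq_measure_integral => A mA AD.
  by rewrite -[LHS]/(lam (A `&` `[0, 1[%classic)) setIidl.
- exact: measurableC.
- by rewrite -[LHS]/(lam (~` `[0, 1[%classic `&` `[0, 1[%classic)) setICl measure0.
Qed.

(** Multiplication by a unimodular number is a rotation. *)
Lemma ge0_integral_disk_rot (w : R[i]) (f : R[i] -> \bar R) : sqnorm w = 1 ->
  measurable_fun setT f -> (forall z, 0 <= f z)%E ->
  (\int[disk_mu]_z f (w * z)%R = \int[disk_mu]_z f z)%E.
Proof.
move=> w1 mf f0.
have mq : measurable_fun setT (fun z : R[i] => w * z).
  by apply: measurable_mulc; [exact: measurable_cst|exact: measurable_id].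
pose mf' := isMeasurableFun.Build _ _ _ _ _ mq.
pose F : {mfun _ >-> _} := HB.pack (fun z : R[i] => w * z) mf'.
transitivity (\int[pushforward disk_mu F]_x f x)%E.
  by rewrite ge0_integral_pushforward.
apply: eq_measure_integral => A mA _.
rewrite -[LHS]/(disk_mu [set z | A (w * z)]) !disk_muE; congr (_ * _)%E.
have mAD : measurable (A `&` @disk R) by apply: measurableI => //; exact: measurable_disk.
have [_ /(_ (@plane R @^-1` (A `&` @disk R)) mAD) h] := area_preserving_rotation w1.
apply: etrans h.
congr (lam2 _); case: w w1 {mq mf' F} => a b w1.
apply/seteqP; split => -[x y] /=.
  move=> [Aw /diskE h]; rewrite /plane/= in Aw *; split; first by rewrite /= [b * x + _]addrC.
  apply/diskE; move: h; rewrite /plane [b * x + _]addrC.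
  by rewrite -[X in _ -> sqnorm X < _]/((a +i* b) * (x +i* y)) sqnormM w1 mul1r.
move=> [Aw /diskE h]; rewrite /plane/= in Aw *; split; first by rewrite [b * x + _]addrC in Aw.
apply/diskE; move: h; rewrite /plane [b * x + _]addrC.
by rewrite -[X in sqnorm X < _ -> _]/((a +i* b) * (x +i* y)) sqnormM w1 mul1r.
Qed.

Lemma disk_mu_rect (a b c d : R) : a <= b -> c <= d ->
  (forall x y, a <= x <= b -> c <= y <= d -> disk (x +i* y)) ->
  let A := [set z : R[i] | a <= complex.Re z <= b /\ c <= complex.Im z <= d] in
  measurable A /\ disk_mu A = ((b - a) * (d - c) / pi)%:E.
Proof.
move=> ab cd rD A.
have E : @plane R @^-1` A = `[a, b]%classic `*` `[c, d]%classic.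
  by apply/seteqP; split => -[x y] /=; rewrite !in_itv.
split.
  by rewrite /measurable/= /cmeasurable/= E; apply: measurableX; exact: measurable_itv.
rewrite disk_muE setIidl; last by move=> -[x y] /= [? ?]; exact: rD.
rewrite E product_measure1E; [|exact: measurable_itv..].
have L (u v : R) : u <= v -> lam `[u, v]%classic = (v - u)%:E.
  move=> uv; rewrite lebesgue_measure_itv/= lte_fin; case: ltP => //.
  by move=> vu; rewrite (@le_anti _ _ u v) ?subrr// uv.
rewrite -[X in (_ * X)%E]/(lam `[a, b]%classic * lam `[c, d]%classic)%E !L//.
by rewrite -!EFinM; congr EFin; ring.
Qed.

End disk_integral.

(** * Parseval's identity on the disk *)

Section parseval.
Variable R : realType.
Local Notation lam := (@lebesgue_measure R).
Local Notation mR := (measurableTypeR R).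

(** The polynomial X^n - 1 splits and is separable. *)
Lemma complex_prim_root n : (0 < n)%N -> exists z : R[i], n.-primitive_root z.
Proof.
move=> n_gt0; pose p : {poly R[i]} := 'X^n - 1.
have [r Dp] := closed_field_poly_normal p.
rewrite (monicP _) ?monicXnsubC // scale1r in Dp.
have rn1: all n.-unity_root r by apply/allP=> z; rewrite -root_prod_XsubC -Dp.
have sz_r: (n < (size r).+1)%N.
  by rewrite -(size_prod_XsubC r id) -Dp size_XnsubC.
have [|z] := hasP (has_prim_root n_gt0 rn1 _ sz_r); last by exists z.
by rewrite -separable_prod_XsubC -Dp separable_Xn_sub_1 // pnatr_eq0 -lt0n.
Qed.

Lemma sqnormC (z : R[i]) : (sqnorm z)%:C = z * z^*%C.
Proof. by case: z => a b; rewrite /sqnorm/=; simpc; congr (_ +i* _); ring. Qed.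

Lemma sqnorm_prim_root n (w : R[i]) : n.-primitive_root w -> sqnorm w = 1.
Proof.
move=> wn; have n0 := prim_order_gt0 wn.
apply/eqP; rewrite -(@pexpr_eq1 _ _ n)//; last exact: sqnorm_ge0.
by rewrite -sqnormX (prim_expr_order wn) /sqnorm/= expr1n expr0n addr0.
Qed.

Lemma conj_prim_root n (w : R[i]) : n.-primitive_root w -> w^*%C = w^-1.
Proof.
move=> wn; have w1 := sqnorm_prim_root wn.
have h : w * w^*%C = 1 by rewrite -sqnormC w1.
have w0 : w != 0.
  by apply/eqP => w0; move: h; rewrite w0 mul0r => /esym/eqP; rewrite oner_eq0.
by apply: (mulfI w0); rewrite h divff.
Qed.

(** The discrete Fourier transform is unitary up to the factor n: expand the squares and
sum the geometric series of powers of w. *)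
Lemma finite_parseval n (w : R[i]) (b : 'I_n -> R[i]) : n.-primitive_root w ->
  \sum_(l < n) sqnorm (\sum_(j < n) b j * w ^+ (l * j)) = n%:R * \sum_(j < n) sqnorm (b j).
Proof.
move=> wn; have n0 := prim_order_gt0 wn.
have w0 : w != 0.
  apply/eqP => w0; have := sqnorm_prim_root wn.
  by rewrite w0 /sqnorm/= expr0n addr0 => /esym/eqP; rewrite oner_eq0.
apply: (@complexI R); rewrite rmorphM/= !rmorph_sum/= rmorph_nat.
under eq_bigr => l _.
  rewrite sqnormC rmorph_sum/= big_distrlr/=.
  under eq_bigr => j _.
    under eq_bigr => k _.
      rewrite rmorphM rmorphXn /= (conj_prim_root wn) (_ : b j * _ * _ = (b j * (b k)^*%C) * (w ^+ j * w^-1 ^+ k) ^+ l); last first.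
        by rewrite exprMn -!exprM ![(_ * l)%N]mulnC; ring.
      over.
    over.
  over.
rewrite exchange_big/= mulr_sumr; apply: eq_bigr => j _.
rewrite exchange_big/= (bigD1 j)//= [X in _ + X]big1 ?addr0 => [|k kj].
  under eq_bigr do rewrite -exprMn divff// expr1n expr1n mulr1.
  by rewrite sumr_const card_ord sqnormC mulr_natl.
rewrite -mulr_sumr.
have g1 : w ^+ j * w^-1 ^+ k - 1 != 0.
  rewrite subr_eq0; apply/eqP => h.
  have /eqP : w ^+ j = w ^+ k.
    by rewrite -[RHS]mul1r -h exprVn mulfVK// expf_neq0.
  rewrite (eq_prim_root_expr wn) !modn_small// => /eqP /val_inj jk.
  by rewrite jk eqxx in kj.
have : (w ^+ j * w^-1 ^+ k) ^+ n - 1 = 0.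
  by rewrite exprMn -!exprM ![(_ * n)%N]mulnC !exprM exprVn (prim_expr_order wn) invr1 !expr1n mulr1 subrr.
rewrite subrX1 => /eqP; rewrite mulf_eq0 (negbTE g1)/= => /eqP ->.
by rewrite mulr0.
Qed.

Lemma measurable_polyfun n (a : nat -> R[i]) :
  measurable_fun setT (fun z : R[i] => \sum_(j < n) a j * z ^+ j).
Proof.
elim: n => [|n ih].
  by under eq_fun do rewrite big_ord0; exact: measurable_cst.
under eq_fun do rewrite big_ord_recr/=.
apply: measurable_addc => //; apply: measurable_mulc; first exact: measurable_cst.
exact/measurable_expc/measurable_id.
Qed.

(** Monomials are orthogonal for radial weights. Since the integral is invariant under
rotation by each n-th root of unity, the integrand may be averaged over these
rotations, and the average is the diagonal sum by finite_parseval. *)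
Lemma disk_parseval n (a : nat -> R[i]) (f : mR -> \bar R) :
  measurable_fun setT f -> (forall x, 0 <= f x)%E ->
  (\int[@disk_mu R]_z ((sqnorm (\sum_(j < n) a j * z ^+ j))%:E * f (sqnorm z)) =
  \sum_(j < n) (sqnorm (a j))%:E * \int[lam]_(u in `[0%R, 1%R[) ((u ^+ j)%:E * f u))%E.
Proof.
move=> mf f0; case: n => [|n].
  rewrite big_ord0; under eq_integral do rewrite big_ord0 /sqnorm/= expr0n addr0 mul0e.
  exact: integral0.
have [w wn] := complex_prim_root (ltn0Sn n).
set N := n.+1 in wn *.
have msq : measurable_fun setT (@sqnorm R : R[i] -> mR).
  exact: (@measurable_sqnorm R _ R[i] id (@measurable_id _ _ setT)).
have mfs : measurable_fun setT (fun z : R[i] => f (sqnorm z)) by exact: measurableT_comp.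
pose F (z : R[i]) := ((sqnorm (\sum_(j < N) a j * z ^+ j))%:E * f (sqnorm z))%E.
have mF : measurable_fun setT F.
  apply: emeasurable_funM => //; apply/measurable_EFinP.
  by apply: measurable_sqnorm; exact: measurable_polyfun.
have F0 z : (0 <= F z)%E by rewrite mule_ge0// lee_fin sqnorm_ge0.
have wl l : sqnorm (w ^+ l) = 1 by rewrite sqnormX (sqnorm_prim_root wn) expr1n.
have mFl l : measurable_fun setT (fun z => F (w ^+ l * z)).
  apply: measurableT_comp => //.
  by apply: measurable_mulc; [exact: measurable_cst|exact: measurable_id].
have mu j : measurable_fun setT (fun u : mR => ((u ^+ j)%:E * f u)%E).
  by apply: emeasurable_funM => //; apply/measurable_EFinP; exact: exprn_measurable.
have muj j : (\int[@disk_mu R]_z ((sqnorm (a j))%:E * ((sqnorm z ^+ j)%:E * f (sqnorm z))) =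
    (sqnorm (a j))%:E * \int[lam]_(u in `[0%R, 1%R[) ((u ^+ j)%:E * f u))%E.
  rewrite ge0_integralZl//; last 3 first.
  - exact: (measurableT_comp (mu j)).
  - by move=> z _; rewrite mule_ge0// lee_fin exprn_ge0// sqnorm_ge0.
  - by rewrite lee_fin sqnorm_ge0.
  congr (_ * _)%E.
  (* The radial formula asks for a nonnegative function on the whole line. *)
  pose g u := ((`|u| ^+ j)%:E * f u)%E.
  have mg : measurable_fun setT (g : mR -> \bar R).
    apply: emeasurable_funM => //; apply/measurable_EFinP; apply: measurable_funX.
    exact: normr_measurable.
  have g0 u : (0 <= g u)%E by rewrite mule_ge0// lee_fin exprn_ge0.
  transitivity (\int[@disk_mu R]_z g (sqnorm z))%E.
    by apply: eq_integral => z _; rewrite /g ger0_norm// sqnorm_ge0.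
  rewrite ge0_integral_sqnorm//; apply: eq_integral => u.
  by rewrite inE/= in_itv/= => /andP[u0 _]; rewrite /g ger0_norm.
suff : ((N%:R)%:E * \int[@disk_mu R]_z F z = (N%:R)%:E *
    \sum_(j < N) (sqnorm (a j))%:E * \int[lam]_(u in `[0%R, 1%R[) ((u ^+ j)%:E * f u))%E.
  move=> /(congr1 (fun x => (N%:R^-1)%:E * x)%E).
  by rewrite !muleA -EFinM mulVf ?mul1e// pnatr_eq0.
transitivity (\sum_(l < N) \int[@disk_mu R]_z F (w ^+ l * z)%R)%E.
  under eq_bigr do rewrite ge0_integral_disk_rot//.
  rewrite (_ : (N%:R)%:E = \sum_(l < N) 1%E) ?ge0_sume_distrl//.
    by apply: eq_bigr => l _; rewrite mul1e.
  by rewrite sumEFin sumr_const card_ord.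
rewrite -ge0_integral_sum//.
under eq_bigr do rewrite -muj.
have mjj j : measurable_fun setT (fun z : R[i] => ((sqnorm (a j))%:E * ((sqnorm z ^+ j)%:E * f (sqnorm z)))%E).
  apply: emeasurable_funM; first exact: measurable_cst.
  exact: (measurableT_comp (mu j)).
rewrite -ge0_integral_sum//; last first.
  move=> j z _; rewrite mule_ge0// ?mule_ge0// ?lee_fin ?sqnorm_ge0//.
  by rewrite exprn_ge0// sqnorm_ge0.
rewrite -ge0_integralZl//; last 2 first.
- by apply: emeasurable_sum.
- move=> z _; apply: sume_ge0 => j _; rewrite mule_ge0// ?mule_ge0// ?lee_fin ?sqnorm_ge0//.
  by rewrite exprn_ge0// sqnorm_ge0.
apply: eq_integral => z _; rewrite /F.
under eq_bigr do rewrite sqnormM wl mul1r.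
rewrite -ge0_sume_distrl; last by move=> j _; rewrite lee_fin sqnorm_ge0.
under [X in _ = (_ * X)%E]eq_bigr do rewrite muleA.
rewrite -ge0_sume_distrl; last first.
  by move=> j _; rewrite mule_ge0// lee_fin ?sqnorm_ge0// exprn_ge0// sqnorm_ge0.
rewrite muleA; congr (_ * _)%E.
rewrite sumEFin.
under [X in _ = (_ * X)%E]eq_bigr do rewrite -EFinM -sqnormX -sqnormM.
rewrite sumEFin -EFinM; congr EFin.
rewrite -(finite_parseval (fun j : 'I_N => a j * z ^+ j) wn).
apply: eq_bigr => l _; congr sqnorm; apply: eq_bigr => j _.
by rewrite exprMn -exprM; ring.
Qed.

End parseval.

(** * Integrals bounded by a primitive *)

Section primitive.
Variable R : realType.
Local Notation lam := (@lebesgue_measure R).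
Local Notation mR := (measurableTypeR R).

(** The fundamental theorem of calculus on [1 - d, 1 - d/n], where f is continuous, and
monotone convergence; f may be unbounded at 0. *)
Lemma integral_le_primitive (F f : R -> R) (d : R) : 0 < d <= 1 ->
  (forall x : R, 0 < x < 2 -> is_derive x 1 F (f x)) ->
  (forall x : R, 0 < x < 2 -> {for x, continuous f}) ->
  (forall x : R, 0 < x <= 1 -> 0 <= f x) -> (forall x : R, 0 < x <= 1 -> 0 <= F x) ->
  (\int[lam]_(u in `[(1 - d)%R, 1%R[) (f (1 - u))%:E <= (F d)%:E)%E.
Proof.
move=> /andP[d0 d1] dF cf f0 F0.
pose I (n : nat) : set R := `[(1 - d)%R, (1 - d / n.+2%:R)%R]%classic.
have UI : `[(1 - d)%R, 1%R[%classic = \bigcup_n I n.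
  apply/seteqP; split => u /=; rewrite in_itv/=.
    move=> /andP[u1 u2].
    have [n hn] : exists n : nat, d / (1 - u) < n%:R.
      by exists (Num.truncn (d / (1 - u))).+1; rewrite truncnS_gt.
    exists n => //; rewrite /I/= in_itv/= u1/= lerBrDl -lerBrDr.
    rewrite ler_pdivrMr ?ltr0n// mulrC -ler_pdivrMr ?subr_gt0//.
    by rewrite (le_trans (ltW hn))// ler_nat (leq_trans (leqnSn _)).
  move=> [n _]; rewrite /I/= in_itv/= => /andP[-> /=] /le_lt_trans; apply.
  by rewrite ltrBlDr ltrDl divr_gt0.
have Ipos n u : I n u -> 0 < 1 - u <= 1.
  rewrite /I/= in_itv/= => /andP[u1 u2]; apply/andP; split.
    by rewrite subr_gt0 (le_lt_trans u2)// ltrBlDr ltrDl divr_gt0.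
  by rewrite lerBlDr lerDl (le_trans _ u1)// subr_ge0.
have dlt n : 1 - d < 1 - d / n.+2%:R.
  by rewrite ltrD2l ltrN2 ltr_pdivrMr// ltr_pMr// ltr1n.
have cG u : 0 < 1 - u < 2 -> is_derive (u : R) 1 (fun v : R => - F (1 - v)) (f (1 - u)).
  move=> hu; have hF := dF _ hu.
  have hv : is_derive u 1 (fun v : R => 1 - v) (-1).
    by rewrite -[-1]sub0r; apply: is_deriveB.
  have := @is_deriveN _ _ _ _ _ _ _ (@is_derive1_comp _ F (fun v : R => 1 - v) u _ _ hF hv).
  by move=> h; apply: (is_derive_eq h); rewrite /GRing.scale/= mulrN1 opprK.
have cfn u : 0 < 1 - u < 2 -> {for u, continuous (fun v : R => f (1 - v))}.
  move=> hu; apply: (@continuous_comp _ _ _ (fun v : R => 1 - v) f); last exact: cf.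
  by apply: continuousB; [exact: cvg_cst|exact: cvg_id].
have sub n u : (1 - d <= u <= 1 - d / n.+2%:R) -> 0 < 1 - u < 2.
  move=> h; have /andP[-> /= h1] := Ipos n u h.
  by rewrite (le_lt_trans h1)// ltr1n.
have mf n : measurable_fun (I n) (fun u : mR => (f (1 - u))%:E).
  apply/measurable_EFinP; apply: subspace_continuous_measurable_fun.
    exact: measurable_itv.
  apply: continuous_in_subspaceT => u; rewrite inE /I/= in_itv/= => h.
  exact/cfn/(sub n).
rewrite UI.
have cv := @ge0_nondecreasing_set_cvg_integral _ mR R I (fun u : mR => (f (1 - u))%:E) lam.
apply: (cvge_le _ (cv _ _ _ _)).
- near=> n.
  rewrite (@continuous_FTC2 _ (fun v : R => f (1 - v)) (fun v : R => - F (1 - v)))//.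
  + rewrite -EFinB lee_fin opprK !subKr gerDr oppr_le0 F0//.
    by rewrite divr_gt0//= ler_pdivrMr// (le_trans d1)// mul1r ler1n.
  + apply: continuous_in_subspaceT => u; rewrite inE /= in_itv/= => h.
    exact/cfn/(sub n).
  + have dG u : 1 - d <= u <= 1 - d / n.+2%:R -> derivable (fun v : R => - F (1 - v)) u 1.
      by move=> h; have [] := cG u (sub n u h).
    have cG' u : 1 - d <= u <= 1 - d / n.+2%:R -> {for u, continuous (fun v : R => - F (1 - v))}.
      by move=> h; apply: differentiable_continuous; apply/derivable1_diffP; exact: dG.
    split.
    * by move=> u; rewrite in_itv/= => /andP[u1 u2]; apply: dG; rewrite !ltW.
    * by apply: cvg_at_right_filter; apply: cG'; rewrite lexx ltW.
    * by apply: cvg_at_left_filter; apply: cG'; rewrite lexx andbT ltW.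
  + move=> u; rewrite in_itv/= => /andP[u1 u2]; rewrite derive1E.
    have h := cG u (sub n u _); apply: derive_val; apply: h.
    by rewrite !ltW.
- move=> n m nm; apply/subsetPset => u; rewrite /I/= !in_itv/= => /andP[-> /= /le_trans]; apply.
  by rewrite lerD2l lerN2 ler_pM2l// lef_pV2 ?posrE ?ltr0n// ler_nat !ltnS.
- by move=> n; exact: measurable_itv.
- exact: mf.
- by move=> n u /Ipos h; rewrite lee_fin f0.
Unshelve. all: by end_near. Qed.

End primitive.

(** * The reproducing inequality of the Bergman kernel *)

Section bergman_kernel.
Variable R : realType.
Local Notation lam := (@lebesgue_measure R).
Local Notation mR := (measurableTypeR R).
Local Notation mu := (@disk_mu R).

Lemma integral_pow_le n :
  (\int[lam]_(u in `[0%R, 1%R[) (u ^+ n)%:E <= (n.+1%:R^-1)%:E :> \bar R)%E.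
Proof.
have := @integral_le_primitive R (fun t => (1 - (1 - t) ^+ n.+1) / n.+1%:R)
  (fun t => (1 - t) ^+ n) 1.
rewrite !subrr expr0n subr0 mul1r ltr01 lexx/=.
under eq_integral do rewrite subKr.
apply=> // x /andP[x0 x1].
- have hv : is_derive x 1 (fun v : R => 1 - v) (-1).
    by rewrite -[-1]sub0r; apply: is_deriveB.
  have := @is_deriveX _ _ (fun v : R => 1 - v) n.+1 x 1 _ hv.
  rewrite (_ : _ ^+ n.+1 = fun v : R => (1 - v) ^+ n.+1); last first.
    by apply/funext => v; elim: n.+1 => [|m ih]; rewrite ?expr0// !exprS -ih.
  move=> hX.
  have h1 : is_derive x 1 (fun v : R => 1 - (1 - v) ^+ n.+1) (0 - (n.+1%:R * (1 - x) ^+ n) *: (-1)).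
    by apply: is_deriveB.
  have h2 := @is_deriveM _ _ (fun v : R => 1 - (1 - v) ^+ n.+1) (cst n.+1%:R^-1) x 1 _ _ h1 (is_derive_cst _ _ _).
  apply: (is_derive_eq h2).
  rewrite /GRing.scale/= mulr0 add0r mulrN1 sub0r opprK mulrA mulVf ?mul1r// pnatr_eq0//.
- apply: (@continuous_comp _ _ _ (fun v : R => 1 - v) (fun v => v ^+ n)).
    by apply: continuousB; [exact: cvg_cst|exact: cvg_id].
  exact: exprn_continuous.
- by rewrite exprn_ge0// subr_ge0.
- rewrite divr_ge0// subr_ge0 exprn_ile1// ?subr_ge0//.
  by rewrite gerBl ltW.
Qed.

(** The partial sums of the expansion of (1 - q)^(-2), up to the factor (1 - q)^2. *)
Lemma truncated_bergman (A : comPzRingType) (q : A) n :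
  (1 - q) ^+ 2 * (\sum_(j < n) j.+1%:R * q ^+ j) = 1 - n.+1%:R * q ^+ n + n%:R * q ^+ n.+1.
Proof.
elim: n => [|n ih]; first by rewrite big_ord0 mulr0 expr0 mul1r mul0r addr0 subrr.
rewrite big_ord_recr/= mulrDr ih -!natr1 !exprS expr0; ring.
Qed.

(** The diagonal K(x,x) of the Bergman kernel. *)
Definition kd (x : R[i]) : R := ((1 - sqnorm x) ^+ 2)^-1.

(** The squared modulus |K(x,y)|^2 of the Bergman kernel. *)
Definition k2 (x y : R[i]) : R := ((sqnorm (1 - x * y^*%C)) ^+ 2)^-1.

Lemma kd_ge0 x : 0 <= kd x.
Proof. by rewrite invr_ge0 sqr_ge0. Qed.

Lemma k2_ge0 x y : 0 <= k2 x y.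
Proof. by rewrite invr_ge0 sqr_ge0. Qed.

Lemma sqnormBconj (x y : R[i]) : sqnorm (1 - x * y^*%C) = sqnorm (1 - x^*%C * y).
Proof. by case: x => a b; case: y => c d; rewrite /sqnorm/=; ring. Qed.

Lemma k2C x y : k2 x y = k2 y x.
Proof. by rewrite /k2 sqnormBconj mulrC. Qed.

(** Inversion, with 0 sent to 0, is x (x^2)^(-1) with a power function. *)
Lemma measurable_invr : measurable_fun setT (fun x : mR => x^-1 : mR).
Proof.
have -> : (fun x : mR => x^-1 : mR) = (fun x : R => x * ((x ^+ 2) `^ (-1))).
  apply/funext => x; rewrite powR_inv1 ?sqr_ge0//.
  by have [->|x0] := eqVneq x 0; [rewrite invr0 mul0r|field].
apply: measurable_funM => //.
apply: (@measurableT_comp _ _ _ _ _ _ (fun x : mR => x `^ (-1))); first exact: measurable_powR.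
exact: exprn_measurable.
Qed.

Lemma cmod_lt1 (x : R[i]) : disk x -> cmod x < 1.
Proof. by move=> /diskE x1; rewrite cmodE -sqrtr1 ltr_sqrt. Qed.

(** For n = 2m, r^n is r^m r^m, and m r^m is bounded by the sum of the geometric
series. *)
Lemma geometric_dominates (r e : R) : 0 <= r < 1 -> 0 < e -> exists n, (n + n.+1)%:R * r ^+ n <= e.
Proof.
move=> /andP[r0 r1] e0.
have : geometric (5 / (1 - r)) r @ \oo --> 0.
  by apply: cvg_geometric; rewrite ger0_norm.
move=> /cvgrPdist_le/(_ _ e0)[m _ hm].
pose M := m.+1; exists (M + M)%N.
have := hm M (leqnSn _); rewrite /geometric/= sub0r normrN ger0_norm; last first.
  by rewrite mulr_ge0 ?divr_ge0 ?subr_ge0 ?exprn_ge0// ltW.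
apply: le_trans.
have geo : M%:R * r ^+ M <= (1 - r)^-1.
  have h : \sum_(i < M) r ^+ i <= (1 - r)^-1.
    rewrite -[leRHS]mul1r ler_pdivlMr ?subr_gt0// mulrC.
    have := subrX1 r M; rewrite -opprB -[r - 1]opprB mulNr => /oppr_inj <-.
    by rewrite gerBl exprn_ge0.
  apply: le_trans h.
  rewrite (_ : M%:R * r ^+ M = \sum_(i < M) r ^+ M); last by rewrite sumr_const card_ord mulr_natl.
  apply: ler_sum => i _.
  by apply: ler_wiXn2l => //; [exact: ltW|exact: ltnW].
rewrite exprD mulrA [leRHS](_ : _ = 5 * (1 - r)^-1 * r ^+ M)//.
apply: ler_wpM2r; first exact: exprn_ge0.
apply: (@le_trans _ _ (5 * (M%:R * r ^+ M))); last by rewrite ler_wpM2l.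
rewrite mulrA; apply: ler_wpM2r; first exact: exprn_ge0.
by rewrite -natrM ler_nat /M; lia.
Qed.

(** By Parseval the integral is the n-th partial sum of the series of (j + 1) |x|^(2j),
whose sum is K(x,x). *)
Lemma sqnorm_truncated_bergman_le (x : R[i]) n : disk x ->
  (\int[mu]_y (sqnorm (\sum_(j < n) (j.+1%:R * x^*%C ^+ j) * y ^+ j))%:E <= (kd x)%:E)%E.
Proof.
move=> /diskE x1.
have := @disk_parseval R n (fun j => j.+1%:R * x^*%C ^+ j) (cst 1%E) (measurable_cst _)
  (fun=> lee01).
under eq_integral do rewrite mule1.
move=> ->.
apply: (@le_trans _ _ (\sum_(j < n) (j.+1%:R * sqnorm x ^+ j)%:E)%E).
  apply: lee_sum => j _; under eq_integral do rewrite mule1.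
  have -> : sqnorm (j.+1%:R * x^*%C ^+ j) = j.+1%:R ^+ 2 * sqnorm x ^+ j.
    rewrite sqnormM sqnormX sqnorm_conj -[X in sqnorm X](rmorph_nat (@real_complex R)).
    by rewrite /sqnorm/= expr0n addr0.
  apply: (@le_trans _ _ ((j.+1%:R ^+ 2 * sqnorm x ^+ j)%:E * (j.+1%:R^-1)%:E)%E).
    apply: lee_wpmul2l; last exact: integral_pow_le.
    by rewrite lee_fin mulr_ge0// exprn_ge0// sqnorm_ge0.
  by rewrite -EFinM lee_fin mulrAC expr2 mulfK// pnatr_eq0.
rewrite sumEFin lee_fin /kd -[leRHS]mul1r ler_pdivlMr; last by rewrite exprn_gt0// subr_gt0.
rewrite mulrC truncated_bergman -[leRHS]addr0 -addrA lerD2l addrC subr_le0 exprS mulrA.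
apply: ler_wpM2r; first by rewrite exprn_ge0// sqnorm_ge0.
by rewrite -natr1; have := ler0n R n; have := sqnorm_ge0 x; nra.
Qed.

Lemma measurable_k2 d (T : measurableType d) (f g : T -> R[i]) :
  measurable_fun setT f -> measurable_fun setT g ->
  measurable_fun setT ((fun t => k2 (f t) (g t)) : T -> mR).
Proof.
move=> mf mg; apply: (@measurableT_comp _ _ _ _ _ _ (fun x : mR => x^-1 : mR)).
  exact: measurable_invr.
apply: measurable_funX; apply: measurable_sqnorm.
have -> : (fun t => 1 - f t * (g t)^*%C) = (fun t => 1 + (-1) * (f t * (g t)^*%C)).
  by apply/funext => t; rewrite mulN1r.
apply: measurable_addc; first exact: measurable_cst.
apply: measurable_mulc; first exact: measurable_cst.
by apply: measurable_mulc => //; exact: measurable_conjc.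
Qed.

(** By truncated_bergman, (1 - q)^2 times the partial sum is 1 up to an error of at most
e, uniformly for |q| <= |x|. *)
Lemma k2_truncated (x : R[i]) e : disk x -> 0 < e < 1 -> exists n, forall y, disk y ->
  k2 x y * (1 - e) ^+ 2 <= sqnorm (\sum_(j < n) (j.+1%:R * x^*%C ^+ j) * y ^+ j).
Proof.
move=> dx /andP[e0 e1].
have [|n hn] := @geometric_dominates (cmod x) e _ e0; first by rewrite cmod_ge0 cmod_lt1.
exists n => y dy.
set s := (X in sqnorm X).
pose q := x^*%C * y.
have rq : cmod q <= cmod x.
  rewrite /q ComplexField.Normc.normcM !cmodE sqnorm_conj -!cmodE.
  by rewrite ler_piMr ?cmod_ge0// ltW// cmod_lt1.
have q1 : 0 < sqnorm (1 - q).
  rewrite lt_neqAle sqnorm_ge0 andbT; apply/eqP => h.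
  have : 1 - q = 0.
    by apply: ComplexField.Normc.eq0_normc; rewrite cmodE -h sqrtr0.
  move=> /subr0_eq q1; move: rq; rewrite -q1 ComplexField.Normc.normc1.
  by rewrite leNgt cmod_lt1.
have Es : (1 - q) ^+ 2 * s = 1 - n.+1%:R * q ^+ n + n%:R * q ^+ n.+1.
  rewrite -truncated_bergman; congr (_ * _); apply: eq_bigr => j _.
  by rewrite /q exprMn mulrA.
have cX (m : nat) : cmod (q ^+ m) = cmod q ^+ m.
  elim: m => [|m ih]; first by rewrite !expr0 ComplexField.Normc.normc1.
  by rewrite !exprS ComplexField.Normc.normcM ih.
have cN (m : nat) (z : R[i]) : cmod (m%:R * z) = m%:R * cmod z.
  by rewrite mulr_natl normcMn mulr_natl.
have cge : 1 - e <= cmod (1 - n.+1%:R * q ^+ n + n%:R * q ^+ n.+1).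
  set v := (X in cmod X).
  have E1 : 1 = v + (n.+1%:R * q ^+ n + - (n%:R * q ^+ n.+1)) by rewrite /v; ring.
  have := le_normcD v (n.+1%:R * q ^+ n + - (n%:R * q ^+ n.+1)).
  rewrite -E1 ComplexField.Normc.normc1.
  have := le_normcD (n.+1%:R * q ^+ n) (- (n%:R * q ^+ n.+1)).
  rewrite normcN !cN !cX => h1 h2.
  suff : n.+1%:R * cmod q ^+ n + n%:R * cmod q ^+ n.+1 <= e by move=> h3; lra.
  apply: le_trans hn; rewrite natrD mulrDl addrC lerD//.
    rewrite ler_wpM2l// exprS.
    apply: (@le_trans _ _ (1 * cmod q ^+ n)).
      by rewrite ler_wpM2r ?exprn_ge0 ?cmod_ge0// (le_trans rq)// ltW// cmod_lt1.
    by rewrite mul1r lerXn2r// ?nnegrE ?cmod_ge0.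
  by rewrite ler_wpM2l// lerXn2r// ?nnegrE ?cmod_ge0.
rewrite /k2 sqnormBconj -/q mulrC ler_pdivrMr ?exprn_gt0//.
rewrite mulrC -sqnormX -sqnormM Es -sqr_cmod.
by rewrite lerXn2r// nnegrE ?cmod_ge0// subr_ge0 ltW.
Qed.

(** Half of the identity saying that K reproduces itself. An inequality is enough for a
lower bound of the variance, and it passes to the limit from the Taylor polynomials
without exchanging limit and integral. *)
Lemma bergman_reproducing x : disk x -> (\int[mu]_y (k2 x y)%:E <= (kd x)%:E)%E.
Proof.
move=> dx.
have mk : measurable_fun setT (fun y => (k2 x y)%:E).
  apply/measurable_EFinP; apply: measurable_k2; first exact: measurable_cst.
  exact: measurable_id.
have h e : 0 < e < 1 -> (((1 - e) ^+ 2)%:E * \int[mu]_y (k2 x y)%:E <= (kd x)%:E)%E.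
  move=> e01; have [n hn] := k2_truncated dx e01.
  apply: le_trans (sqnorm_truncated_bergman_le n dx).
  rewrite -ge0_integralZl//; last 2 first.
  - by move=> y _; rewrite lee_fin k2_ge0.
  - by rewrite lee_fin sqr_ge0.
  apply: le_integral_disk.
  - by move=> y dy; rewrite -EFinM lee_fin mulrC hn.
  - by apply: emeasurable_funM => //; exact: measurable_cst.
  - apply/measurable_EFinP; apply: measurable_sqnorm.
    exact: (measurable_polyfun _ (fun j => j.+1%:R * x^*%C ^+ j)).
  - by move=> y; rewrite mule_ge0// lee_fin ?sqr_ge0// k2_ge0.
  - by move=> y; rewrite lee_fin sqnorm_ge0.
have I0 : (0 <= \int[mu]_y (k2 x y)%:E)%E.
  by apply: integral_ge0 => y _; rewrite lee_fin k2_ge0.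
case: (\int[mu]_y (k2 x y)%:E)%E h I0 => [a h a0| h _|//].
- rewrite lee_fin; apply/ler_addgt0Pr => d d0.
  pose e := Num.min (2^-1) (d / (2 * (a + 1))).
  have a1 : 0 < 2 * (a + 1) by move: a0; rewrite lee_fin => a0; lra.
  have e0 : 0 < e by rewrite /e lt_min divr_gt0// invr_gt0 ltr0n.
  have e1 : e <= 2^-1 by rewrite /e ge_min lexx.
  have e2 : e * (2 * (a + 1)) <= d by rewrite -ler_pdivlMr// /e ge_min lexx orbT.
  have := h e; rewrite -EFinM lee_fin e0/= (le_lt_trans e1) ?invf_lt1 ?ltr1n// => /(_ isT).
  by move: a0; rewrite lee_fin => a0; nra.
- have := h 2^-1; rewrite invr_gt0 ltr0n/= invf_lt1 ?ltr1n// => /(_ isT).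
  by rewrite gt0_muley ?leye_eq// lte_fin exprn_gt0// subr_gt0 invf_lt1 ?ltr1n.
Qed.

End bergman_kernel.

(** * Sums over arbitrary sets *)

Section esum_extra.
Variable R : realType.
Local Open Scope ereal_scope.

Lemma esumZl (T : choiceType) (I : set T) (a : T -> \bar R) (c : \bar R) : 0 <= c ->
  (forall i, I i -> 0 <= a i) ->
  \esum_(i in I) (c * a i) = c * \esum_(i in I) a i.
Proof.
have le1 (k : \bar R) (b : T -> \bar R) : 0 <= k -> (forall i, I i -> 0 <= b i) ->
    \esum_(i in I) (k * b i) <= k * \esum_(i in I) b i.
  move=> k0 b0; apply: ge_ereal_sup => _ [X [finX XI] <-].
  rewrite fsbig_finite//= big_seq_cond -ge0_sume_distrr -?big_seq_cond; last first.
    by move=> i; rewrite andbT in_fset_set// inE => /XI/b0.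
  apply: lee_wpmul2l => //; apply: esum_ge; exists X => //.
  by rewrite fsbig_finite.
move=> c0 a0; apply/eqP; rewrite eq_le le1//=.
have ca0 i : I i -> 0 <= c * a i by move=> Ii; rewrite mule_ge0// a0.
case: c c0 ca0 => [c|_ ca0|//].
- rewrite lee_fin => c0' ca0.
  have [->|cn0] := eqVneq c 0%R.
    by rewrite mul0e; apply: esum_ge0 => i _; rewrite mul0e.
  have c0 : (0 < c)%R by rewrite lt_neqAle eq_sym cn0.
  have -> : \esum_(i in I) a i = \esum_(i in I) (c^-1%:E * (c%:E * a i)).
    by apply: eq_esum => i _; rewrite muleA -EFinM mulVf ?mul1e// gt_eqF.
  apply: (@le_trans _ _ (c%:E * (c^-1%:E * \esum_(i in I) (c%:E * a i)))).
    by apply: lee_wpmul2l; [rewrite lee_fin ltW|apply: le1 => //; rewrite lee_fin invr_ge0 ltW].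
  by rewrite muleA -EFinM divff ?mul1e// gt_eqF.
- have [h|/existsNP[i /not_implyP[Ii /eqP ai]]] := pselect (forall i, I i -> a i = 0).
    by rewrite (esum1 h) mule0 esum_ge0.
  apply: (@le_trans _ _ +oo); first by rewrite leey.
  apply: esum_ge; exists [set i]; first by split => // j ->.
  by rewrite fsbig_set1 gt0_mulye// lt_neqAle eq_sym ai a0.
Qed.

(** Monotone convergence for sums over a set of any cardinality. *)
Lemma cvg_esum (T : choiceType) (I : set T) (a : nat -> T -> \bar R) (b : T -> \bar R) :
  (forall n i, I i -> 0 <= a n i) ->
  (forall i, I i -> {homo a^~ i : m n / (m <= n)%N >-> m <= n}) ->
  (forall i, I i -> a n i @[n --> \oo] --> b i) ->
  \esum_(i in I) a n i @[n --> \oo] --> \esum_(i in I) b i.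
Proof.
move=> a0 nd cv.
have ndE : {homo (fun n => \esum_(i in I) a n i) : m n / (m <= n)%N >-> m <= n}.
  by move=> m n mn; apply: le_esum => i Ii; exact: nd.
have aleb n i : I i -> a n i <= b i.
  move=> Ii; apply: cvge_ge (cv i Ii).
  by exists n => // m /= nm; exact: nd.
have h := ereal_nondecreasing_cvgn ndE.
rewrite (_ : \esum_(i in I) b i = ereal_sup (range (fun n => \esum_(i in I) a n i)))//.
apply/eqP; rewrite eq_le; apply/andP; split; last first.
  by apply: ge_ereal_sup => _ [n _ <-]; apply: le_esum => i; exact: aleb.
apply: ge_ereal_sup => _ [X [finX XI] <-].
rewrite fsbig_finite//=.
have cX : \sum_(i <- fset_set X) a n i @[n --> \oo] --> \sum_(i <- fset_set X) b i.
  rewrite big_seq_cond; under eq_fun do rewrite big_seq_cond.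
  apply: cvg_nnesum => [i|i]; rewrite andbT in_fset_set// inE => /XI Ii.
    by near=> n; exact: a0.
  exact: cv.
apply: cvge_le cX; near=> n.
apply: (@le_trans _ _ (\esum_(i in I) a n i)).
  by apply: esum_ge; exists X => //; rewrite fsbig_finite.
by apply: ereal_sup_ubound; exists n.
Unshelve. all: by end_near. Qed.

End esum_extra.

(** * Linear statistics *)

Section linear_statistics.
Variable R : realType.
Local Open Scope ereal_scope.

Definition linstat (f : R[i] -> R) (X : conf R) : \bar R :=
  \esum_(x in ((X : config R) : set R[i])) (f x)%:E.

Lemma esum_count (B : set R[i]) (X : set R[i]) n :
  (X `&` B #= `I_n)%card -> \esum_(x in X) (\1_B x : R)%:E = n%:R%:E.
Proof.
move=> XB.
have -> : \esum_(x in X) (\1_B x : R)%:E = \esum_(x in X `&` B) 1%:E :> \bar R.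
  rewrite [RHS]esum_mkcondr; apply: eq_esum => x _.
  by rewrite indicE; case: (x \in B).
have finXB : finite_set (X `&` B) by exists n.
rewrite esum_fset// fsbig_finite//= big_const_seq count_predT.
have -> : size (fset_set (X `&` B)) = n.
  by have /card_fset_set := XB.
elim: n {XB} => //= n ->; by rewrite -EFinD -natr1 addrC.
Qed.

Lemma esum_infinite (B : set R[i]) (X : set R[i]) :
  infinite_set (X `&` B) -> \esum_(x in X) (\1_B x : R)%:E = +oo :> \bar R.
Proof.
move=> inf; apply/eqyP => A A0.
have [C CXB AC] := infinite_set_fset (Num.truncn A).+1 inf.
apply: (@le_trans _ _ (\sum_(x <- C) (\1_B x : R)%:E)).
  rewrite big_seq_cond (eq_bigr (fun=> 1%:E)); last first.
    by move=> x; rewrite andbT => xC; rewrite indicE mem_set//; have [] := CXB x xC.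
  rewrite -big_seq_cond sumEFin lee_fin big_const_seq count_predT iter_addr addr0.
  rewrite (le_trans (ltW (truncnS_gt A)))// ler_nat.
  exact: leq_trans AC _.
apply: esum_ge; exists [set` C].
  by split; [exact: finite_fset|move=> x /CXB[]].
by rewrite fsbig_finite//= set_fsetK.
Qed.

(** The events that B contains exactly n points are the generators of the
sigma-algebra; on the complement of all of them the number of points is infinite. *)
Lemma measurable_linstat_indic (B : set R[i]) : measurable B ->
  measurable_fun setT (linstat \1_B).
Proof.
move=> mB _ Y _; rewrite setTI.
pose E (n : nat) : set (conf R) := [set X : config R | (X `&` B #= `I_n)%card].
have mE n : measurable (E n).
  by apply: sub_sigma_algebra; exists B, n.
have -> : linstat \1_B @^-1` Y = (\bigcup_(n in [set n | Y n%:R%:E]) E n) `|`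
   (if pselect (Y +oo) then ~` (\bigcup_n E n) else set0).
  apply/seteqP; split => X /=.
    have [fX|iX] := pselect (finite_set ((X : config R) `&` B)).
      have [n hn] := fX; rewrite /linstat (esum_count hn) => Yn.
      by left; exists n.
    rewrite /linstat esum_infinite// => Yoo; right; case: pselect => //= _ [n _ hn].
    by apply: iX; exists n.
  move=> [[n Yn hn]|]; first by rewrite /linstat (esum_count hn).
  case: pselect => //= Yoo nE; rewrite /linstat esum_infinite// => -[n hn].
  by apply: nE; exists n.
apply: measurableU; first exact: bigcup_measurable.
by case: pselect => //= _; apply: measurableC; exact: bigcup_measurable.
Qed.

End linear_statistics.

Section linear_statistics_measurability.
Variable R : realType.
Local Notation mR := (measurableTypeR R).
Local Open Scope ereal_scope.
Import HBNNSimple.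

(** By approximation from below by simple functions. *)
Lemma measurable_linstat (f : R[i] -> R) : measurable_fun setT (f : R[i] -> mR) -> (forall x, 0 <= f x)%R ->
  measurable_fun setT (linstat f).
Proof.
move=> mf f0.
have mf' : measurable_fun setT (EFin \o f) by exact/measurable_EFinP.
pose g := nnsfun_approx measurableT mf'.
apply: (emeasurable_fun_cvg (fun n => linstat (g n))) => //.
- move=> n.
  have -> : linstat (g n) = fun X : conf R =>
     \sum_(r <- fset_set (range (g n))) (r%:E * linstat (\1_(g n @^-1` [set r])) X).
    apply/funext => X.
    transitivity (\esum_(x in ((X : config R) : set R[i]))
        \sum_(r <- fset_set (range (g n))) (r%:E * (\1_(g n @^-1` [set r]) x)%:E)).
      apply: eq_esum => x _; rewrite fimfunE.
      rewrite fsbig_finite//= -sumEFin; apply: eq_bigr => r _.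
      by rewrite EFinM.
    rewrite big_seq_cond; under eq_esum do rewrite big_seq_cond.
    rewrite esum_sum => [|x r Xx]; last first.
      rewrite andbT in_fset_set// inE => -[y _ <-].
      by rewrite mule_ge0// lee_fin// fun_ge0.
    apply: eq_bigr => r; rewrite andbT in_fset_set// inE => -[y _ <-].
    by rewrite esumZl// lee_fin fun_ge0.
  apply: emeasurable_sum => r.
  apply: emeasurable_funM; first exact: measurable_cst.
  apply: measurable_linstat_indic.
  by rewrite -[X in measurable X]setTI; exact: measurable_funP.
- move=> X _; apply: cvg_esum.
  + by move=> n x _; rewrite lee_fin fun_ge0.
  + by move=> x _ m n mn; rewrite lee_fin; exact/lefP/nd_nnsfun_approx.
  + move=> x _; apply: cvg_nnsfun_approx => // y _; rewrite lee_fin//.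
Qed.

Lemma sqrt_sum_sqr_le (a b : R) : (Num.sqrt (a ^+ 2 + b ^+ 2) <= `|a| + `|b|)%R.
Proof.
rewrite -[leRHS]ger0_norm ?addr_ge0// -sqrtr_sqr ler_sqrt ?sqr_ge0//.
by rewrite sqrrD !real_normK ?num_real// lerD2r lerDl mulrn_wge0// mulr_ge0.
Qed.

Lemma continuous_plane : continuous (@plane R).
Proof.
move=> p; apply/cvgrPdist_le => e e0.
have er : e = (complex.Re e)%:C.
  by case: (e) (gtr0_real e0) => a b; rewrite complex_real => /eqP ->.
have e1 : (0 < complex.Re e / 2)%R by rewrite divr_gt0// -ltcR -er.
have c1 : fst q @[q --> p] --> p.1 by exact: cvg_fst.
have c2 : snd q @[q --> p] --> p.2 by exact: cvg_snd.
move/cvgrPdist_le : c1 => /(_ _ e1) h1; move/cvgrPdist_le : c2 => /(_ _ e1) h2.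
near=> q; rewrite er normc_def lecR.
have -> : (plane p - plane q)%R = ((p.1 - q.1)%R +i* (p.2 - q.2)%R)%C by [].
apply: (@le_trans _ _ (`|p.1 - q.1| + `|p.2 - q.2|)%R); last first.
  rewrite [leRHS](_ : _ = complex.Re e / 2 + complex.Re e / 2)%R; last by field.
  by apply: lerD; near: q.
exact: sqrt_sum_sqr_le.
Unshelve. all: by end_near. Qed.

Lemma compact_disc (c : R) : compact [set z : R[i] | sqnorm z <= c]%R.
Proof.
pose A := [set p : R * R | p.1 ^+ 2 + p.2 ^+ 2 <= c]%R.
have -> : [set z : R[i] | sqnorm z <= c]%R = @plane R @` A.
  apply/seteqP; split => z /=; last by move=> [p Ap <-].
  by move=> h; exists (complex.Re z, complex.Im z) => //; case: z {h}.
apply: continuous_compact; first exact/continuous_subspaceT/continuous_plane.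
pose m := (c + 1)%R.
apply: (@subclosed_compact _ _ (`[(- m)%R, m]%classic `*` `[(- m)%R, m]%classic)).
- have ca : continuous (fun p : R * R => p.1 ^+ 2 + p.2 ^+ 2)%R.
    move=> p; apply: cvgD; apply: cvgM; by [exact: cvg_fst|exact: cvg_snd].
  rewrite (_ : A = (fun p : R * R => p.1 ^+ 2 + p.2 ^+ 2)%R @^-1` [set x | x <= c]%R) //.
  apply: closed_comp => //; exact: closed_le.
- by apply: compact_setX; exact: segment_compact.
- have bnd (a b : R) : (a ^+ 2 + b ^+ 2 <= c -> - m <= a <= m)%R.
    have := sqr_ge0 (a - 1); have := sqr_ge0 (a + 1); have := sqr_ge0 b.
    by rewrite /m => *; apply/andP; split; nra.
  move=> [x y] h; split; rewrite /= in_itv/=; first exact: (bnd _ _ h).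
  by apply: (bnd y x); rewrite addrC.
Qed.

(** A smaller concentric disc is compact. *)
Lemma finite_points_disc (X : config R) (c : R) : (c < 1)%R ->
  finite_set ((X : set R[i]) `&` [set z | sqnorm z <= c]%R).
Proof.
move=> c1; apply: points_locally_finite; first exact: compact_disc.
by move=> z /= zc; apply/diskE; exact: le_lt_trans zc c1.
Qed.

End linear_statistics_measurability.

(** * Sums over pairs of distinct points *)

Section pair_statistics.
Variable R : realType.
Local Notation mR := (measurableTypeR R).
Local Open Scope ereal_scope.

Definition pairstat (f g : R[i] -> R) (X : conf R) : \bar R :=
  \esum_(t in @distinct_tuples R 2 (X : config R)) (f (tnth t ord0) * g (tnth t ord_max))%:E.

Lemma linstat_ge0 (f : R[i] -> R) X : (forall x, 0 <= f x)%R -> 0 <= linstat f X.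
Proof. by move=> f0; apply: esum_ge0 => x _; rewrite lee_fin. Qed.

Lemma pairstat_ge0 (f g : R[i] -> R) X : (forall x, 0 <= f x)%R -> (forall x, 0 <= g x)%R ->
  0 <= pairstat f g X.
Proof. by move=> f0 g0; apply: esum_ge0 => x _; rewrite lee_fin mulr_ge0. Qed.

(** The pairs of points of X are the diagonal, a copy of X, and the pairs of distinct points. *)
Lemma linstatM (f g : R[i] -> R) X : (forall x, 0 <= f x)%R -> (forall x, 0 <= g x)%R ->
  linstat f X * linstat g X = linstat (fun x => f x * g x)%R X + pairstat f g X.
Proof.
move=> f0 g0.
set S : set R[i] := (X : config R).
have -> : linstat f X * linstat g X = \esum_(x in S) \esum_(y in S) (f x * g y)%:E.
  rewrite muleC -esumZl; [|exact: linstat_ge0|by move=> x _; rewrite lee_fin].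
  apply: eq_esum => x _; rewrite muleC /linstat -esumZl ?lee_fin// => y _.
  by rewrite lee_fin.
have fg0 (k : R[i] * R[i]) : 0 <= (f k.1 * g k.2)%:E by rewrite lee_fin mulr_ge0.
rewrite (@esum_esum _ _ _ S (fun=> S) (fun x y => (f x * g y)%:E)); last first.
  by move=> x y _ _; exact: (fg0 (x, y)).
rewrite (esumID [set k | k.1 = k.2])//; congr (_ + _).
  rewrite /linstat (@reindex_esum _ _ _ S _ (fun x => (x, x)))//.
  split.
  - by move=> x Sx /=.
  - by move=> x y _ _ [].
  - by move=> [x y] /= [[Sx Sy] /= xy]; exists x => //; rewrite xy.
rewrite /pairstat (@reindex_esum _ _ _ (@distinct_tuples R 2 S) _
  (fun t : 2.-tuple R[i] => (tnth t ord0, tnth t ord_max)))//.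
split.
- move=> t [/= ut St]; split; first by split; exact: St.
  move=> /= h; have := tuple_uniqP _ ut ord0 ord_max.
  by move=> /(_ h).
- move=> t u _ _ [h0 h1]; apply: eq_from_tnth => i.
  have [->//|i0] := eqVneq i ord0.
  by have -> : i = ord_max by apply: val_inj; case: i i0 => -[|[|]].
- move=> [x y] /= [[Sx Sy] /= xy]; exists [tuple x; y] => //.
  split; first by rewrite /= inE andbT; apply/eqP.
  by case=> -[|[|]].
Qed.

Lemma linstat_lty_support (f : R[i] -> R) (c : R) X : (forall x, 0 <= f x)%R -> (c < 1)%R ->
  (forall x, (c < sqnorm x)%R -> f x = 0%R) -> linstat f X < +oo.
Proof.
move=> f0 c1 fc.
rewrite /linstat (_ : esum _ _ = \esum_(x in ((X : config R) : set R[i]) `&` [set z | sqnorm z <= c]%R) (f x)%:E).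
  rewrite esum_fset; last 2 first.
  - exact: finite_points_disc.
  - by move=> x _; rewrite lee_fin.
  by rewrite fsbig_finite/=; [rewrite sumEFin ltry|exact: finite_points_disc].
rewrite [RHS]esum_mkcondr; apply: eq_esum => x _.
case: ifPn => //; rewrite notin_setE/= => /negP; rewrite -ltNge => /fc ->//.
Qed.

(** The difference of linstatM expresses pairstat by linear statistics as soon as the
diagonal part is finite. This is so after restriction of f and g to a smaller disc,
and monotone convergence removes the restriction. *)
Lemma measurable_pairstat (f g : R[i] -> R) :
  measurable_fun setT (f : R[i] -> mR) -> measurable_fun setT (g : R[i] -> mR) ->
  (forall x, 0 <= f x)%R -> (forall x, 0 <= g x)%R ->
  measurable_fun setT (pairstat f g).
Proof.
move=> mf mg f0 g0.
pose B n := [set z : R[i] | sqnorm z <= 1 - n.+1%:R^-1]%R.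
have mB n : measurable (B n).
  have -> : B n = setT `&` (@sqnorm R @^-1` `]-oo, (1 - n.+1%:R^-1)%R]%classic).
    by rewrite setTI; apply/seteqP; split => z /=; rewrite in_itv.
  have /(_ measurableT) := @measurable_sqnorm R _ R[i] id (@measurable_id _ _ setT); apply.
  exact: measurable_itv.
pose tr (h : R[i] -> R) n x := (h x * \1_(B n) x)%R.
have tr0 h n x : (forall x, 0 <= h x)%R -> (0 <= tr h n x)%R.
  by move=> h0; rewrite mulr_ge0// indicE.
have mtr h n : measurable_fun setT (h : R[i] -> mR) -> measurable_fun setT (tr h n : R[i] -> mR).
  by move=> mh; apply: measurable_funM => //; exact: measurable_indic.
have lt1 n : (1 - n.+1%:R^-1 < 1 :> R)%R by rewrite ltrBlDr ltrDl invr_gt0.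
have trs h n x : (1 - n.+1%:R^-1 < sqnorm x)%R -> tr h n x = 0%R.
  by move=> hx; rewrite /tr indicE memNset ?mulr0// /B/= leNgt hx.
apply: (emeasurable_fun_cvg (fun n => pairstat (tr f n) (tr g n))) => //.
- move=> n.
  have -> : pairstat (tr f n) (tr g n) = (fun X =>
      linstat (tr f n) X * linstat (tr g n) X - linstat (fun x => tr f n x * tr g n x)%R X).
    apply/funext => X; rewrite linstatM; [|by move=> x; exact: tr0..].
    rewrite addeAC subee ?add0e// ge0_fin_numE; last first.
      by apply: linstat_ge0 => x; rewrite mulr_ge0// tr0.
    apply: (@linstat_lty_support _ (1 - n.+1%:R^-1)%R) => //.
      by move=> x; rewrite mulr_ge0// tr0.
    by move=> x /trs ->; rewrite mul0r.
  apply: emeasurable_funB.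
    by apply: emeasurable_funM; apply: measurable_linstat => //; [exact: mtr|move=> x; exact: tr0|exact: mtr|move=> x; exact: tr0].
  apply: measurable_linstat; first by apply: measurable_funM; exact: mtr.
  by move=> x; rewrite mulr_ge0// tr0.
- move=> X _.
  have nd m n x : (m <= n)%N -> (\1_(B m) x <= \1_(B n) x :> R)%R.
    move=> mn; rewrite !indicE ler_nat.
    have [|//] := boolP (x \in B m); rewrite inE => xm; rewrite mem_set//.
    rewrite /B/= (le_trans xm)// lerD2l lerN2 lef_pV2 ?posrE ?ltr0n// ler_nat ltnS//.
  apply: cvg_esum.
  + by move=> n t _; rewrite lee_fin mulr_ge0// tr0.
  + by move=> t _ m n mn; rewrite lee_fin ler_pM ?tr0// ler_wpM2l// nd.
  + move=> t [_ tX].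
    have near1 x : points X x -> \forall n \near \oo, x \in B n.
      move=> /(@points_disk R X)/diskE x1.
      have [k kx] : exists k : nat, ((1 - sqnorm x)^-1 < k%:R)%R.
        by exists (Num.truncn (1 - sqnorm x)^-1).+1; rewrite truncnS_gt.
      exists k => // n /= kn; rewrite inE /B/= lerBrDl -lerBrDr.
      rewrite -[leRHS]invrK lef_pV2 ?posrE ?ltr0n ?invr_gt0 ?subr_gt0//.
      by rewrite (le_trans (ltW kx))// ler_nat (leq_trans kn).
    apply: cvg_near_cst; near=> n.
    rewrite /tr !indicE.
    have -> : tnth t ord0 \in B n by near: n; exact: near1.
    have -> : tnth t ord_max \in B n by near: n; exact: near1.
    by rewrite !mulr1.
Unshelve. all: by end_near. Qed.

End pair_statistics.

(** * First and second moments *)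

Section moments.
Variable R : realType.
Local Notation mR := (measurableTypeR R).
Local Notation mu := (@disk_mu R).
Variables (P : probability (conf R) R) (hP : determinantal P (@bergman R)).

Lemma bergman_diag (x : R[i]) : bergman x x = (kd x)%:C.
Proof.
by rewrite /bergman -sqnormC /kd -[1 in LHS](rmorph1 (@real_complex R)) -rmorphB -rmorphXn -fmorphV.
Qed.

Lemma bergman_sym (x y : R[i]) : bergman x y * bergman y x = (k2 x y)%:C.
Proof.
have E : 1 - y * x^*%C = (1 - x * y^*%C)^*%C.
  by rewrite rmorphB rmorphM rmorph1 /= conjcK mulrC.
rewrite /bergman E -invfM -exprMn -sqnormC /k2.
by rewrite -rmorphXn -fmorphV.
Qed.

Lemma measurable_kd : measurable_fun setT (@kd R : R[i] -> mR).
Proof.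
apply: (@measurableT_comp _ _ _ _ _ _ (fun x : mR => x^-1 : mR)).
  exact: measurable_invr.
apply: measurable_funX; apply: measurable_funB; first exact: measurable_cst.
exact: (@measurable_sqnorm R _ R[i] id (@measurable_id _ _ setT)).
Qed.

(** The two-point correlation function K(x,x) K(y,y) - |K(x,y)|^2, truncated so as to be
nonnegative also outside the disk. *)
Definition rho2 (x y : R[i]) : R := Num.max 0 (kd x * kd y - k2 x y).

(** Since |1 - x y^*|^2 = (1 - |x|^2) (1 - |y|^2) + |x - y|^2. *)
Lemma k2_le_kd (x y : R[i]) : disk x -> disk y -> k2 x y <= kd x * kd y.
Proof.
move=> /diskE x1 /diskE y1.
have E : sqnorm (1 - x * y^*%C) = (1 - sqnorm x) * (1 - sqnorm y) + sqnorm (x - y).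
  by case: x {x1} => a b; case: y {y1} => c d; rewrite /sqnorm/=; ring.
have p : 0 < (1 - sqnorm x) * (1 - sqnorm y) by rewrite mulr_gt0// subr_gt0.
rewrite /k2 /kd -invfM -exprMn lef_pV2 ?posrE ?exprn_gt0//; last first.
  by rewrite E (lt_le_trans p)// lerDl sqnorm_ge0.
by rewrite lerXn2r ?nnegrE ?sqnorm_ge0// ?(ltW p)// E lerDl sqnorm_ge0.
Qed.

Lemma rho2E (x y : R[i]) : disk x -> disk y -> rho2 x y + k2 x y = kd x * kd y.
Proof.
move=> dx dy; rewrite /rho2 max_r ?subrK//.
by rewrite subr_ge0 k2_le_kd.
Qed.

Lemma measurable_rho2 d (T : measurableType d) (f g : T -> R[i]) :
  measurable_fun setT f -> measurable_fun setT g ->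
  measurable_fun setT ((fun t => rho2 (f t) (g t)) : T -> mR).
Proof.
move=> mf mg; apply: measurable_maxr; first exact: measurable_cst.
apply: measurable_funB; last exact: measurable_k2.
by apply: measurable_funM; apply: (measurableT_comp measurable_kd).
Qed.

Local Open Scope ereal_scope.

(** The first correlation function is K(x,x). *)
Lemma expectation_linstat (f : R[i] -> R) :
  measurable_fun setT (f : R[i] -> mR) -> (forall x, 0 <= f x)%R ->
  \int[P]_X linstat f X = \int[mu]_x (f x * kd x)%:E.
Proof.
move=> mf f0.
have := hP (ltn0Sn 0) (phi := fun t => (f (tnth t ord0))%:E).
move=> /(_ _ _)/=; set r := (X in X -> _) => H.
have -> : \int[P]_X linstat f X = \int[P]_X
    \esum_(t in @distinct_tuples R 1 (X : config R)) (f (tnth t ord0))%:E.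
  apply: eq_integral => X _.
  rewrite /linstat (@reindex_esum _ _ _ (@distinct_tuples R 1 (X : config R)) _
    (fun t : 1.-tuple R[i] => tnth t ord0))//.
  split.
  - by move=> t [_]; exact.
  - move=> t u _ _ h; apply: eq_from_tnth => i; by rewrite ord1.
  - move=> x Xx; exists [tuple x] => //; split => // i; by rewrite ord1.
rewrite H{H}; last 2 first.
- apply/measurable_EFinP; apply: (measurableT_comp mf); exact: measurable_tnth.
- by move=> t; rewrite lee_fin.
rewrite -ge0_integral_disk; last 2 first.
- by apply/measurable_EFinP; apply: measurable_funM => //; exact: measurable_kd.
- by move=> x; rewrite lee_fin mulr_ge0// kd_ge0.
apply: eq_integral => x _; rewrite det_mx11 mxE /= -EFinM.
by congr (_ * _)%:E; rewrite !(tnth_nth 0%R)/= bergman_diag.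
Qed.

(** The second correlation function is the determinant of a 2 by 2 matrix. *)
Lemma expectation_pairstat (f g : R[i] -> R) :
  measurable_fun setT (f : R[i] -> mR) -> (forall x, 0 <= f x)%R ->
  measurable_fun setT (g : R[i] -> mR) -> (forall x, 0 <= g x)%R ->
  \int[P]_X pairstat f g X = \int[mu]_x \int[mu]_y (f x * g y * rho2 x y)%:E.
Proof.
move=> mf f0 mg g0.
have := hP (ltn0Sn 1) (phi := fun t => (f (tnth t ord0) * g (tnth t ord_max))%:E).
move=> /(_ _ _) -> /=; last 2 first.
- apply/measurable_EFinP; apply: measurable_funM.
    apply: (measurableT_comp mf); exact: measurable_tnth.
  apply: (measurableT_comp mg); exact: measurable_tnth.
- by move=> t; rewrite lee_fin mulr_ge0.
have mF : measurable_fun setT (fun p : R[i] * R[i] => (f p.1 * g p.2 * rho2 p.1 p.2)%:E).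
  apply/measurable_EFinP; apply: measurable_funM.
    apply: measurable_funM; apply: measurableT_comp => //.
  by apply: measurable_rho2.
have F0 x y : 0 <= (f x * g y * rho2 x y)%:E.
  by rewrite lee_fin !mulr_ge0// /rho2 le_max lexx.
rewrite -[RHS]ge0_integral_disk; last 2 first.
- exact: (measurable_fun_fubini_tonelli_F _ mF).
- by move=> x; apply: integral_ge0 => y _; exact: F0.
apply: eq_integral => x; rewrite inE => dx.
rewrite -[RHS]ge0_integral_disk//; last first.
  apply: (measurableT_comp mF (g := fun y => (x, y))).
  by apply: measurable_fun_pair; [exact: measurable_cst|exact: measurable_id].
apply: eq_integral => y; rewrite inE => dy.
rewrite -EFinM; congr (_ * _)%:E.
rewrite (expand_det_row _ ord0) !big_ord_recl big_ord0 /cofactor !det_mx11 !mxE/=.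
rewrite !(tnth_nth 0%R)/= /bump/= expr0 mul1r expr1 mulN1r mulrN bergman_sym !bergman_diag.
by rewrite addr0 -rmorphM -rmorphB/= -(rho2E dx dy) addrK.
Qed.

Definition pairint (F : R[i] -> R[i] -> R) : \bar R := \int[mu \x mu]_p (F p.1 p.2)%:E.

Definition measurable2 (F : R[i] -> R[i] -> R) :=
  measurable_fun setT ((fun p => F p.1 p.2) : R[i] * R[i] -> mR).

Lemma pairintE F : measurable2 F -> (forall x y, 0 <= F x y)%R ->
  pairint F = \int[mu]_x \int[mu]_y (F x y)%:E.
Proof.
move=> mF F0; rewrite /pairint fubini_tonelli1//; first exact/measurable_EFinP.
by move=> p; rewrite lee_fin.
Qed.

Lemma pairintD F G : measurable2 F -> measurable2 G -> (forall x y, 0 <= F x y)%R ->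
  (forall x y, 0 <= G x y)%R ->
  pairint (fun x y => F x y + G x y)%R = pairint F + pairint G.
Proof.
move=> mF mG F0 G0; rewrite /pairint -ge0_integralD//=.
- by move=> p _; rewrite lee_fin.
- exact/measurable_EFinP.
- by move=> p _; rewrite lee_fin.
- exact/measurable_EFinP.
Qed.

Lemma pairintZ (c : R) F : measurable2 F -> (forall x y, 0 <= F x y)%R -> (0 <= c)%R ->
  pairint (fun x y => c * F x y)%R = c%:E * pairint F.
Proof.
move=> mF F0 c0; rewrite /pairint -ge0_integralZl//=.
- exact/measurable_EFinP.
- by move=> p _; rewrite lee_fin.
Qed.

Lemma pairint_ge0 F : (forall x y, 0 <= F x y)%R -> 0 <= pairint F.
Proof. by move=> F0; apply: integral_ge0 => p _; rewrite lee_fin. Qed.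

Lemma pairintC F : measurable2 F -> (forall x y, 0 <= F x y)%R ->
  pairint (fun x y => F y x) = pairint F.
Proof.
move=> mF F0.
have mF' : measurable2 (fun x y => F y x).
  apply: (measurableT_comp mF (g := fun p : R[i] * R[i] => (p.2, p.1))).
  by apply: measurable_fun_pair; [exact: measurable_snd|exact: measurable_fst].
rewrite pairintE// /pairint fubini_tonelli2//; first exact/measurable_EFinP.
by move=> p; rewrite lee_fin.
Qed.

(** The measure charges only pairs of points of the disk. *)
Lemma le_pairint F G : measurable2 F -> measurable2 G -> (forall x y, 0 <= F x y)%R ->
  (forall x y, 0 <= G x y)%R -> (forall x y, disk x -> disk y -> F x y <= G x y)%R ->
  pairint F <= pairint G.
Proof.
move=> mF mG F0 G0 FG; rewrite !pairintE//.
have mE (H : R[i] -> R[i] -> R) : measurable2 H ->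
    measurable_fun setT (fun p : R[i] * R[i] => (H p.1 p.2)%:E).
  by move=> mH; exact/measurable_EFinP.
have m1 (H : R[i] -> R[i] -> R) x : measurable2 H -> measurable_fun setT (fun y => (H x y)%:E).
  move=> /mE mH; apply: (measurableT_comp mH (g := fun y => (x, y))).
  by apply: measurable_fun_pair; [exact: measurable_cst|exact: measurable_id].
apply: le_integral_disk.
- move=> x dx; apply: le_integral_disk; [|exact: m1..| |].
  + by move=> y dy; rewrite lee_fin FG.
  + by move=> y; rewrite lee_fin.
  + by move=> y; rewrite lee_fin.
- by apply: (measurable_fun_fubini_tonelli_F _ (mE _ mF)) => p; rewrite lee_fin.
- by apply: (measurable_fun_fubini_tonelli_F _ (mE _ mG)) => p; rewrite lee_fin.
- by move=> x; apply: integral_ge0 => y _; rewrite lee_fin.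
- by move=> x; apply: integral_ge0 => y _; rewrite lee_fin.
Qed.

Lemma measurable2_l (f : R[i] -> R) : measurable_fun setT (f : R[i] -> mR) ->
  measurable2 (fun x _ => f x).
Proof. by move=> mf; apply: (measurableT_comp mf); exact: measurable_fst. Qed.

Lemma measurable2_r (f : R[i] -> R) : measurable_fun setT (f : R[i] -> mR) ->
  measurable2 (fun _ y => f y).
Proof. by move=> mf; apply: (measurableT_comp mf); exact: measurable_snd. Qed.

Lemma measurable2_k2 : measurable2 (@k2 R).
Proof. by apply: measurable_k2; [exact: measurable_fst|exact: measurable_snd]. Qed.

Lemma measurable2_rho2 : measurable2 rho2.
Proof. by apply: measurable_rho2; [exact: measurable_fst|exact: measurable_snd]. Qed.

Lemma measurable2M F G : measurable2 F -> measurable2 G -> measurable2 (fun x y => F x y * G x y)%R.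
Proof. by move=> mF mG; exact: measurable_funM. Qed.

Lemma measurable2D F G : measurable2 F -> measurable2 G -> measurable2 (fun x y => F x y + G x y)%R.
Proof. by move=> mF mG; exact: measurable_funD. Qed.

Lemma pairint_prod (f g : R[i] -> R) :
  measurable_fun setT (f : R[i] -> mR) -> (forall x, 0 <= f x)%R ->
  measurable_fun setT (g : R[i] -> mR) -> (forall x, 0 <= g x)%R ->
  pairint (fun x y => f x * g y)%R = (\int[mu]_x (f x)%:E) * (\int[mu]_y (g y)%:E).
Proof.
move=> mf f0 mg g0; rewrite pairintE; last 2 first.
- by apply: measurable2M; [exact: measurable2_l|exact: measurable2_r].
- by move=> x y; rewrite mulr_ge0.
rewrite -ge0_integralZr//; last 3 first.
- exact/measurable_EFinP.
- by move=> x _; rewrite lee_fin.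
- by apply: integral_ge0 => y _; rewrite lee_fin.
apply: eq_integral => x _; rewrite -ge0_integralZl//.
- exact/measurable_EFinP.
- by move=> y _; rewrite lee_fin.
- by rewrite lee_fin.
Qed.

(** The term with K^2 stands on the left, so that the identity holds among nonnegative
quantities, finite or not. *)
Lemma second_moment (f g : R[i] -> R) :
  measurable_fun setT (f : R[i] -> mR) -> (forall x, 0 <= f x)%R ->
  measurable_fun setT (g : R[i] -> mR) -> (forall x, 0 <= g x)%R ->
  \int[P]_X (linstat f X * linstat g X) + pairint (fun x y => f x * g y * k2 x y)%R =
  \int[mu]_x (f x * g x * kd x)%:E + (\int[mu]_x (f x * kd x)%:E) * (\int[mu]_x (g x * kd x)%:E).
Proof.
move=> mf f0 mg g0.
have mfg : measurable_fun setT ((fun x => f x * g x)%R : R[i] -> mR) by exact: measurable_funM.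
have m2 : measurable2 (fun x y => f x * g y)%R.
  by apply: measurable2M; [exact: measurable2_l|exact: measurable2_r].
have r0 x y : (0 <= rho2 x y)%R by rewrite /rho2 le_max lexx.
have -> : \int[P]_X (linstat f X * linstat g X) = \int[P]_X
    (linstat (fun x => f x * g x)%R X + pairstat f g X).
  by apply: eq_integral => X _; rewrite linstatM.
rewrite ge0_integralD//; last 4 first.
- by move=> X _; apply: linstat_ge0 => x; rewrite mulr_ge0.
- by apply: measurable_linstat => // x; rewrite mulr_ge0.
- by move=> X _; exact: pairstat_ge0.
- exact: measurable_pairstat.
rewrite expectation_linstat//; last by move=> x; rewrite mulr_ge0.
rewrite expectation_pairstat// -addeA; congr (_ + _).
rewrite -(@pairintE (fun x y => f x * g y * rho2 x y)%R); last 2 first.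
- by apply: measurable2M => //; exact: measurable2_rho2.
- by move=> x y; rewrite !mulr_ge0.
rewrite -pairintD; last 4 first.
- by apply: measurable2M => //; exact: measurable2_rho2.
- by apply: measurable2M => //; exact: measurable2_k2.
- by move=> x y; rewrite !mulr_ge0.
- by move=> x y; rewrite !mulr_ge0 ?k2_ge0.
rewrite -pairint_prod; last 4 first.
- by apply: measurable_funM => //; exact: measurable_kd.
- by move=> x; rewrite mulr_ge0 ?kd_ge0.
- by apply: measurable_funM => //; exact: measurable_kd.
- by move=> x; rewrite mulr_ge0 ?kd_ge0.
have mL : measurable2 (fun x y => f x * g y * rho2 x y + f x * g y * k2 x y)%R.
  by apply: measurable2D; apply: measurable2M => //; [exact: measurable2_rho2|exact: measurable2_k2].
have mR' : measurable2 (fun x y => f x * kd x * (g y * kd y))%R.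
  by apply: measurable2M; [apply: measurable2_l|apply: measurable2_r]; apply: measurable_funM => //; exact: measurable_kd.
have L0 x y : (0 <= f x * g y * rho2 x y + f x * g y * k2 x y)%R.
  by rewrite addr_ge0// !mulr_ge0 ?k2_ge0.
have R0 x y : (0 <= f x * kd x * (g y * kd y))%R by rewrite !mulr_ge0 ?kd_ge0.
have E x y : disk x -> disk y -> (f x * g y * rho2 x y + f x * g y * k2 x y = f x * kd x * (g y * kd y))%R.
  by move=> dx dy; rewrite -mulrDr rho2E// mulrACA.
by apply/eqP; rewrite eq_le; apply/andP; split; apply: le_pairint => // x y dx dy; rewrite E.
Qed.

End moments.

(** * A lower bound for the variance *)

Section variance.
Variable R : realType.
Local Notation mR := (measurableTypeR R).
Local Notation mu := (@disk_mu R).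
Local Open Scope ereal_scope.

Lemma ge0_lty_EFin (x : \bar R) : 0 <= x -> x < +oo -> exists2 r : R, (0 <= r)%R & x = r%:E.
Proof.
case: x => [r|//|//] r0 _; exists r => //.
Qed.

Lemma pairint_reproducing (u : R[i] -> R) :
  measurable_fun setT (u : R[i] -> mR) -> (forall x, 0 <= u x)%R ->
  pairint (fun x y => u x * k2 x y)%R <= \int[mu]_x (u x * kd x)%:E.
Proof.
move=> mU u0.
have m2 : measurable2 (fun x y => u x * k2 x y)%R.
  by apply: measurable2M; [exact: measurable2_l|exact: measurable2_k2].
have p0 x y : (0 <= u x * k2 x y)%R by rewrite mulr_ge0 ?k2_ge0.
rewrite pairintE//; apply: le_integral_disk.
- move=> x dx.
  have mk : measurable_fun setT (fun y => (k2 x y)%:E).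
    apply/measurable_EFinP; apply: measurable_k2; first exact: measurable_cst.
    exact: measurable_id.
  under eq_integral do rewrite EFinM.
  rewrite ge0_integralZl//; last 2 first.
  - by move=> y _; rewrite lee_fin k2_ge0.
  - by rewrite lee_fin.
  by rewrite EFinM lee_wpmul2l ?lee_fin//; exact: bergman_reproducing.
- apply: (measurable_fun_fubini_tonelli_F (fun p => (u p.1 * k2 p.1 p.2)%:E)).
    exact/measurable_EFinP.
  by move=> p; rewrite lee_fin.
- by apply/measurable_EFinP; apply: measurable_funM => //; exact: measurable_kd.
- by move=> x; apply: integral_ge0 => y _; rewrite lee_fin.
- by move=> x; rewrite lee_fin mulr_ge0 ?kd_ge0.
Qed.

Variables (P : probability (conf R) R) (hP : determinantal P (@bergman R)).

Lemma linstat_ae_lty (f : R[i] -> R) :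
  measurable_fun setT (f : R[i] -> mR) -> (forall x, 0 <= f x)%R ->
  \int[mu]_x (f x * kd x)%:E < +oo ->
  {ae P, forall X, linstat f X < +oo}.
Proof.
move=> mf f0 flty.
have int : P.-integrable setT (linstat f).
  apply/integrableP; split; first exact: measurable_linstat.
  under eq_integral do rewrite gee0_abs ?linstat_ge0//.
  by rewrite (expectation_linstat hP).
have := integrable_ae measurableT int.
apply: filterS => X /(_ I) h.
by rewrite -ge0_fin_numE// linstat_ge0.
Qed.

(** Put h = f - g and let S be its linear statistic. By second_moment,
E S^2 = int h^2 K(x,x) - iint h(x) h(y) |K|^2 + (int h K(x,x))^2.
Dropping the last square, and using bergman_reproducing in the form
int h^2 K(x,x) >= iint h(x)^2 |K|^2, leaves half of iint (h(x) - h(y))^2 |K|^2.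
The function h enters through nonnegative f and g because moments are available
for nonnegative functions. *)
Lemma variance_ge (f g : R[i] -> R) :
  measurable_fun setT (f : R[i] -> mR) -> (forall x, 0 <= f x)%R ->
  measurable_fun setT (g : R[i] -> mR) -> (forall x, 0 <= g x)%R ->
  \int[mu]_x (f x * kd x)%:E < +oo -> \int[mu]_x (g x * kd x)%:E < +oo ->
  \int[mu]_x (f x * f x * kd x)%:E < +oo -> \int[mu]_x (g x * g x * kd x)%:E < +oo ->
  pairint (fun x y => ((f x - g x) - (f y - g y)) ^+ 2 * k2 x y)%R <=
  2%:E * \int[P]_X ((fine (linstat f X) - fine (linstat g X)) ^+ 2)%:E.
Proof.
move=> mf f0 mg g0 mfoo mgoo f2oo g2oo.
have Pge0 (u : R[i] -> R) : (forall x, 0 <= u x)%R -> 0 <= \int[mu]_x (u x * kd x)%:E.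
  by move=> u0; apply: integral_ge0 => x _; rewrite lee_fin mulr_ge0 ?kd_ge0.
have mU (u v : R[i] -> R) : measurable_fun setT (u : R[i] -> mR) ->
    measurable_fun setT (v : R[i] -> mR) -> measurable_fun setT ((fun x => u x * v x)%R : R[i] -> mR).
  by move=> *; exact: measurable_funM.
have muk (u : R[i] -> R) : measurable_fun setT (u : R[i] -> mR) ->
    measurable_fun setT (fun x => (u x * kd x)%:E).
  by move=> mu'; apply/measurable_EFinP; apply: mU => //; exact: measurable_kd.
pose h (x : R[i]) := (f x - g x)%R.
have mh : measurable_fun setT (h : R[i] -> mR) by exact: measurable_funB.
have h20 x : (0 <= h x ^+ 2)%R by exact: sqr_ge0.
have mh2 : measurable_fun setT ((fun x => h x ^+ 2)%R : R[i] -> mR) by exact: measurable_funX.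
have ff0 x : (0 <= f x * f x)%R by rewrite mulr_ge0.
have gg0 x : (0 <= g x * g x)%R by rewrite mulr_ge0.
have fg0 x : (0 <= f x * g x)%R by rewrite mulr_ge0.
have mff := mU _ _ mf mf. have mgg := mU _ _ mg mg. have mfg := mU _ _ mf mg.
have Dh : \int[mu]_x (h x ^+ 2 * kd x)%:E + 2%:E * \int[mu]_x (f x * g x * kd x)%:E =
    \int[mu]_x (f x * f x * kd x)%:E + \int[mu]_x (g x * g x * kd x)%:E.
  rewrite -ge0_integralZl//; last 2 first.
  - exact: (muk (fun x => f x * g x)%R).
  - by move=> x _; rewrite lee_fin mulr_ge0 ?kd_ge0.
  rewrite -!ge0_integralD//; last 8 first.
  - by move=> x _; rewrite lee_fin mulr_ge0 ?kd_ge0.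
  - exact: (muk (fun x => f x * f x)%R).
  - by move=> x _; rewrite lee_fin mulr_ge0 ?kd_ge0.
  - exact: (muk (fun x => g x * g x)%R).
  - by move=> x _; rewrite lee_fin mulr_ge0 ?kd_ge0.
  - exact: (muk (fun x => h x ^+ 2)%R).
  - by move=> x _; rewrite -EFinM lee_fin !mulr_ge0 ?kd_ge0.
  - by apply: emeasurable_funM; [exact: measurable_cst|exact: (muk (fun x => f x * g x)%R)].
  apply: eq_integral => x _; rewrite -EFinM -!EFinD; congr EFin; rewrite /h; ring.
have m2 (u v : R[i] -> R) : measurable_fun setT (u : R[i] -> mR) ->
    measurable_fun setT (v : R[i] -> mR) -> measurable2 (fun x y => u x * v y * k2 x y)%R.
  move=> mu1 mv; apply: measurable2M; last exact: measurable2_k2.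
  by apply: measurable2M; [exact: measurable2_l|exact: measurable2_r].
have q0 (u v : R[i] -> R) : (forall x, 0 <= u x)%R -> (forall x, 0 <= v x)%R ->
    forall x y, (0 <= u x * v y * k2 x y)%R.
  by move=> u0 v0 x y; rewrite !mulr_ge0 ?k2_ge0.
pose Q (u v : R[i] -> R) := pairint (fun x y => u x * v y * k2 x y)%R.
pose V (x y : R[i]) := ((h x - h y) ^+ 2 * k2 x y)%R.
have mV : measurable2 V.
  apply: measurable2M; last exact: measurable2_k2.
  apply: measurable_funX; apply: measurable_funB.
    exact: (measurable2_l mh).
  exact: (measurable2_r mh).
have V0 x y : (0 <= V x y)%R by rewrite mulr_ge0 ?sqr_ge0 ?k2_ge0.
have Z2 (u v : R[i] -> R) : measurable_fun setT (u : R[i] -> mR) ->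
    measurable_fun setT (v : R[i] -> mR) -> (forall x, 0 <= u x)%R -> (forall x, 0 <= v x)%R ->
    [/\ measurable2 (fun x y => 2 * (u x * v y * k2 x y))%R,
        forall x y, (0 <= 2 * (u x * v y * k2 x y))%R &
        pairint (fun x y => 2 * (u x * v y * k2 x y))%R = 2%:E * Q u v].
  move=> mu1 mv u0 v0; split.
  - by apply: measurable_funM; [exact: measurable_cst|exact: m2].
  - by move=> x y; rewrite mulr_ge0// q0.
  - by rewrite pairintZ//; [exact: m2|exact: q0].
have [mffZ ff0Z ffZ] := Z2 _ _ mf mf f0 f0.
have [mggZ gg0Z ggZ] := Z2 _ _ mg mg g0 g0.
have [mfgZ fg0Z fgZ] := Z2 _ _ mf mg f0 g0.
have [mgfZ gf0Z gfZ] := Z2 _ _ mg mf g0 f0.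
have mL : measurable2 (fun x y => h x ^+ 2 * k2 x y)%R.
  by apply: measurable2M; [exact: (measurable2_l mh2)|exact: measurable2_k2].
have L0 x y : (0 <= h x ^+ 2 * k2 x y)%R by rewrite mulr_ge0 ?k2_ge0.
have mL' : measurable2 (fun x y => h y ^+ 2 * k2 x y)%R.
  by apply: measurable2M; [exact: (measurable2_r mh2)|exact: measurable2_k2].
have L0' x y : (0 <= h y ^+ 2 * k2 x y)%R by rewrite mulr_ge0 ?k2_ge0.
have DV : pairint V + (2%:E * Q f f + 2%:E * Q g g) =
    (pairint (fun x y => h x ^+ 2 * k2 x y)%R + pairint (fun x y => h y ^+ 2 * k2 x y)%R) +
    (2%:E * Q f g + 2%:E * Q g f).
  rewrite -ffZ -ggZ -fgZ -gfZ -!pairintD//; last 6 first.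
  - exact: measurable2D.
  - exact: measurable2D.
  - by move=> x y; rewrite addr_ge0.
  - by move=> x y; rewrite addr_ge0.
  - exact: measurable2D.
  - by move=> x y; rewrite addr_ge0.
  by congr pairint; apply/funext => x; apply/funext => y; rewrite /V /h; ring.
have QC : Q g f = Q f g.
  rewrite /Q -pairintC; [|exact: m2|exact: q0].
  by congr pairint; apply/funext => x; apply/funext => y; rewrite k2C; ring.
have LC : pairint (fun x y => h y ^+ 2 * k2 x y)%R = pairint (fun x y => h x ^+ 2 * k2 x y)%R.
  rewrite -pairintC//.
  by congr pairint; apply/funext => x; apply/funext => y; rewrite k2C.
have Lle := pairint_reproducing mh2 h20.
have Mff := second_moment hP mf f0 mf f0.
have Mgg := second_moment hP mg g0 mg g0.
have Mfg := second_moment hP mf f0 mg g0.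
(* Every term of these identities is finite, so that they become linear equations
   between real numbers. *)
have [a a0 Ea] := ge0_lty_EFin (Pge0 _ f0) mfoo.
have [b b0 Eb] := ge0_lty_EFin (Pge0 _ g0) mgoo.
have [aa aa0 Eaa] := ge0_lty_EFin (Pge0 _ ff0) f2oo.
have [bb bb0 Ebb] := ge0_lty_EFin (Pge0 _ gg0) g2oo.
have Ege0 (u v : R[i] -> R) : (forall x, 0 <= u x)%R -> (forall x, 0 <= v x)%R ->
    0 <= \int[P]_X (linstat u X * linstat v X).
  by move=> u0 v0; apply: integral_ge0 => X _; rewrite mule_ge0// linstat_ge0.
have Qge0 (u v : R[i] -> R) : (forall x, 0 <= u x)%R -> (forall x, 0 <= v x)%R -> 0 <= Q u v.
  by move=> u0 v0; apply: pairint_ge0; exact: q0.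
have split_lty (x y : \bar R) r : 0 <= x -> 0 <= y -> x + y = r%:E ->
    exists2 p : R * R, x = p.1%:E & y = p.2%:E.
  by case: x => [x||]; case: y => [y||]//= _ _ _; exists (x, y).
have [[dh ab] /= Edh Eab'] : exists2 p : R * R, \int[mu]_x (h x ^+ 2 * kd x)%:E = p.1%:E &
    2%:E * \int[mu]_x (f x * g x * kd x)%:E = p.2%:E.
  apply: (@split_lty _ _ (aa + bb)%R); last by rewrite Dh Eaa Ebb.
    exact: (Pge0 (fun x => h x ^+ 2)%R).
  by rewrite mule_ge0// (Pge0 (fun x => f x * g x)%R).
have Eab : \int[mu]_x (f x * g x * kd x)%:E = (ab / 2)%:E.
  have : \int[mu]_x (f x * g x * kd x)%:E = 2^-1%:E * (2%:E * \int[mu]_x (f x * g x * kd x)%:E).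
    by rewrite muleA -EFinM mulVf ?mul1e// pnatr_eq0.
  by rewrite Eab' -EFinM mulrC.
rewrite Eaa Ea -EFinM -EFinD in Mff.
rewrite Ebb Eb -EFinM -EFinD in Mgg.
rewrite Eab Ea Eb -EFinM -EFinD in Mfg.
have [[e1 q1] /= E1 Q1] := split_lty _ _ _ (Ege0 _ _ f0 f0) (Qge0 _ _ f0 f0) Mff.
have [[e2 q2] /= E2 Q2] := split_lty _ _ _ (Ege0 _ _ g0 g0) (Qge0 _ _ g0 g0) Mgg.
have [[e3 q3] /= E3 Q3] := split_lty _ _ _ (Ege0 _ _ f0 g0) (Qge0 _ _ f0 g0) Mfg.
have [l l0 El] := ge0_lty_EFin (pairint_ge0 L0) (le_lt_trans Lle (eq_ind_r (fun z => z < +oo) (ltry _) Edh)).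
rewrite El Edh lee_fin in Lle.
rewrite Edh Eab Eaa Ebb -EFinM -!EFinD in Dh.
rewrite LC QC El Q1 Q2 Q3 -!EFinM -!EFinD in DV.
have [|[v w] /= Ev [Ew]] := split_lty _ _ _ (pairint_ge0 V0) _ DV.
  by rewrite lee_fin; have := Qge0 _ _ f0 f0; have := Qge0 _ _ g0 g0; rewrite Q1 Q2 !lee_fin; lra.
have mS (u : R[i] -> R) : measurable_fun setT (u : R[i] -> mR) -> (forall x, 0 <= u x)%R ->
    measurable_fun setT (linstat u) by move=> *; exact: measurable_linstat.
pose D := \int[P]_X ((fine (linstat f X) - fine (linstat g X)) ^+ 2)%:E.
have mD : measurable_fun setT (fun X : conf R => ((fine (linstat f X) - fine (linstat g X)) ^+ 2)%:E).
  apply/measurable_EFinP; apply: measurable_funX; apply: measurable_funB.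
    by apply: measurableT_comp; [exact: fine_measurable|exact: mS].
  by apply: measurableT_comp; [exact: fine_measurable|exact: mS].
have D0 : 0 <= D by apply: integral_ge0 => X _; rewrite lee_fin sqr_ge0.
have sfg0 (u w' : R[i] -> R) : (forall x, 0 <= u x)%R -> (forall x, 0 <= w' x)%R ->
    forall X : conf R, 0 <= linstat u X * linstat w' X.
  by move=> u0 w0 X; rewrite mule_ge0// linstat_ge0.
have DE : e1%:E + e2%:E <= D + 2%:E * e3%:E.
  rewrite -E1 -E2 -E3 /D -ge0_integralZl//; last 2 first.
  - by apply: emeasurable_funM; exact: mS.
  - by move=> X _; exact: sfg0.
  rewrite -!ge0_integralD//; last 7 first.
  - by move=> X _; rewrite lee_fin sqr_ge0.
  - by move=> X _; rewrite mule_ge0// sfg0.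
  - by apply: emeasurable_funM; [exact: measurable_cst|apply: emeasurable_funM; exact: mS].
  - by move=> X _; exact: sfg0.
  - by apply: emeasurable_funM; exact: mS.
  - by move=> X _; exact: sfg0.
  - by apply: emeasurable_funM; exact: mS.
  apply: ae_ge0_le_integral => //.
  - by move=> X _; rewrite adde_ge0// sfg0.
  - by apply: emeasurable_funD; apply: emeasurable_funM; exact: mS.
  - by move=> X _; rewrite adde_ge0// ?lee_fin ?sqr_ge0// mule_ge0// sfg0.
  - apply: emeasurable_funD => //.
    by apply: emeasurable_funM; [exact: measurable_cst|apply: emeasurable_funM; exact: mS].
  have := linstat_ae_lty mf f0 mfoo; have := linstat_ae_lty mg g0 mgoo.
  apply: filterS2 => X goo foo _.
  have [x x0 ->] := ge0_lty_EFin (linstat_ge0 X f0) foo.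
  have [y y0 ->] := ge0_lty_EFin (linstat_ge0 X g0) goo.
  by rewrite -!EFinM -!EFinD lee_fin /=; nra.
have -> : pairint (fun x y => (f x - g x - (f y - g y)) ^+ 2 * k2 x y)%R = v%:E by rewrite -Ev.
rewrite -/D; case: D D0 DE => [d| _ _|//].
  rewrite -!EFinM -!EFinD !lee_fin => d0 DE.
  move: Mff Mgg Mfg DV Dh; rewrite E1 E2 E3 -!/(Q _ _) Q1 Q2 Q3 Ev -!EFinD => -[M1] [M2] [M3] [M4] [M5].
  (* a - b is the mean of the statistic of h. *)
  have := sqr_ge0 (a - b); nra.
by rewrite gt0_muley ?leey// lte_fin.
Qed.

End variance.

(** * The weight given by the hyperbolic distance *)

Section poincare_weight.
Variable R : realType.
Local Notation mR := (measurableTypeR R).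
Local Notation mu := (@disk_mu R).

Definition rho (s : R) (x : R[i]) : R := expR (- s * dist 0 x).

Lemma mobius0x (x : R[i]) : mobius 0 x = x.
Proof. by rewrite /mobius conjc0 mul0r !subr0 divr1. Qed.

Lemma dist0x (x : R[i]) : dist 0 x = ln ((1 + cmod x) / (1 - cmod x)).
Proof. by rewrite /dist mobius0x. Qed.

Lemma distx0 (x : R[i]) : dist x 0 = dist 0 x.
Proof.
rewrite dist0x /dist /mobius mulr0 subr0 sub0r divr1.
by rewrite normcN.
Qed.

Lemma rho_gt0 s x : 0 < rho s x.
Proof. exact: expR_gt0. Qed.

Lemma measurable_rho s : measurable_fun setT (rho s : R[i] -> mR).
Proof.
have mc : measurable_fun setT ((fun x : R[i] => cmod x) : R[i] -> mR).
  by apply: measurable_cmod; exact: measurable_id.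
apply: (@measurableT_comp _ _ _ _ _ _ (expR : mR -> mR)) => //.
apply: measurable_funM; first exact: measurable_cst.
have -> : dist 0 = (fun x : R[i] => ln ((1 + cmod x) / (1 - cmod x))).
  by apply/funext => x; rewrite dist0x.
apply: (@measurableT_comp _ _ _ _ _ _ (@ln R : mR -> mR)) => //.
apply: measurable_funM; first by apply: measurable_funD; [exact: measurable_cst|].
apply: (@measurableT_comp _ _ _ _ _ _ (fun x : mR => x^-1 : mR)).
  exact: measurable_invr.
by apply: measurable_funB; [exact: measurable_cst|].
Qed.

(** For r = |x|, (1 - r)/(1 + r) = (1 - r^2)/(1 + r)^2. *)
Lemma rhoE s x : disk x -> rho s x = ((1 - sqnorm x) / (1 + cmod x) ^+ 2) `^ s.
Proof.
move=> dx; have r1 := cmod_lt1 dx; have r0 := cmod_ge0 x.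
rewrite /rho dist0x mulNr -mulrN -lnV ?posrE ?divr_gt0 ?subr_gt0 ?(lt_le_trans ltr01) ?lerDl//.
rewrite invf_div (_ : (1 - cmod x) / (1 + cmod x) = (1 - sqnorm x) / (1 + cmod x) ^+ 2); last first.
  by rewrite -sqr_cmod; field; rewrite gt_eqF// (lt_le_trans ltr01)// lerDl.
rewrite /powR gt_eqF// divr_gt0 ?exprn_gt0 ?subr_gt0 ?(lt_le_trans ltr01) ?lerDl//.
by apply/diskE.
Qed.

Lemma rho_le s x : 0 <= s -> disk x -> rho s x <= (1 - sqnorm x) `^ s.
Proof.
move=> s0 dx; have /diskE x1 := dx; have r0 := cmod_ge0 x; rewrite rhoE//.
have t0 : 0 <= 1 - sqnorm x by rewrite subr_ge0 ltW.
apply: ge0_ler_powR; rewrite ?nnegrE ?divr_ge0 ?sqr_ge0//.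
rewrite ler_pdivrMr; last by rewrite exprn_gt0 ?(lt_le_trans ltr01) ?lerDl.
by rewrite ler_peMr// exprn_ege1// lerDl.
Qed.

Lemma rho_ge s x : 0 <= s -> disk x -> ((1 - sqnorm x) / 4) `^ s <= rho s x.
Proof.
move=> s0 dx; have /diskE x1 := dx; have r0 := cmod_ge0 x; rewrite rhoE//.
have r1 := cmod_lt1 dx.
have t0 : 0 <= 1 - sqnorm x by rewrite subr_ge0 ltW.
have p : 0 < (1 + cmod x) ^+ 2 by rewrite exprn_gt0 ?(lt_le_trans ltr01) ?lerDl.
apply: ge0_ler_powR; rewrite ?nnegrE ?divr_ge0 ?sqr_ge0//.
rewrite ler_wpM2l// lef_pV2 ?posrE//.
by nra.
Qed.

Lemma rho_le1 s x : 0 <= s -> disk x -> rho s x <= 1.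
Proof.
move=> s0 dx; apply: (le_trans (rho_le s0 dx)).
have /diskE x1 := dx; have q0 := sqnorm_ge0 x.
rewrite -[leRHS](@powRr0 _ (1 - sqnorm x)); apply: ger_powR => //.
by rewrite subr_gt0 x1/= gerBl.
Qed.

Local Open Scope ereal_scope.

(** The integrand is at most (1 - |x|^2)^(s - 2), of which the integral is
the integral of t^(s - 2) over ]0,1]. *)
Lemma integral_rho_le s : (1 < s < 2)%R ->
  \int[mu]_x (rho s x * kd x)%:E <= ((s - 1)^-1)%:E.
Proof.
move=> /andP[s1 s2].
have mt : measurable_fun setT (fun u : mR => ((1 - u) `^ (s - 2))%:E).
  apply/measurable_EFinP.
  apply: (@measurableT_comp _ _ _ _ _ _ (fun x : mR => (x `^ (s - 2))%R)); first exact: measurable_powR.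
  by apply: measurable_funB.
apply: (@le_trans _ _ (\int[mu]_x ((1 - sqnorm x) `^ (s - 2))%:E)).
  apply: le_integral_disk.
  - move=> x dx; have /diskE x1 := dx.
    rewrite lee_fin /kd; apply: (@le_trans _ _ ((1 - sqnorm x) `^ s * ((1 - sqnorm x) ^+ 2)^-1)%R).
      by rewrite ler_wpM2r ?invr_ge0 ?sqr_ge0// rho_le// ltW// (lt_trans ltr01).
    rewrite -powR_invn; last by rewrite subr_ge0 ltW.
    by rewrite -powRD ?lexx//; apply/implyP => _; rewrite gt_eqF// subr_gt0.
  - by apply/measurable_EFinP; apply: measurable_funM; [exact: measurable_rho|exact: measurable_kd].
  - apply: (measurableT_comp mt (g := @sqnorm R)).
    exact: (@measurable_sqnorm R _ R[i] id (@measurable_id _ _ setT)).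
  - by move=> x; rewrite lee_fin mulr_ge0 ?kd_ge0// ltW// rho_gt0.
  - by move=> x; rewrite lee_fin powR_ge0.
rewrite (ge0_integral_sqnorm (f := fun u => ((1 - u) `^ (s - 2))%:E))//; last first.
  by move=> x; rewrite lee_fin powR_ge0.
have := @integral_le_primitive R (fun t => t `^ (s - 1) / (s - 1))%R (fun t => t `^ (s - 2))%R 1.
rewrite subrr powR1 mul1r ltr01 lexx/=; apply => //.
- move=> x /andP[x0 x2].
  have h1 := is_derive1_powR (s - 1)%R x0.
  have h2 := @is_deriveM _ _ (fun t : R => t `^ (s - 1))%R (cst (s - 1)^-1%R) x 1%R _ _ h1 (is_derive_cst _ _ _).
  apply: (is_derive_eq h2).
  rewrite /GRing.scale/= mulr0 add0r mulrA mulVf ?mul1r ?subr_eq0 ?gt_eqF//.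
  by rewrite (_ : s - 1 - 1 = s - 2)%R//; ring.
- move=> x /andP[x0 _]; apply: differentiable_continuous; apply/derivable1_diffP.
  by apply: derivable_powR; rewrite in_itv/= x0.
- by move=> x _; rewrite powR_ge0.
- by move=> x _; rewrite divr_ge0 ?powR_ge0// subr_ge0 ltW.
Qed.

Lemma integral_rho_gt0 s : (0 <= s)%R -> 0 < \int[mu]_x (rho s x * kd x)%:E.
Proof.
move=> s0.
pose c : R := (8^-1 `^ s)%R.
pose B : set R[i] := [set x : R[i] | sqnorm x <= 2^-1]%R.
have BE : B = @sqnorm R @^-1` `]-oo, 2^-1%R]%classic.
  by apply/seteqP; split => z /=; rewrite in_itv.
have mB : measurable B.
  rewrite BE -[X in measurable X]setTI.
  have /(_ measurableT) := @measurable_sqnorm R _ R[i] id (@measurable_id _ _ setT); apply.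
  exact: measurable_itv.
apply: (@lt_le_trans _ _ (\int[mu]_x (c%:E * (\1_B x)%:E))).
  rewrite ge0_integralZl//; last 2 first.
  - by apply/measurable_EFinP; exact: measurable_indic.
  - by rewrite lee_fin powR_ge0.
  rewrite integral_indic// setIT BE.
  rewrite [X in _ * X]disk_mu_law; last exact: measurable_itv.
  rewrite (_ : _ `&` _ = `[0%R, 2^-1%R]%classic); last first.
    apply/seteqP; split => x /=; rewrite !in_itv/=; first by move=> [-> /andP[-> _]].
    by move=> /andP[-> x1]; rewrite x1 (le_lt_trans x1)// invf_lt1 ?ltr1n.
  rewrite lebesgue_measure_itv/= lte_fin invr_gt0 ltr0n -EFinB -EFinM lte_fin.
  by rewrite mulr_gt0 ?subr0 ?invr_gt0// powR_gt0// invr_gt0.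
apply: le_integral_disk.
- move=> x dx; rewrite -EFinM lee_fin indicE.
  case: (boolP (x \in B)); rewrite ?mulr0 ?mulr1; last first.
    by move=> _; rewrite mulr_ge0 ?kd_ge0// ltW// rho_gt0.
  rewrite inE /B/= => xB.
  rewrite -[c]mulr1; apply: ler_pM => //; first exact: powR_ge0.
    apply: le_trans (rho_ge s0 dx).
    by apply: ge0_ler_powR => //; rewrite ?nnegrE; lra.
  have /diskE x1 := dx; have q0 := sqnorm_ge0 x.
  rewrite /kd invf_ge1 ?exprn_gt0 ?subr_gt0// exprn_ile1// ?subr_ge0 ?(ltW x1)//.
  by rewrite gerBl.
- by apply: emeasurable_funM; [exact: measurable_cst|apply/measurable_EFinP; exact: measurable_indic].
- by apply/measurable_EFinP; apply: measurable_funM; [exact: measurable_rho|exact: measurable_kd].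
- by move=> x; rewrite mule_ge0// lee_fin ?powR_ge0.
- by move=> x; rewrite lee_fin mulr_ge0 ?kd_ge0// ltW// rho_gt0.
Qed.

End poincare_weight.

(** * Pointwise bounds for the energy of the weighted monomials *)

Section energy.
Variable R : realType.

(** The weighted monomial h_n. *)
Definition hn (s : R) (n : nat) (x : R[i]) : R[i] := (rho s x)%:C * x ^+ n.

Lemma sqnormRC (r : R) : sqnorm r%:C = r ^+ 2.
Proof. by rewrite /sqnorm/= expr0n addr0. Qed.

Lemma cmod_hn s n x : cmod (hn s n x) = rho s x * cmod x ^+ n.
Proof.
rewrite /hn ComplexField.Normc.normcM; congr (_ * _).
  by rewrite cmodE sqnormRC sqrtr_sqr ger0_norm// ltW// rho_gt0.
elim: n => [|n ih]; first by rewrite !expr0 ComplexField.Normc.normc1.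
by rewrite !exprS ComplexField.Normc.normcM ih.
Qed.

(** In the ring, |x|^n is at least 1/2 by Bernoulli's inequality and 1 - |x|^2 is at
least 1/(4n). *)
Lemma cmod_hn_ge s n x : 1 <= s <= 2 -> (0 < n)%N ->
  1 - (2 * n%:R)^-1 <= sqnorm x -> sqnorm x <= 1 - (4 * n%:R)^-1 ->
  2^-1 * (16^-1 / n%:R) `^ s <= cmod (hn s n x).
Proof.
move=> /andP[s1 s2] n0 x1 x2.
have n0' : 0 < n%:R :> R by rewrite ltr0n.
have dx : disk x by apply/diskE; rewrite (le_lt_trans x2)// ltrBlDr ltrDl invr_gt0 mulr_gt0.
have r0 := cmod_ge0 x; have r1 := cmod_lt1 dx.
rewrite cmod_hn mulrC; apply: ler_pM.
- exact: powR_ge0.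
- by rewrite invr_ge0.
- apply: le_trans (rho_ge _ dx); last by rewrite (le_trans ler01).
  apply: ge0_ler_powR; first by rewrite (le_trans ler01).
  + by rewrite nnegrE divr_ge0// ltW.
  + by rewrite nnegrE divr_ge0// subr_ge0 ltW//; apply/diskE.
  rewrite ler_pdivlMr//; apply: (@le_trans _ _ (4 * n%:R)^-1); last by rewrite lerBrDl -lerBrDr.
  by rewrite invfM -[X in X <= _]mulrAC (_ : 16^-1 * 4 = 4^-1)//; field.
- apply: (@le_trans _ _ (cmod x ^+ (n + n))); last first.
    by apply: ler_wiXn2l => //; [exact: ltW|exact: leq_addr].
  rewrite addnn -mul2n exprM sqr_cmod.
  have t1 : (2 * n%:R)^-1 <= 1 :> R.
    by rewrite invf_le1 ?mulr_gt0// -natrM ler1n muln_gt0.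
  apply: (@le_trans _ _ ((1 - (2 * n%:R)^-1) ^+ n)); last first.
    by apply: lerXn2r; rewrite ?nnegrE ?sqnorm_ge0// subr_ge0.
  have bern m (t : R) : 0 <= t <= 1 -> 1 - m%:R * t <= (1 - t) ^+ m.
    move=> /andP[t0 t2]; elim: m => [|m ih]; first by rewrite expr0 mul0r subr0.
    rewrite exprS -natr1; apply: (@le_trans _ _ ((1 - t) * (1 - m%:R * t))).
      by have := ler0n R m; nra.
    by rewrite ler_wpM2l// subr_ge0.
  apply: le_trans (bern n _ _); last by rewrite t1 invr_ge0 mulr_ge0// ltW.
  by rewrite invfM mulrCA divff ?gt_eqF// mulr1; lra.
Qed.

(** Closer to the circle, where 1 - |y|^2 is at most 1/(64 n), the weight alone gives the
bound: it is at most (1/(64 n))^s, and 4^(-s) <= 1/4. *)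
Lemma cmod_hn_le s n y : 1 <= s <= 2 -> (0 < n)%N -> disk y ->
  1 - (64 * n%:R)^-1 <= sqnorm y ->
  cmod (hn s n y) <= 4^-1 * (16^-1 / n%:R) `^ s.
Proof.
move=> /andP[s1 s2] n0 dy y1.
have n0' : 0 < n%:R :> R by rewrite ltr0n.
have s0 : 0 <= s by rewrite (le_trans ler01).
rewrite cmod_hn; apply: (@le_trans _ _ (rho s y)).
  rewrite ler_piMr ?(ltW (rho_gt0 _ _))// exprn_ile1 ?cmod_ge0//.
  by rewrite ltW// cmod_lt1.
apply: (le_trans (rho_le s0 dy)).
have /diskE y2 := dy.
apply: (@le_trans _ _ ((4^-1 * (16^-1 / n%:R)) `^ s)).
  apply: ge0_ler_powR => //; rewrite ?nnegrE.
  - by rewrite subr_ge0 ltW.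
  - by rewrite mulr_ge0// divr_ge0// ltW.
  have E : 4^-1 * (16^-1 / n%:R) = (64 * n%:R)^-1 :> R by field; rewrite gt_eqF.
  by rewrite E; lra.
rewrite powRM ?divr_ge0 ?invr_ge0 ?(ltW n0')//.
rewrite ler_wpM2r ?powR_ge0//; apply: ge1r_powR => //.
by apply/andP; split; lra.
Qed.

(** The exponent s is at most 2. *)
Lemma scale_ge s n : 1 <= s <= 2 -> (0 < n)%N ->
  (16 ^+ 2)^-1 * n%:R `^ (- s) <= (16^-1 / n%:R) `^ s :> R.
Proof.
move=> /andP[s1 s2] n0.
have n0' : 0 < n%:R :> R by rewrite ltr0n.
have s0 : 0 <= s by rewrite (le_trans ler01).
rewrite powRM ?invr_ge0 ?(ltW n0')// -(powR_inv1 (ltW n0')) -powRrM mulN1r.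
rewrite ler_wpM2r ?powR_ge0// -exprVn -powR_mulrn ?invr_ge0//.
apply: ger_powR => //; apply/andP; split; lra.
Qed.

Lemma sqnormB_ge (a b : R[i]) : cmod b <= cmod a -> (cmod a - cmod b) ^+ 2 <= sqnorm (a - b).
Proof.
move=> ab; rewrite -sqr_cmod lerXn2r ?nnegrE ?cmod_ge0 ?subr_ge0//.
by rewrite lerBlDr -[X in cmod X <= _](subrK b) le_normcD.
Qed.

Lemma sqnormB_hn_ge s n x y : 1 <= s <= 2 -> (0 < n)%N ->
  1 - (2 * n%:R)^-1 <= sqnorm x -> sqnorm x <= 1 - (4 * n%:R)^-1 ->
  disk y -> 1 - (64 * n%:R)^-1 <= sqnorm y ->
  (2 ^+ 20)^-1 * (n%:R `^ (- s)) ^+ 2 <= sqnorm (hn s n x - hn s n y).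
Proof.
move=> s12 n0 x1 x2 dy y1.
have h1 := cmod_hn_ge s12 n0 x1 x2; have h2 := cmod_hn_le s12 n0 dy y1.
have h3 := scale_ge s12 n0.
set A := (16^-1 / n%:R) `^ s in h1 h2 h3; set B := n%:R `^ (- s) in h3 *.
have B0 : 0 <= B by exact: powR_ge0.
have A0 : 0 <= A by exact: powR_ge0.
apply: le_trans (sqnormB_ge _); last by lra.
have -> : (2 ^+ 20)^-1 * B ^+ 2 = (4^-1 * ((16 ^+ 2)^-1 * B)) ^+ 2 by field.
rewrite lerXn2r ?nnegrE ?mulr_ge0 ?invr_ge0 ?exprn_ge0//; lra.
Qed.

(** A square close to the point 1. In the pairing with a point x of the ring it is turned
by the argument of x. *)
Definition box (n : nat) : set R[i] :=
  [set z | 1 - (128 * n%:R)^-1 <= complex.Re z <= 1 - (256 * n%:R)^-1 /\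
           0 <= complex.Im z <= (256 * n%:R)^-1].

Lemma box_disk n y : (0 < n)%N -> box n y -> disk y /\ 1 - (64 * n%:R)^-1 <= sqnorm y.
Proof.
move=> n0 [/andP[p1 p2] /andP[q1 q2]].
have n0' : 1 <= n%:R :> R by rewrite ler1n.
have [d d0 [E1 E2 E3]] : exists2 d : R, 0 < d <= 256^-1 & [/\ (256 * n%:R)^-1 = d,
    (128 * n%:R)^-1 = 2 * d & (64 * n%:R)^-1 = 4 * d].
  exists (256 * n%:R)^-1; last by split=> //; field; rewrite gt_eqF// (lt_le_trans ltr01).
  apply/andP; split; first by rewrite invr_gt0 mulr_gt0 ?ltr0n.
  by rewrite invfM ler_piMr ?invr_ge0 ?ler0n// invf_le1 ?ltr0n.
move: p1 p2 q1 q2; rewrite E1 E2 E3; case: y => p q /= p1 p2 q1 q2.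
move/andP: d0 => [d0 d1].
split; first by apply/diskE; rewrite /sqnorm/=; nra.
by rewrite /sqnorm/=; nra.
Qed.

(** After rotation, x is the real number r = |x|. In terms of d = 1/(256 n), 1 - r y^* has
real part at most 130 d and imaginary part at most d, hence modulus at most
256 d = 1/n. *)
Lemma k2_box n x y w : (0 < n)%N -> box n y -> sqnorm w = 1 -> x = (cmod x)%:C * w ->
  1 - (2 * n%:R)^-1 <= sqnorm x -> sqnorm x < 1 ->
  n%:R ^+ 4 <= k2 x (w * y).
Proof.
move=> n0 By w1 xw x1 x2.
have [dy _] := box_disk n0 By; move: By => [/andP[p1 p2] /andP[q1 q2]].
have n0' : 1 <= n%:R :> R by rewrite ler1n.
have dx : disk x by apply/diskE.
have r0 := cmod_ge0 x; have r1 := cmod_lt1 dx.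
have rr : cmod x ^+ 2 = sqnorm x by exact: sqr_cmod.
have E : 1 - x * (w * y)^*%C = 1 - (cmod x)%:C * y^*%C.
  rewrite {1}xw rmorphM /= -mulrA [w * _]mulrA -sqnormC w1 mul1r//.
have [d /andP[d0 d1] [E1 E2 E3 E4]] : exists2 d : R, 0 < d <= 256^-1 & [/\ (256 * n%:R)^-1 = d,
    (128 * n%:R)^-1 = 2 * d, (2 * n%:R)^-1 = 128 * d & n%:R = (256 * d)^-1].
  exists (256 * n%:R)^-1; last by split=> //; field; rewrite gt_eqF// (lt_le_trans ltr01).
  apply/andP; split; first by rewrite invr_gt0 mulr_gt0 ?ltr0n.
  by rewrite invfM ler_piMr ?invr_ge0 ?ler0n// invf_le1 ?ltr0n.
move: p1 p2 q1 q2 x1; rewrite E1 E2 E3 E4 => p1 p2 q1 q2 x1.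
have sq : sqnorm (1 - x * (w * y)^*%C) <= (256 * d) ^+ 2.
  rewrite E; move: r0 r1 rr x1; move: (cmod x) => r r0 r1 rr x1.
  case: y p1 p2 q1 q2 {dy E} => p q /= p1 p2 q1 q2.
  rewrite /sqnorm/= !mul0r !subr0 !addr0 add0r mulrN opprK.
  have h1 : 0 <= 1 - r * p <= 130 * d by apply/andP; split; nra.
  have h2 : 0 <= r * q <= d by apply/andP; split; nra.
  nra.
have sq0 : 0 < sqnorm (1 - x * (w * y)^*%C).
  rewrite E; move: r0 r1; move: (cmod x) => r r0 r1.
  case: y p1 p2 q1 q2 {dy E sq} => p q /= p1 p2 q1 q2.
  rewrite /sqnorm/= !mul0r !subr0 !addr0 add0r mulrN opprK.
  have h1 : 0 < 1 - r * p by nra.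
  by rewrite ltr_pwDl ?exprn_gt0// sqr_ge0.
rewrite /k2 exprVn lef_pV2 ?posrE ?exprn_gt0 ?mulr_gt0 ?ltr0n//.
rewrite (_ : (256 * d) ^+ 4 = ((256 * d) ^+ 2) ^+ 2); last by ring.
by rewrite lerXn2r// nnegrE ?sqnorm_ge0 ?sqr_ge0.
Qed.

End energy.

(** * The energy of the weighted monomials *)

Section energy_bound.
Variable R : realType.
Local Notation mu := (@disk_mu R).

Lemma measurable_hn s n : measurable_fun setT (@hn R s n).
Proof.
apply: measurable_mulc; last exact/measurable_expc/measurable_id.
by apply: measurable_complex; [exact: measurable_rho|exact: measurable_cst].
Qed.

(** The product of the constants of sqnormB_hn_ge, of the area of the box, and of the area
of the ring. *)
Definition energy_const : R := (2 ^+ 20)^-1 * (256 ^+ 2)^-1 / pi * 4^-1.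

Lemma energy_const_gt0 : 0 < energy_const.
Proof.
apply: mulr_gt0; last by rewrite invr_gt0 ltr0n.
by apply: divr_gt0; [apply: mulr_gt0; rewrite invr_gt0 exprn_gt0 ?ltr0n|exact: pi_gt0].
Qed.

Lemma disk_mu_box n : (0 < n)%N ->
  measurable (@box R n) /\ disk_mu (@box R n) = (((256 * n%:R)^-1) ^+ 2 / pi)%:E.
Proof.
move=> n0; have n0' : 0 < n%:R :> R by rewrite ltr0n.
have h : 1 - (128 * n%:R)^-1 <= 1 - (256 * n%:R)^-1 :> R.
  by rewrite lerD2l lerN2 lef_pV2 ?posrE ?mulr_gt0 ?ltr0n// ler_pM2r// ler_nat.
have h' : 0 <= (256 * n%:R)^-1 :> R by rewrite invr_ge0 mulr_ge0 ?ler0n.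
have [|m ->] := @disk_mu_rect R _ _ _ _ h h'.
  by move=> x y hx hy; have [] := @box_disk R n (x +i* y) n0 (conj hx hy).
have n1 : n%:R != 0 :> R by rewrite gt_eqF.
have p1 : pi != 0 :> R by rewrite gt_eqF// pi_gt0.
split => //; congr EFin; move: (@pi R) p1 => q q0.
by field; rewrite n1 q0.
Qed.

(** The points x whose weighted monomial of degree n is largest, up to constants. *)
Definition ring_region (n : nat) : set R[i] :=
  [set z | 1 - (2 * n%:R)^-1 <= sqnorm z <= 1 - (4 * n%:R)^-1].

Lemma disk_mu_ring_region n : (0 < n)%N ->
  measurable (ring_region n) /\ disk_mu (ring_region n) = ((4 * n%:R)^-1)%:E.
Proof.
move=> n0; have n0' : 0 < n%:R :> R by rewrite ltr0n.
have E : ring_region n = @sqnorm R @^-1` `[1 - (2 * n%:R)^-1, 1 - (4 * n%:R)^-1]%classic.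
  by apply/seteqP; split => z /=; rewrite in_itv.
split.
  rewrite E -[X in measurable X]setTI.
  have /(_ measurableT) := @measurable_sqnorm R _ R[i] id (@measurable_id _ _ setT); apply.
  exact: measurable_itv.
rewrite E disk_mu_law; last exact: measurable_itv.
have t1 : (2 * n%:R)^-1 <= 1 :> R.
  by rewrite invf_le1 ?mulr_gt0// -natrM ler1n muln_gt0.
have t2 : 0 < (4 * n%:R)^-1 :> R by rewrite invr_gt0 mulr_gt0.
have t3 : (2 * n%:R)^-1 = 2 * (4 * n%:R)^-1 :> R by field; rewrite gt_eqF.
rewrite (_ : _ `&` _ = `[(1 - (2 * n%:R)^-1)%R, (1 - (4 * n%:R)^-1)%R]%classic); last first.
  apply/seteqP; split => x /=; rewrite !in_itv/=; first by case.
  move=> /andP[x1 x2]; rewrite x1 x2; split => //; apply/andP; split; lra.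
rewrite lebesgue_measure_itv/= lte_fin; case: ltP => h; last by exfalso; lra.
by rewrite -EFinB; congr EFin; lra.
Qed.

Local Open Scope ereal_scope.

(** Restrict x to the ring and y to the box turned by the argument of x. The integrand
is then at least c n^(-2s) n^4, and the areas contribute n^(-2) and n^(-1). *)
Lemma hn_energy_ge s n : (1 <= s <= 2)%R -> (0 < n)%N ->
  (energy_const * n%:R * (n%:R `^ (- s)) ^+ 2)%:E <=
  pairint (fun x y => sqnorm (hn s n x - hn s n y) * k2 x y)%R.
Proof.
move=> s12 n0; have n0' : (0 < n%:R :> R)%R by rewrite ltr0n.
pose F x y : R := (sqnorm (hn s n x - hn s n y) * k2 x y)%R.
have F0 x y : (0 <= F x y)%R by rewrite mulr_ge0 ?sqnorm_ge0 ?k2_ge0.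
have mF : measurable2 F.
  apply: measurable2M; last exact: measurable2_k2.
  apply: measurable_sqnorm.
  have -> : (fun p : R[i] * R[i] => hn s n p.1 - hn s n p.2)%R =
     (fun p : R[i] * R[i] => hn s n p.1 + (-1) * hn s n p.2)%R.
    by apply/funext => p; rewrite mulN1r.
  apply: measurable_addc; first by apply: (measurableT_comp (measurable_hn s n)); exact: measurable_fst.
  apply: measurable_mulc; first exact: measurable_cst.
  by apply: (measurableT_comp (measurable_hn s n)); exact: measurable_snd.
have mEF : measurable_fun setT (fun p : R[i] * R[i] => (F p.1 p.2)%:E) by exact/measurable_EFinP.
have mF1 x : measurable_fun setT (fun y => (F x y)%:E).
  apply: (measurableT_comp mEF (g := fun y => (x, y))).
  by apply: measurable_fun_pair; [exact: measurable_cst|exact: measurable_id].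
rewrite -/(pairint F) pairintE//.
have [mbox Ebox] := disk_mu_box n0.
have [mring Ering] := disk_mu_ring_region n0.
pose c : R := ((2 ^+ 20)^-1 * (n%:R `^ (- s)) ^+ 2 * n%:R ^+ 4)%R.
have c0 : (0 <= c)%R by rewrite !mulr_ge0 ?invr_ge0 ?exprn_ge0 ?powR_ge0 ?(ltW n0').
pose L : R := (c * (((256 * n%:R)^-1) ^+ 2 / pi))%R.
have L0 : (0 <= L)%R.
  by apply: mulr_ge0 => //; apply: divr_ge0; [exact: sqr_ge0|exact: pi_ge0].
have -> : (energy_const * n%:R * (n%:R `^ (- s)) ^+ 2)%R = (L * (4 * n%:R)^-1)%R.
  have n1 : (n%:R != 0 :> R)%R by rewrite gt_eqF.
  have p1 : (pi != 0 :> R)%R by rewrite gt_eqF// pi_gt0.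
  by rewrite /L /c /energy_const; move: (@pi R) p1 => q q0; field; rewrite n1 q0.
have inner x : ring_region n x -> L%:E <= \int[mu]_y (F x y)%:E.
  move=> /andP[x1 x2].
  have x3 : (sqnorm x < 1)%R by rewrite (le_lt_trans x2)// ltrBlDr ltrDl invr_gt0 mulr_gt0.
  have r0 : (cmod x != 0)%R.
    have : (0 < sqnorm x)%R.
      apply: (lt_le_trans _ x1); rewrite subr_gt0 invf_lt1 ?mulr_gt0//.
      by rewrite -natrM ltr1n mul2n -addnn (leq_ltn_trans n0)// -[X in (X < _)%N]addn0 ltn_add2l.
    by rewrite -sqr_cmod => h; apply/eqP => c00; move: h; rewrite c00 expr0n ltxx.
  pose w := (((cmod x)^-1)%:C * x)%R.
  have w1 : sqnorm w = 1%R by rewrite /w sqnormM sqnormRC -sqr_cmod exprVn mulVf// expf_neq0.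
  have xw : x = ((cmod x)%:C * w)%R.
    by rewrite /w mulrA -rmorphM divff// mul1r.
  rewrite -(@ge0_integral_disk_rot R w (fun y => (F x y)%:E))//; last by move=> y; rewrite lee_fin.
  apply: (@le_trans _ _ (\int[mu]_y (c%:E * (\1_(box n) y)%:E))).
    rewrite ge0_integralZl//; last by apply/measurable_EFinP; exact: measurable_indic.
    by rewrite integral_indic// setIT [X in _ <= _ * X]Ebox -EFinM.
  apply: le_integral_disk.
  - move=> y dy; rewrite -EFinM lee_fin indicE.
    case: (boolP (y \in box n)) => [|_]; last by rewrite mulr0.
    rewrite inE mulr1 => By; have [dy' y1] := box_disk n0 By.
    have swy : sqnorm (w * y)%R = sqnorm y by rewrite sqnormM w1 mul1r.
    apply: ler_pM.
    + by rewrite mulr_ge0 ?invr_ge0 ?exprn_ge0 ?powR_ge0.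
    + by rewrite exprn_ge0// ltW.
    + apply: sqnormB_hn_ge => //; last by rewrite swy.
      by apply/diskE; rewrite swy; apply/diskE.
    + exact: k2_box.
  - by apply: emeasurable_funM; [exact: measurable_cst|apply/measurable_EFinP; exact: measurable_indic].
  - apply: (measurableT_comp (mF1 x)).
    by apply: measurable_mulc; [exact: measurable_cst|exact: measurable_id].
  - by move=> y; rewrite mule_ge0// lee_fin.
  - by move=> y; rewrite lee_fin F0.
apply: (@le_trans _ _ (\int[mu]_y (L%:E * (\1_(ring_region n) y)%:E))).
  rewrite ge0_integralZl//; last by apply/measurable_EFinP; exact: measurable_indic.
  by rewrite integral_indic// setIT [X in _ <= _ * X]Ering -EFinM.
apply: le_integral_disk.
- move=> x dx; rewrite indicE; case: (boolP (x \in ring_region n)) => [|_].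
    by rewrite inE mule1 => /inner.
  by rewrite -EFinM mulr0; apply: integral_ge0 => y _; rewrite lee_fin F0.
- by apply: emeasurable_funM; [exact: measurable_cst|apply/measurable_EFinP; exact: measurable_indic].
- by apply: (measurable_fun_fubini_tonelli_F _ mEF) => p; rewrite lee_fin F0.
- by move=> y; rewrite mule_ge0// lee_fin.
- by move=> x; apply: integral_ge0 => y _; rewrite lee_fin F0.
Qed.

End energy_bound.

(** * Statistics of the weighted monomials *)

Section power_statistics.
Variable R : realType.
Local Notation mR := (measurableTypeR R).
Local Notation mu := (@disk_mu R).
Local Open Scope ereal_scope.

Definition pospart (u : R[i] -> R) (x : R[i]) : R := Num.max (u x) 0%R.

Lemma pospart_ge0 u x : (0 <= pospart u x)%R.
Proof. by rewrite /pospart le_max lexx orbT. Qed.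

Lemma pospartB u x : (pospart u x - pospart (fun z => - u z) x)%R = u x.
Proof. by rewrite /pospart; case: (leP (u x) 0%R); case: (leP (- u x)%R 0%R) => *; lra. Qed.

Lemma pospart_le u x : (pospart u x <= `|u x|)%R.
Proof. by rewrite /pospart ge_max normr_ge0 ler_norm. Qed.

Lemma measurable_pospart u : measurable_fun setT (u : R[i] -> mR) ->
  measurable_fun setT (pospart u : R[i] -> mR).
Proof. by move=> mu'; apply: measurable_maxr => //; exact: measurable_cst. Qed.

(** The linear statistic of a real function, as a difference of nonnegative ones; it is
meaningful where both are finite, which is almost surely the case below. *)
Definition realstat (u : R[i] -> R) (X : conf R) : R :=
  (fine (linstat (pospart u) X) - fine (linstat (pospart (fun z => - u z)%R) X))%R.

Lemma measurable_realstat u : measurable_fun setT (u : R[i] -> mR) ->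
  measurable_fun setT (realstat u : conf R -> mR).
Proof.
move=> mu'; apply: measurable_funB; (apply: measurableT_comp; first exact: fine_measurable).
  by apply: measurable_linstat; [exact: measurable_pospart|exact: pospart_ge0].
apply: measurable_linstat; last exact: pospart_ge0.
by apply: measurable_pospart; exact: measurable_funN.
Qed.

(** By integral_rho_le and since the weight is at most 1. *)
Lemma integral_kd_lty (s : R) (f : R[i] -> R) : (1 < s < 2)%R ->
  measurable_fun setT (f : R[i] -> mR) -> (forall x, 0 <= f x)%R ->
  (forall x, disk x -> f x <= rho s x)%R ->
  \int[mu]_x (f x * kd x)%:E < +oo /\ \int[mu]_x (f x * f x * kd x)%:E < +oo.
Proof.
move=> s12 mf f0 fr; have s0 : (0 <= s)%R by move/andP: s12 => [s1 _]; rewrite ltW// (lt_trans ltr01).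
have L := le_lt_trans (integral_rho_le s12) (ltry _).
have mk (u : R[i] -> R) : measurable_fun setT (u : R[i] -> mR) ->
    measurable_fun setT (fun x => (u x * kd x)%:E).
  by move=> mu'; apply/measurable_EFinP; apply: measurable_funM => //; exact: measurable_kd.
have pk (u : R[i] -> R) : (forall x, 0 <= u x)%R -> forall x, 0 <= (u x * kd x)%:E.
  by move=> u0 x; rewrite lee_fin mulr_ge0 ?kd_ge0.
split; apply: le_lt_trans L; apply: le_integral_disk.
- by move=> x dx; rewrite lee_fin ler_wpM2r ?kd_ge0 ?fr.
- exact: mk.
- by apply: mk; exact: measurable_rho.
- exact: pk.
- by apply: pk => x; exact/ltW/rho_gt0.
- move=> x dx; rewrite lee_fin ler_wpM2r ?kd_ge0//.
  by rewrite (le_trans (ler_pM _ _ (fr x dx) (fr x dx)))// ler_piMr ?rho_le1// ltW// rho_gt0.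
- by apply: (mk (fun x => f x * f x)%R); exact: measurable_funM.
- by apply: mk; exact: measurable_rho.
- by apply: (pk (fun x => f x * f x)%R) => x; rewrite mulr_ge0.
- by apply: pk => x; exact/ltW/rho_gt0.
Qed.

Variables (P : probability (conf R) R) (hP : determinantal P (@bergman R)).

Lemma realstat_variance_ge (s : R) (u : R[i] -> R) : (1 < s < 2)%R ->
  measurable_fun setT (u : R[i] -> mR) ->
  (forall x, disk x -> `|u x| <= rho s x)%R ->
  pairint (fun x y => (u x - u y) ^+ 2 * k2 x y)%R <=
  2%:E * \int[P]_X ((realstat u X) ^+ 2)%:E.
Proof.
move=> s12 mu' ur.
have mN : measurable_fun setT ((fun z => - u z)%R : R[i] -> mR) by exact: measurable_funN.
have [f1 f2] := integral_kd_lty s12 (measurable_pospart mu') (pospart_ge0 u)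
  (fun x dx => le_trans (pospart_le u x) (ur x dx)).
have [|g1 g2] := integral_kd_lty s12 (measurable_pospart mN) (pospart_ge0 _).
  by move=> x dx; rewrite (le_trans (pospart_le _ x))// normrN ur.
have := variance_ge hP (measurable_pospart mu') (pospart_ge0 _)
  (measurable_pospart mN) (pospart_ge0 _) f1 g1 f2 g2.
rewrite (_ : (fun x y => _) = (fun x y => (u x - u y) ^+ 2 * k2 x y)%R)//.
by apply/funext => x; apply/funext => y; rewrite !pospartB.
Qed.

(** The random variable S_n. *)
Definition powstat (s : R) (n : nat) (X : conf R) : R[i] :=
  (realstat (fun x => complex.Re (hn s n x)) X +i*
   realstat (fun x => complex.Im (hn s n x)) X)%C.

Lemma normRe_le_cmod (z : R[i]) : (`|complex.Re z| <= cmod z)%R.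
Proof. by rewrite cmodE -sqrtr_sqr ler_sqrt ?sqnorm_ge0// lerDl sqr_ge0. Qed.

Lemma normIm_le_cmod (z : R[i]) : (`|complex.Im z| <= cmod z)%R.
Proof. by rewrite cmodE -sqrtr_sqr ler_sqrt ?sqnorm_ge0// lerDr sqr_ge0. Qed.

Lemma cmod_hn_le_rho s n (x : R[i]) : disk x -> (cmod (hn s n x) <= rho s x)%R.
Proof.
move=> dx; rewrite cmod_hn ler_piMr ?(ltW (rho_gt0 _ _))//.
by rewrite exprn_ile1 ?cmod_ge0// ltW// cmod_lt1.
Qed.

Lemma measurable_powstat s n : measurable_fun setT (fun X => (sqnorm (powstat s n X))%:E).
Proof.
apply/measurable_EFinP; rewrite /sqnorm /powstat /=.
apply: measurable_funD; apply: measurable_funX; apply: measurable_realstat.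
  exact: (measurableT_comp (@measurable_Re R) (measurable_hn s n)).
exact: (measurableT_comp (@measurable_Im R) (measurable_hn s n)).
Qed.

(** The energy of h_n is the sum of the energies of its real and imaginary parts, and
realstat_variance_ge applies to each. *)
Lemma powstat_second_moment_ge s n : (1 < s < 2)%R -> (0 < n)%N ->
  (2^-1 * energy_const R * n%:R * (n%:R `^ (- s)) ^+ 2)%:E <=
  \int[P]_X (sqnorm (powstat s n X))%:E.
Proof.
move=> s12 n0.
have s12' : (1 <= s <= 2)%R by move/andP: s12 => [s1 s2]; rewrite !ltW.
have mr : measurable_fun setT ((fun x => complex.Re (hn s n x)) : R[i] -> mR).
  exact: (measurableT_comp (@measurable_Re R) (measurable_hn s n)).
have mi : measurable_fun setT ((fun x => complex.Im (hn s n x)) : R[i] -> mR).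
  exact: (measurableT_comp (@measurable_Im R) (measurable_hn s n)).
have Vr := realstat_variance_ge s12 mr (fun x dx => le_trans (normRe_le_cmod _) (cmod_hn_le_rho s n dx)).
have Vi := realstat_variance_ge s12 mi (fun x dx => le_trans (normIm_le_cmod _) (cmod_hn_le_rho s n dx)).
have H := hn_energy_ge s12' n0.
have m2 (u : R[i] -> R) : measurable_fun setT (u : R[i] -> mR) ->
    measurable2 (fun x y => (u x - u y) ^+ 2 * k2 x y)%R.
  move=> mu'; apply: measurable2M; last exact: measurable2_k2.
  apply: measurable_funX; apply: measurable_funB.
    exact: (measurable2_l mu').
  exact: (measurable2_r mu').
have E : pairint (fun x y => sqnorm (hn s n x - hn s n y) * k2 x y)%R =
   pairint (fun x y => (complex.Re (hn s n x) - complex.Re (hn s n y)) ^+ 2 * k2 x y)%R +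
   pairint (fun x y => (complex.Im (hn s n x) - complex.Im (hn s n y)) ^+ 2 * k2 x y)%R.
  rewrite -pairintD; [|exact: m2|exact: m2| |].
  - congr pairint; apply/funext => x; apply/funext => y; rewrite -mulrDl; congr (_ * _)%R.
    by case: (hn s n x) => a b; case: (hn s n y) => c d.
  - by move=> x y; rewrite mulr_ge0 ?sqr_ge0 ?k2_ge0.
  - by move=> x y; rewrite mulr_ge0 ?sqr_ge0 ?k2_ge0.
have msq (u : R[i] -> R) : measurable_fun setT (u : R[i] -> mR) ->
    measurable_fun setT (fun X => ((realstat u X) ^+ 2)%:E).
  by move=> mu'; apply/measurable_EFinP; apply: measurable_funX; exact: measurable_realstat.
have EP : \int[P]_X (sqnorm (powstat s n X))%:E =
  \int[P]_X ((realstat (fun x => complex.Re (hn s n x)) X) ^+ 2)%:E +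
  \int[P]_X ((realstat (fun x => complex.Im (hn s n x)) X) ^+ 2)%:E.
  rewrite -ge0_integralD//.
  - by move=> X _; rewrite lee_fin sqr_ge0.
  - exact: msq.
  - by move=> X _; rewrite lee_fin sqr_ge0.
  - exact: msq.
have {E H} : (energy_const R * n%:R * (n%:R `^ (- s)) ^+ 2)%:E <= 2%:E * \int[P]_X (sqnorm (powstat s n X))%:E.
  apply: (le_trans H); rewrite E EP muleDr//; first exact: leeD.
  by apply: ge0_adde_def; rewrite inE; apply: integral_ge0 => X _; rewrite lee_fin sqr_ge0.
move=> /(@lee_wpmul2l _ 2^-1%:E) => /(_ _).
rewrite muleA -!EFinM mulVf ?pnatr_eq0// mul1e !mulrA; apply.
by rewrite lee_fin invr_ge0.
Qed.

End power_statistics.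

(** * Moments of the critical weight *)

Section critical_weight.
Variable R : realType.
Local Notation mR := (measurableTypeR R).
Local Notation lam := (@lebesgue_measure R).

(** The critical weight in terms of u = |z|^2. *)
Definition wcr (u : R) : R := ((1 - u) * ln (4 / (1 - u)) ^+ 2)^-1.

Lemma WcrE (z : R[i]) : Wcr z = wcr (sqnorm z).
Proof. by rewrite /Wcr /wcr sqr_cmod. Qed.

Lemma wcr_ge0 u : u < 1 -> 0 <= wcr u.
Proof. by move=> u1; rewrite invr_ge0 mulr_ge0 ?sqr_ge0// subr_ge0 ltW. Qed.

Lemma measurable_wcr : measurable_fun setT (wcr : mR -> mR).
Proof.
have m1 : measurable_fun setT (fun u : mR => 1 - u : mR) by apply: measurable_funB.
apply: (@measurableT_comp _ _ _ _ _ _ (fun x : mR => x^-1 : mR)); first exact: measurable_invr.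
apply: measurable_funM => //; apply: measurable_funX.
apply: (@measurableT_comp _ _ _ _ _ _ (@ln R : mR -> mR)) => //.
apply: measurable_funM; first exact: measurable_cst.
exact: (measurableT_comp (@measurable_invr R)).
Qed.

Lemma ln4_ge : 2^-1 <= ln 4 :> R.
Proof.
have := @ln_sublinear R 4^-1; rewrite invr_gt0 ltr0n => /(_ isT).
rewrite lnV ?posrE ?ltr0n// => h.
have h2 : ln (4 : R) = ln 2 + ln 2 by rewrite -lnM ?posrE// -natrM.
have := @ln_sublinear R 2^-1; rewrite invr_gt0 ltr0n => /(_ isT).
rewrite lnV ?posrE ?ltr0n// => h3.
have l2 : 0 <= ln (2 : R) by rewrite ln_ge0// ler1n.
have : 1 - 2^-1 <= ln (2 : R).
  have := @le_ln1Dx R (- 2^-1); rewrite ltrN2 invf_lt1 ?ltr1n// => /(_ isT).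
  rewrite (_ : 1 - 2^-1 = 2^-1); last by lra.
  by rewrite lnV ?posrE//; lra.
lra.
Qed.

Lemma ln4_sub (t : R) : 0 < t <= 1 -> 2^-1 <= ln 4 - ln t.
Proof.
move=> /andP[t0 t1]; have := ln4_ge; have := @ln_le0 R t t1; lra.
Qed.

Lemma ln_quot4 (t : R) : 0 < t -> ln (4 / t) = ln 4 - ln t.
Proof. by move=> t0; rewrite ln_div ?posrE. Qed.

(** The derivative of 1/(ln 4 - ln t) is 1/(t (ln 4 - ln t)^2). *)
Lemma integral_wcr_le d : 0 < d <= 1 ->
  (\int[lam]_(u in `[(1 - d)%R, 1%R[) (wcr u)%:E <= ((ln 4 - ln d)^-1)%:E)%E.
Proof.
move=> d01.
have := @integral_le_primitive R (fun t => (ln 4 - ln t)^-1)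
  (fun t => (t * (ln 4 - ln t) ^+ 2)^-1) d d01.
have pos (t : R) : 0 < t < 2 -> 0 < ln 4 - ln t.
  move=> /andP[t0 t2]; rewrite subr_gt0 ltr_ln ?posrE// (lt_trans t2)// ltr_nat//.
have -> : (\int[lam]_(u in `[(1 - d)%R, 1%R[) (wcr u)%:E = \int[lam]_(u in `[(1 - d)%R, 1%R[)
    (((1 - u) * (ln 4 - ln (1 - u)) ^+ 2)^-1)%:E)%E.
  apply: eq_integral => u; rewrite inE/= in_itv/= => /andP[_ u1].
  by rewrite /wcr ln_quot4// subr_gt0.
have dl (t : R) : 0 < t < 2 -> is_derive t 1 (fun v : R => ln 4 - ln v) (- t^-1).
  move=> /andP[t0 _]; have h := is_derive1_ln t0.
  by rewrite -[- t^-1]sub0r; apply: is_deriveB.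
apply.
- move=> t t02; have /andP[t0 _] := t02.
  have p := pos t t02.
  have := @is_deriveV R (fun v : R => ln 4 - ln v) t _ 1 _ (dl t t02).
  rewrite gt_eqF// => /(_ isT) h; apply: (is_derive_eq h).
  by rewrite /GRing.scale/=; field; rewrite !gt_eqF.
- move=> t t02; have /andP[t0 _] := t02.
  apply: continuousV; first by rewrite mulf_neq0 ?expf_neq0// gt_eqF// pos.
  apply: continuousM; first exact: cvg_id.
  have cl : {for t, continuous (fun v : R => ln 4 - ln v)}.
    by apply: continuousB; [exact: cvg_cst|exact: continuous_ln].
  by apply: continuousM.
- move=> t /andP[t0 _]; by rewrite invr_ge0 mulr_ge0 ?sqr_ge0// ltW.
- move=> t t01; rewrite invr_ge0; apply: le_trans (ln4_sub t01).
  by rewrite invr_ge0.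
Qed.

Lemma expr_tail (u : R) n : (0 < n)%N -> 0 <= u < 1 -> u ^+ n <= (n%:R * (1 - u))^-1.
Proof.
move=> n0 /andP[u0 u1].
have n0' : 0 < n%:R :> R by rewrite ltr0n.
rewrite -[leRHS]mul1r ler_pdivlMr; last by rewrite mulr_gt0 ?subr_gt0.
have h : \sum_(i < n) u ^+ i * (1 - u) <= 1.
  rewrite -mulr_suml mulrC.
  have := subrX1 u n; rewrite -opprB -[u - 1]opprB mulNr => /oppr_inj <-.
  by rewrite gerBl exprn_ge0.
apply: le_trans h.
rewrite (_ : u ^+ n * (n%:R * (1 - u)) = \sum_(i < n) u ^+ n * (1 - u)); last first.
  by rewrite sumr_const card_ord -mulr_natl; ring.
apply: ler_sum => i _; rewrite ler_wpM2r ?subr_ge0 ?(ltW u1)//.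
by apply: ler_wiXn2l => //; [exact: ltW|exact: ltnW].
Qed.

(** Cut at 1 - u = d with d = n^(-1/2). Beyond the cut, the weight alone has integral at
most 1/(ln 4 - ln d), of order 1/ln n; before the cut, u^n is at most 1/(n d) = d by
expr_tail, which is smaller than 2/ln n. *)
Lemma integral_pow_wcr_le n : (2 <= n)%N ->
  (\int[lam]_(u in `[0%R, 1%R[) ((u ^+ n)%:E * (wcr u)%:E) <= (8 / ln n%:R)%:E)%E.
Proof.
move=> n2.
have n0 : 0 < n%:R :> R by rewrite ltr0n (leq_trans _ n2).
have n1 : 1 < n%:R :> R by rewrite ltr1n.
have ln0 : 0 < ln (n%:R : R) by rewrite ln_gt0.
pose q : R := Num.sqrt n%:R.
have q1 : 1 <= q by rewrite -[leLHS]sqrtr1 ler_sqrt// ltW.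
have q0 : 0 < q by rewrite (lt_le_trans ltr01).
have qq : q ^+ 2 = n%:R by rewrite sqr_sqrtr// ltW.
pose d := q^-1.
have d01 : 0 < d <= 1 by rewrite invr_gt0 q0 invf_le1.
have lnd : ln d = - (ln n%:R / 2).
  by rewrite lnV ?posrE// -qq expr2 lnM ?posrE//; lra.
have mw : measurable_fun setT (fun u : mR => (wcr u)%:E) by apply/measurable_EFinP; exact: measurable_wcr.
pose A : set R := `[0%R, 1%R[%classic. pose B : set R := `[(1 - d)%R, 1%R[%classic.
have mB : measurable (B : set mR) by exact: measurable_itv.
have mA : measurable (A : set mR) by exact: measurable_itv.
have BA : B `<=` A.
  move=> u; rewrite /A /B/= !in_itv/= => /andP[u1 ->]; rewrite andbT (le_trans _ u1)//.
  by rewrite subr_ge0; case/andP: d01.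
apply: (@le_trans _ _ (\int[lam]_(u in A) ((\1_B u * wcr u)%:E + d%:E * (wcr u)%:E))%E).
  apply: ge0_le_integral => //.
  - move=> u; rewrite /A/= in_itv/= => /andP[u0 u1].
    by rewrite mule_ge0// lee_fin ?exprn_ge0// wcr_ge0.
  - apply: measurable_funTS; apply: emeasurable_funM => //.
    by apply/measurable_EFinP; exact: exprn_measurable.
  - apply: measurable_funTS; apply: emeasurable_funD.
      apply/measurable_EFinP; apply: measurable_funM; last exact: measurable_wcr.
      exact: measurable_indic.
    by apply: emeasurable_funM => //; exact: measurable_cst.
  - move=> u; rewrite /A/= in_itv/= => /andP[u0 u1].
    rewrite -!EFinM -EFinD lee_fin -mulrDl ler_wpM2r ?wcr_ge0// indicE.
    case: (boolP (u \in B)) => uB.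
      by rewrite (le_trans (exprn_ile1 _ u0 (ltW u1)))// lerDl; case/andP: d01 => /ltW.
    rewrite add0r.
    have ud : u < 1 - d.
      rewrite ltNge; apply/negP => h; move: uB; rewrite notin_setE; apply.
      by rewrite /B/= in_itv/= h u1.
    apply: (@le_trans _ _ (n%:R * (1 - u))^-1).
      by apply: expr_tail; rewrite ?u0// (leq_trans _ n2).
    rewrite /d lef_pV2 ?posrE ?mulr_gt0 ?subr_gt0// -qq expr2 -mulrA ler_pMr//.
    by rewrite -ler_pdivrMl// mulr1 lerBrDr -lerBrDl ltW.
rewrite ge0_integralD//=; last 4 first.
- move=> u; rewrite /A/= in_itv/= => /andP[u0 u1].
  by rewrite lee_fin mulr_ge0 ?wcr_ge0.
- apply: measurable_funTS; apply/measurable_EFinP; apply: measurable_funM; last exact: measurable_wcr.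
  exact: measurable_indic.
- move=> u; rewrite /A/= in_itv/= => /andP[u0 u1].
  by rewrite mule_ge0// lee_fin ?wcr_ge0//; case/andP: d01 => /ltW.
- by apply: measurable_funTS; apply: emeasurable_funM => //; exact: measurable_cst.
rewrite ge0_integralZl//; last 3 first.
- exact: measurable_funTS.
- move=> u; rewrite /A/= in_itv/= => /andP[u0 u1].
  by rewrite lee_fin ?wcr_ge0.
- by rewrite lee_fin; case/andP: d01 => /ltW.
have IA : (\int[lam]_(u in A) (wcr u)%:E <= 2%:E)%E.
  have := @integral_wcr_le 1; rewrite subrr ln1 subr0 ltr01 lexx => /(_ isT) h.
  apply: (le_trans h); rewrite lee_fin -[leRHS]invrK lef_pV2 ?posrE ?invr_gt0//.
    exact: ln4_ge.
  by rewrite (lt_le_trans _ ln4_ge)// invr_gt0.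
have IB : (\int[lam]_(u in A) (\1_B u * wcr u)%:E <= (2 / ln n%:R)%:E)%E.
  have -> : (\int[lam]_(u in A) (\1_B u * wcr u)%:E = \int[lam]_(u in B) (wcr u)%:E)%E.
    rewrite [RHS]integral_mkcond [LHS]integral_mkcond; apply: eq_integral => u _.
    rewrite !patchE indicE; case: (boolP (u \in B)) => uB.
      by rewrite (mem_set (BA _ _)) ?mul1r//; exact/set_mem.
    by rewrite mul0r; case: ifP.
  apply: (le_trans (integral_wcr_le d01)).
  rewrite lee_fin lnd opprK -[leRHS]invrK lef_pV2 ?posrE ?invf_div ?divr_gt0//.
    have := ln4_ge; lra.
  have := ln4_ge; move: ln0; lra.
apply: (@le_trans _ _ ((2 / ln n%:R)%:E + d%:E * 2%:E)%E).
  by apply: leeD => //; apply: lee_wpmul2l => //; rewrite lee_fin; case/andP: d01 => /ltW.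
rewrite -EFinM -EFinD lee_fin.
have : d <= 2 / ln n%:R.
  rewrite /d -[leRHS]invrK lef_pV2 ?posrE ?invf_div ?divr_gt0//.
  have := ln_sublinear q0; rewrite -qq expr2 lnM ?posrE//; lra.
have : 0 <= (ln (n%:R : R))^-1 by rewrite invr_ge0 ltW.
lra.
Qed.

End critical_weight.

(** * Summation over hyperbolic annuli *)

Section shell_series.
Variable R : realType.

Lemma dist0_ge0 (x : R[i]) : disk x -> 0 <= dist 0 x.
Proof.
move=> dx; have r1 := cmod_lt1 dx; have r0 := cmod_ge0 x.
rewrite dist0x ln_ge0// ler_pdivlMr ?subr_gt0// mul1r; lra.
Qed.

(** A hyperbolic disc about 0 is a Euclidean disc about 0 of smaller radius than 1. *)
Lemma sqnorm_le_dist (x : R[i]) (D : R) : disk x -> dist 0 x < D ->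
  sqnorm x <= (expR D - 1) / (expR D + 1).
Proof.
move=> dx; have r1 := cmod_lt1 dx; have r0 := cmod_ge0 x.
rewrite dist0x -ltr_expR lnK; last first.
  by rewrite posrE divr_gt0 ?subr_gt0// (lt_le_trans ltr01)// lerDl.
rewrite ltr_pdivrMr ?subr_gt0// => h.
have e0 := expR_gt0 D.
rewrite ler_pdivlMr; last by rewrite addr_gt0.
rewrite -sqr_cmod; nra.
Qed.

Lemma finite_shell (X : config R) k : finite_set ((X : set R[i]) `&` annulus k 0).
Proof.
apply: sub_finite_set (@finite_points_disc R X ((expR k.+1%:R - 1) / (expR k.+1%:R + 1)) _).
  move=> x [Xx [dx /andP[_ xk]]]; split => //; exact: sqnorm_le_dist.
have e0 := expR_gt0 (k.+1%:R : R).
rewrite ltr_pdivrMr; last by rewrite addr_gt0.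
by rewrite mul1r; lra.
Qed.

Lemma points_shells (X : config R) :
  (X : set R[i]) = \bigcup_k ((X : set R[i]) `&` annulus k 0).
Proof.
apply/seteqP; split => x; last by move=> [k _ []].
move=> Xx; have dx := @points_disk R X x Xx.
exists (Num.truncn (dist 0 x)) => //; split => //; split => //.
by have := truncn_itv (dist0_ge0 dx).
Qed.

Lemma trivIset_shells (X : config R) :
  trivIset setT (fun k => (X : set R[i]) `&` annulus k 0).
Proof.
move=> i j _ _ [x [[_ [_ /andP[i1 i2]]] [_ [_ /andP[j1 j2]]]]].
apply/eqP; rewrite eqn_leq; apply/andP; split; rewrite -ltnS -(ltr_nat R).
  exact: le_lt_trans i1 j2.
exact: le_lt_trans j1 i2.
Qed.

(** The annuli partition the configuration into finite sets, so that the outer series is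
a regrouping of a convergent sum of nonnegative terms. *)
Lemma cvg_shell_ge0 (f : R[i] -> R) (X : conf R) : (forall x, 0 <= f x) ->
  (linstat f X < +oo)%E ->
  series (fun k => \sum_(x \in ((X : config R) : set R[i]) `&` annulus k 0) f x) @ \oo
    --> fine (linstat f X).
Proof.
move=> f0 foo.
pose S k := ((X : config R) : set R[i]) `&` annulus k 0.
have Sk k : (\esum_(x in S k) (f x)%:E = (\sum_(x \in S k) f x)%:E)%E.
  rewrite esum_fset; [|exact: finite_shell|by move=> x _; rewrite lee_fin].
  by rewrite fsumEFin//; exact: finite_shell.
have E : linstat f X = (\sum_(0 <= k <oo) (\sum_(x \in S k) f x)%:E)%E.
  rewrite /linstat points_shells nneseries_sum_bigcup//; last exact: trivIset_shells.
  by apply: eq_eseriesr => k _; exact: Sk.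
have s0 k : (0 <= (\sum_(x \in S k) f x)%:E)%E.
  by rewrite -Sk; apply: esum_ge0 => x _; rewrite lee_fin.
have cv : (\sum_(0 <= k < n) (\sum_(x \in S k) f x)%:E)%E @[n --> \oo] --> linstat f X.
  rewrite E; apply: is_cvg_nneseries => n _ _; exact: s0.
rewrite -(@fineK _ (linstat f X)) in cv; last by rewrite ge0_fin_numE ?linstat_ge0.
apply: cvg_trans (fine_cvg cv); apply: near_eq_cvg; near=> n.
by rewrite /series/= sumEFin.
Unshelve. all: by end_near. Qed.

Lemma cvg_shell_real (u : R[i] -> R) (X : conf R) :
  (linstat (pospart u) X < +oo)%E -> (linstat (pospart (fun z => - u z)%R) X < +oo)%E ->
  series (fun k => \sum_(x \in ((X : config R) : set R[i]) `&` annulus k 0) u x) @ \oo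
    --> realstat u X.
Proof.
move=> p1 p2.
have -> : series (fun k => \sum_(x \in ((X : config R) : set R[i]) `&` annulus k 0) u x) =
    (fun n => series (fun k => \sum_(x \in ((X : config R) : set R[i]) `&` annulus k 0) pospart u x) n -
      series (fun k => \sum_(x \in ((X : config R) : set R[i]) `&` annulus k 0)
        pospart (fun z => - u z) x) n).
  apply/funext => n; rewrite /series/= -sumrB; apply: eq_bigr => k _.
  have fk := finite_shell X k.
  rewrite !fsbig_finite//= -sumrB; apply: eq_bigr => x _.
  by rewrite pospartB.
exact: cvgB (cvg_shell_ge0 (pospart_ge0 _) p1) (cvg_shell_ge0 (pospart_ge0 _) p2).
Qed.

Lemma cvg_shell_complex (h : R[i] -> R[i]) (a b : R) (X : conf R) :
  series (fun k => \sum_(x \in ((X : config R) : set R[i]) `&` annulus k 0) complex.Re (h x)) @ \oo --> a ->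
  series (fun k => \sum_(x \in ((X : config R) : set R[i]) `&` annulus k 0) complex.Im (h x)) @ \oo --> b ->
  series (fun k => \sum_(x \in ((X : config R) : set R[i]) `&` annulus k 0) h x) @ \oo --> (a +i* b : R[i]).
Proof.
move=> ca cb.
have sumC (I : Type) (r : seq I) (F : I -> R[i]) :
    \sum_(i <- r) F i = (\sum_(i <- r) complex.Re (F i)) +i* (\sum_(i <- r) complex.Im (F i)).
  elim: r => [|i r ih]; first by rewrite !big_nil.
  by rewrite !big_cons ih; case: (F i).
rewrite (_ : series _ = (fun n => plane
    (series (fun k => \sum_(x \in ((X : config R) : set R[i]) `&` annulus k 0) complex.Re (h x)) n,
     series (fun k => \sum_(x \in ((X : config R) : set R[i]) `&` annulus k 0) complex.Im (h x)) n))).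
  have cp : {for (a, b), continuous (@plane R)} by exact: continuous_plane.
  have hh := continuous_cvg _ cp (cvg_pair ca cb).
  exact: hh.
apply/funext => n; rewrite /plane/= /series/= sumC.
congr (_ +i* _); apply: eq_bigr => k _;
  by rewrite !fsbig_finite ?sumC//; exact: finite_shell.
Qed.

Lemma le_linstat (f g : R[i] -> R) (X : conf R) : (forall x, disk x -> f x <= g x) ->
  (linstat f X <= linstat g X)%E.
Proof.
move=> fg; apply: le_esum => x Xx; rewrite lee_fin; apply: fg.
exact: (@points_disk R X x Xx).
Qed.

Lemma cvg_shell_hn s n (X : conf R) : (linstat (rho s) X < +oo)%E ->
  series (fun k => \sum_(x \in ((X : config R) : set R[i]) `&` annulus k 0) hn s n x) @ \oo
    --> powstat s n X.
Proof.
move=> Xoo.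
have lty (u : R[i] -> R) : (forall x, disk x -> `|u x| <= rho s x) -> (linstat (pospart u) X < +oo)%E.
  move=> ur; apply: le_lt_trans Xoo; apply: le_linstat => x dx.
  exact: le_trans (pospart_le u x) (ur x dx).
apply: cvg_shell_complex; apply: cvg_shell_real; apply: lty => x dx;
  rewrite ?normrN (le_trans _ (cmod_hn_le_rho s n dx))// ?normRe_le_cmod ?normIm_le_cmod//.
Qed.

Lemma cvgc_add_mul (c : R[i]) (u v : nat -> R[i]) (l m : R[i]) :
  u @ \oo --> l -> v @ \oo --> m -> (fun n => u n + c * v n) @ \oo --> l + c * m.
Proof.
move=> ul vm.
have cc : (fun _ : nat => c) @ \oo --> c by exact: cvg_cst.
have h : (fun n => c * v n) @ \oo --> c * m by exact: cvgM cc vm.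
exact: cvgD ul h.
Qed.

(** By linearity, applied to the convergent series of each monomial. Absolute convergence
is guaranteed by finiteness of the sum of the weights, since |z^n| <= 1. *)
Lemma gXf_poly s M (a : nat -> R[i]) (X : conf R) : (linstat (rho s) X < +oo)%E ->
  gXf X s 0 (fun z => \sum_(j < M) a j * z ^+ j) = \sum_(j < M) a j * powstat s j X.
Proof.
move=> Xoo; apply: cvg_lim; first exact: norm_hausdorff.
pose T j := series (fun k => \sum_(x \in ((X : config R) : set R[i]) `&` annulus k 0) hn s j x).
rewrite (_ : series _ = (fun n => \sum_(j < M) a j * T j n)).
  elim: M => [|M ih].
    by rewrite big_ord0; under eq_fun do rewrite big_ord0; exact: cvg_cst.
  rewrite big_ord_recr/=; under eq_fun do rewrite big_ord_recr/=.
  exact: cvgc_add_mul ih (cvg_shell_hn Xoo).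
apply/funext => n; rewrite /T /series/=.
under [RHS]eq_bigr do rewrite mulr_sumr.
rewrite exchange_big/=; apply: eq_bigr => k _.
have fk := finite_shell X k.
under [RHS]eq_bigr do rewrite fsbig_finite//= mulr_sumr.
rewrite exchange_big/= fsbig_finite//=; apply: eq_bigr => x _.
rewrite mulr_sumr; apply: eq_bigr => j _.
by rewrite /hn /rho; ring.
Qed.

End shell_series.

(** * Duality with polynomial test functions *)

Section test_functions.
Variable R : realType.
Local Notation mR := (measurableTypeR R).
Local Notation mu := (@disk_mu R).

Lemma derivable_monomial (c z : R[i]) n : derivable (fun z : R[i] => c * z ^+ n) z 1.
Proof.
have hX : derivable (fun z : R[i] => z ^+ n) z 1 by exact: exprn_derivable.
have hc : derivable (fun z : R[i] => c) z 1 by exact: derivable_cst.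
exact: (derivableM hc hX).
Qed.

Lemma holomorphic_poly M (a : nat -> R[i]) :
  holomorphic_disk (fun z => \sum_(j < M) a j * z ^+ j).
Proof.
move=> z _; elim: M => [|M ih].
  rewrite (_ : (fun z => _) = (fun=> 0)); first exact: derivable_cst.
  by apply/funext => x; rewrite big_ord0.
rewrite (_ : (fun z => _) = (fun z => \sum_(j < M) a j * z ^+ j + a M * z ^+ M)).
  exact: (derivableD ih (@derivable_monomial (a M) z M)).
by apply/funext => x; rewrite big_ord_recr.
Qed.

(** Coefficients of degree 0 and 1 are excluded since ln j must be positive. The absolute
value of the weight makes it nonnegative outside the disk, as Parseval requires. *)
Lemma wnorm_sq_poly_le M (a : nat -> R[i]) : (forall j, (j < 2)%N -> a j = 0) ->
  (wnorm_sq (@Wcr R) (fun z => \sum_(j < M) a j * z ^+ j)%R <=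
   (\sum_(j < M) sqnorm (a j) * (8 / ln j%:R))%:E)%E.
Proof.
move=> a0; pose w u : \bar R := (`|wcr u|)%:E.
have mw : measurable_fun setT (w : mR -> \bar R).
  apply/measurable_EFinP; apply: (@measurableT_comp _ _ _ _ _ _ (fun u : mR => `|u| : mR)).
    exact: normr_measurable.
  exact: measurable_wcr.
have w0 u : (0 <= w u)%E by rewrite lee_fin.
have -> : wnorm_sq (@Wcr R) (fun z => \sum_(j < M) a j * z ^+ j)%R =
    (\int[mu]_z ((sqnorm (\sum_(j < M) a j * z ^+ j))%:E * w (sqnorm z)))%E.
  rewrite -ge0_integral_disk; last 2 first.
  - apply: emeasurable_funM.
      by apply/measurable_EFinP; apply: measurable_sqnorm; exact: measurable_polyfun.
    apply: (measurableT_comp mw).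
    exact: (@measurable_sqnorm R _ R[i] id (@measurable_id _ _ setT)).
  - by move=> z; rewrite mule_ge0// lee_fin sqnorm_ge0.
  apply: eq_integral => z; rewrite inE => /diskE z1.
  by rewrite WcrE sqr_cmod -EFinM ger0_norm// wcr_ge0.
rewrite disk_parseval// -sumEFin; apply: lee_sum => j _.
have [j2|j2] := ltnP j 2.
  by rewrite (a0 j j2) /sqnorm/= expr0n addr0 mul0e mul0r.
rewrite EFinM; apply: lee_wpmul2l; first by rewrite lee_fin sqnorm_ge0.
apply: le_trans (integral_pow_wcr_le R j2).
rewrite le_eqVlt; apply/orP; left; apply/eqP.
apply: eq_integral => u; rewrite inE/= in_itv/= => /andP[_ u1].
by rewrite /w ger0_norm// wcr_ge0.
Qed.

Lemma wnorm_sq_ge0 (f : R[i] -> R[i]) : (0 <= wnorm_sq (@Wcr R) f)%E.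
Proof.
apply: integral_ge0 => z /diskE z1; rewrite lee_fin mulr_ge0 ?sqr_ge0//.
by rewrite WcrE wcr_ge0.
Qed.

Lemma A2_ball_poly M (a : nat -> R[i]) : (forall j, (j < 2)%N -> a j = 0) ->
  \sum_(j < M) sqnorm (a j) * (8 / ln j%:R) < 1 ->
  A2_ball (@Wcr R) (fun z => \sum_(j < M) a j * z ^+ j).
Proof.
move=> a0 a1; have h := wnorm_sq_poly_le M a0.
have n0 := wnorm_sq_ge0 (fun z => \sum_(j < M) a j * z ^+ j).
split; first by split; [exact: holomorphic_poly|exact: le_lt_trans h (ltry _)].
rewrite /wnorm; move: n0 h; case: (wnorm_sq _ _) => [r|//|//]; rewrite !lee_fin => r0 h.
by rewrite /= -sqrtr1 ltr_sqrt// (le_lt_trans h).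
Qed.

Lemma A2_ball0 : A2_ball (@Wcr R) (fun=> 0).
Proof.
have := @A2_ball_poly 0 (fun=> 0) (fun _ _ => erefl); rewrite big_ord0 => /(_ ltr01).
by rewrite (_ : (fun z : R[i] => \sum_(j < 0) 0 * z ^+ j) = fun=> 0)//; apply/funext => z; rewrite big_ord0.
Qed.

(** The sum of |S_j|^2 / w_j for j < M, with w_j replaced by its upper bound 8 / ln j. *)
Definition qform (s : R) (M : nat) (X : conf R) : R :=
  \sum_(j < M) sqnorm (powstat s j X) * (ln j%:R / 8).

Lemma ln_nat_ge0 j : 0 <= ln (j%:R : R).
Proof. by case: j => [|j]; [rewrite ln0|rewrite ln_ge0// ler1n]. Qed.

Lemma qform_ge0 s M X : 0 <= qform s M X.
Proof.
by apply: sumr_ge0 => j _; rewrite mulr_ge0 ?sqnorm_ge0// divr_ge0// ln_nat_ge0.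
Qed.

(** The test function with coefficients proportional to S_j^* / w_j is extremal in
Cauchy-Schwarz. Scaled by l = 1 / (2 sqrt Q), it has squared norm at most 1/4, and
its sum over X is l Q. When Q = 0, l is 0 and the statement is trivial. The value at
the origin vanishes. *)
Lemma sup_ge_qform s M (X : conf R) (g : R) : (linstat (rho s) X < +oo)%E -> 0 < g ->
  ((qform s M X / (4 * g ^+ 2))%:E <=
   ereal_sup [set ((cmod (gXf X s 0 f / g%:C - f 0)) ^+ 2)%:E | f in A2_ball (@Wcr R)])%E.
Proof.
move=> Xoo g0; set Q := qform s M X.
have Q0 : 0 <= Q by exact: qform_ge0.
pose l := (2 * Num.sqrt Q)^-1.
have lQ : l ^+ 2 * Q ^+ 2 = Q / 4.
  have [Q00|Qn0] := eqVneq Q 0; first by rewrite Q00 expr0n mulr0 mul0r.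
  rewrite /l exprVn exprMn sqr_sqrtr//; field; exact: Qn0.
have lQ' : l ^+ 2 * Q <= 4^-1.
  have [Q00|Qn0] := eqVneq Q 0; first by rewrite Q00 mulr0 invr_ge0.
  rewrite /l exprVn exprMn sqr_sqrtr// (_ : (2 ^+ 2 * Q)^-1 * Q = 4^-1)//.
  by field; exact: Qn0.
pose a j : R[i] := (l * (ln j%:R / 8))%:C * (powstat s j X)^*%C.
have a0 j : (j < 2)%N -> a j = 0.
  move=> j2; have lj : ln (j%:R : R) = 0.
    case: j j2 => [_|[_|//]]; first exact: ln0.
    exact: ln1.
  by rewrite /a lj mul0r mulr0 rmorph0 mul0r.
have nrm : \sum_(j < M) sqnorm (a j) * (8 / ln j%:R) < 1.
  apply: (@le_lt_trans _ _ (l ^+ 2 * Q)); last by lra.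
  rewrite /Q /qform mulr_sumr; apply: ler_sum => j _.
  rewrite /a sqnormM sqnormRC sqnorm_conj.
  have [l0|l0] := eqVneq (ln (j%:R : R)) 0; first by rewrite l0 !(mul0r, mulr0, invr0).
  by rewrite le_eqVlt; apply/orP; left; apply/eqP; field.
apply: ereal_sup_ubound; exists (fun z => \sum_(j < M) a j * z ^+ j).
  exact: A2_ball_poly.
rewrite (gXf_poly _ _ Xoo).
have -> : \sum_(j < M) a j * powstat s j X = (l * Q)%:C.
  rewrite /Q /qform mulr_sumr rmorph_sum/=; apply: eq_bigr => j _.
  rewrite /a -mulrA [_^*%C * _]mulrC -sqnormC -rmorphM; congr (_%:C); ring.
have -> : \sum_(j < M) a j * 0 ^+ j = 0.
  apply: big1 => j _; case: j => -[|j] jM /=; first by rewrite a0 ?mul0r.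
  by rewrite expr0n mulr0.
rewrite subr0 -fmorphV -rmorphM sqr_cmod sqnormRC expr_div_n exprMn lQ.
by congr EFin; field; rewrite gt_eqF.
Qed.

End test_functions.

(** * Expectation of the supremum *)

Section lower_integral.
Context d (T : measurableType d) (R : realType) (m : {measure set T -> \bar R}).
Local Open Scope ereal_scope.

(** The integral of a nonnegative function is the supremum of the integrals of the simple
functions below it, hence monotone also for functions that are not measurable. *)
Lemma ge0_le_lower_integral (f g : T -> \bar R) : (forall x, 0 <= f x) ->
  (forall x, f x <= g x) -> \int[m]_x f x <= \int[m]_x g x.
Proof.
move=> f0 fg; rewrite !ge0_integralTE//; last by move=> x; exact: le_trans (fg x).
by apply: ereal_sup_le => _ [h hf <-]; exists h => // x; exact: le_trans (fg x).
Qed.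

End lower_integral.

Section conclusion.
Variable R : realType.

(** By induction, a discrete form of the integral of (ln x)/x: the increment of (ln n)^2
is at most 4 ln (n+1) / (n+1), as ln (n+1) - ln n <= 1/n <= 2/(n+1). *)
Lemma sum_ln_div_ge n : (0 < n)%N ->
  4^-1 * ln (n%:R : R) ^+ 2 <= \sum_(j < n.+1) ln (j%:R : R) / j%:R.
Proof.
case: n => // n _; elim: n => [|n ih].
  rewrite ln1 expr0n mulr0; apply: sumr_ge0 => j _.
  by rewrite divr_ge0// ln_nat_ge0.
rewrite big_ord_recr/=; apply: (@le_trans _ _ (4^-1 * ln (n.+1%:R : R) ^+ 2 + ln n.+2%:R / n.+2%:R)); last first.
  by rewrite lerD2r.
have n0 : 0 < n.+1%:R :> R by rewrite ltr0n.
have n1 : 0 < n.+2%:R :> R by rewrite ltr0n.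
have h : ln (n.+2%:R : R) - ln n.+1%:R <= n.+1%:R^-1.
  rewrite -ln_div ?posrE// (_ : n.+2%:R / n.+1%:R = 1 + n.+1%:R^-1 :> R).
    by apply: le_ln1Dx; rewrite (lt_trans (ltrN10 _))// invr_gt0.
  by rewrite -[n.+2%:R]natr1 mulrDl divff ?gt_eqF// mul1r.
have h2 : n.+1%:R^-1 <= 2 * n.+2%:R^-1 :> R.
  rewrite -[leLHS]mul1r ler_pdivrMr// mulrAC ler_pdivlMr// mul1r -natrM ler_nat.
  by rewrite mul2n -addnn addSn addnS !ltnS leq_addr.
have a0 := ln_nat_ge0 R n.+1. have b0 := ln_nat_ge0 R n.+2.
have ab : ln (n.+1%:R : R) <= ln n.+2%:R by rewrite ler_ln ?posrE// ler_nat.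
have i0 : 0 <= n.+2%:R^-1 :> R by rewrite invr_ge0 ltW.
move: h h2 a0 b0 ab i0; move: (n.+1%:R^-1) (n.+2%:R^-1) (ln n.+1%:R) (ln n.+2%:R) => x y a b h h2 a0 b0 ab y0.
have : (b - a) * (b + a) <= (2 * y) * (2 * b).
  by apply: ler_pM; lra.
by nra.
Qed.

(** Take for n the integer part of exp(1/e). *)
Lemma exists_ln_range (e : R) : 0 < e < 2^-1 -> exists n, [/\ (0 < n)%N,
  ln (n%:R : R) <= e^-1 & (2 * e)^-1 <= ln (n%:R : R)].
Proof.
move=> /andP[e0 e1].
have i2 : 2 < e^-1 by rewrite -[2]invrK ltf_pV2 ?posrE ?invr_gt0.
pose a := (2 * e)^-1; have a1 : 1 < a by rewrite /a invfM; lra.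
have E : e^-1 = a + a by rewrite /a invfM; lra.
pose n := Num.truncn (expR e^-1).
have /andP[n1 n2] := truncn_itv (expR_ge0 (e^-1)).
rewrite -/n in n1 n2.
have ea : 2 <= expR a by have := expR_ge1Dx a; lra.
have n3 : expR a <= n%:R.
  move: n2; rewrite E expRD -natr1; nra.
have n0 : 0 < n%:R :> R by rewrite (lt_le_trans _ n3)// expR_gt0.
exists n; split.
- by rewrite -(ltr_nat R).
- by rewrite -[leRHS]expRK ler_ln ?posrE// expR_gt0.
- by rewrite -/a -[leLHS]expRK ler_ln ?posrE// expR_gt0.
Qed.

Variables (P : probability (conf R) R) (hP : determinantal P (@bergman R)).
Local Open Scope ereal_scope.

Lemma expectation_qform_ge s M : (1 < s < 2)%R ->
  (16^-1 * energy_const R * \sum_(j < M) ln (j%:R : R) * (j%:R * (j%:R `^ (- s)) ^+ 2))%:E <=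
  \int[P]_X (qform s M X)%:E.
Proof.
move=> s12; rewrite /qform.
under eq_integral do rewrite -sumEFin.
rewrite ge0_integral_sum//; last 2 first.
- move=> j; under eq_fun do rewrite EFinM.
  by apply: emeasurable_funM; [exact: measurable_powstat|exact: measurable_cst].
- by move=> j X _; rewrite lee_fin mulr_ge0 ?sqnorm_ge0// divr_ge0// ln_nat_ge0.
rewrite mulr_sumr -sumEFin; apply: lee_sum => j _.
under eq_integral do rewrite EFinM.
rewrite ge0_integralZr//; last 3 first.
- exact: measurable_powstat.
- by move=> X _; rewrite lee_fin sqnorm_ge0.
- by rewrite lee_fin divr_ge0// ln_nat_ge0.
case: j => -[|j] jM /=; first by rewrite ln0// !(mul0r, mulr0) mule0.
have := powstat_second_moment_ge hP s12 (ltn0Sn j).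
move=> /(@lee_wpmul2r _ (ln j.+1%:R / 8)%:E) => /(_ _).
rewrite -EFinM => h; apply: le_trans (h _).
  by rewrite lee_fin; lra.
by rewrite lee_fin divr_ge0// ln_nat_ge0.
Qed.

Lemma gX_linstat (X : conf R) s : gX X s 0%R = linstat (rho s) X.
Proof. by apply: eq_esum => x _; rewrite distx0. Qed.

Lemma gP_bounds s : (1 < s < 2)%R -> (0 < gP P s 0%R <= (s - 1)^-1)%R.
Proof.
move=> s12; have s0 : (0 <= s)%R by move/andP: s12 => [s1 _]; rewrite ltW// (lt_trans ltr01).
rewrite /gP; under eq_integral do rewrite gX_linstat.
rewrite (expectation_linstat hP); [|exact: measurable_rho|by move=> x; exact/ltW/rho_gt0].
have p := integral_rho_gt0 s0; have q := integral_rho_le s12.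
move: p q; case: (\int[_]_x _)%E => [r|//|//].
by rewrite !lte_fin lee_fin => -> ->.
Qed.

(** sup_ge_qform holds on the event that the weights are summable, which has probability
one. Off this event the minorant is replaced by 0, so that it is a measurable minorant
everywhere. *)
Lemma expectation_sup_ge s M : (1 < s < 2)%R ->
  ((4 * gP P s 0%R ^+ 2)^-1)%:E * \int[P]_X (qform s M X)%:E <=
  \int[P]_X ereal_sup [set ((cmod (gXf X s 0%R f / (gP P s 0%R)%:C - f 0%R)) ^+ 2)%:E
                 | f in A2_ball (@Wcr R)].
Proof.
move=> s12; have /andP[g0 _] := gP_bounds s12.
set g := gP P s 0%R in g0 *.
have c0 : (0 <= (4 * g ^+ 2)^-1)%R by rewrite invr_ge0 mulr_ge0// sqr_ge0.
have mq : measurable_fun setT (fun X => (qform s M X)%:E).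
  rewrite /qform; under eq_fun do rewrite -sumEFin.
  apply: emeasurable_sum => j; under eq_fun do rewrite EFinM.
  by apply: emeasurable_funM; [exact: measurable_powstat|exact: measurable_cst].
rewrite -ge0_integralZl//; last first.
  by move=> X _; rewrite lee_fin qform_ge0.
have rho0 x : (0 <= rho s x :> R)%R by exact/ltW/rho_gt0.
have ml : measurable_fun setT (linstat (rho s)) by apply: measurable_linstat; [exact: measurable_rho|].
pose G : set (conf R) := [set X | linstat (rho s) X < +oo].
have mG : measurable G.
  by rewrite -[G]setTI; exact: emeasurable_fun_infty_o.
pose m X := ((4 * g ^+ 2)^-1)%:E * (qform s M X)%:E * (\1_G X)%:E.
have m0 X : 0 <= m X by rewrite !mule_ge0// lee_fin qform_ge0.
apply: (@le_trans _ _ (\int[P]_X m X)).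
  apply: ae_ge0_le_integral => //.
  - by move=> X _; rewrite mule_ge0// lee_fin qform_ge0.
  - by apply: emeasurable_funM => //; exact: measurable_cst.
  - apply: emeasurable_funM; first by apply: emeasurable_funM => //; exact: measurable_cst.
    by apply/measurable_EFinP; exact: measurable_indic.
  have := linstat_ae_lty hP (@measurable_rho R s) rho0 (le_lt_trans (integral_rho_le s12) (ltry _)).
  apply: filterS => X Xoo _.
  by rewrite /m indicE mem_set// mule1.
apply: ge0_le_lower_integral => // X; rewrite /m indicE.
case: (boolP (X \in G)) => XG.
  rewrite mule1 -EFinM mulrC; apply: sup_ge_qform => //.
  by rewrite inE in XG.
rewrite mule0; apply: le_trans (ereal_sup_ubound _); last first.
  by exists (fun=> 0%R); [exact: A2_ball0|reflexivity].
by rewrite lee_fin sqr_ge0.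
Qed.

(** The constants of powstat_second_moment_ge, sup_ge_qform and sum_ln_div_ge, and the
bounds j^(-2e) >= exp(-2) and ln n >= 1/(2e), multiplied together. *)
Definition liminf_const : R := (energy_const R * expR (-2) / 1024)%R.

(** Choose n with ln n between 1/(2e) and 1/e. For j <= n, j^(-2e) is at least exp(-2),
so the sum of j^(1 - 2s) ln j is at least exp(-2) (ln n)^2 / 4, of order 1/e^2, which
compensates g_P(s)^(-2) >= e^2. *)
Lemma expectation_sup_ge_const s : (1 < s < 3 / 2)%R ->
  liminf_const%:E <=
  \int[P]_X ereal_sup [set ((cmod (gXf X s 0%R f / (gP P s 0%R)%:C - f 0%R)) ^+ 2)%:E
                 | f in A2_ball (@Wcr R)].
Proof.
move=> /andP[s1 s2].
have s12 : (1 < s < 2)%R by rewrite s1/=; lra.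
pose e := (s - 1)%R.
have e0 : (0 < e < 2^-1)%R by rewrite /e; apply/andP; split; lra.
have [n [n0 n1 n2]] := exists_ln_range e0.
have /andP[g0 g1] := gP_bounds s12.
apply: le_trans (expectation_sup_ge n.+1 s12).
have C0 := energy_const_gt0 R.
apply: (@le_trans _ _ (((4 * gP P s 0%R ^+ 2)^-1)%:E * (16^-1 * energy_const R *
   \sum_(j < n.+1) ln (j%:R : R) * (j%:R * (j%:R `^ (- s)) ^+ 2))%:E)); last first.
  apply: lee_wpmul2l; first by rewrite lee_fin invr_ge0 mulr_ge0// sqr_ge0.
  exact: expectation_qform_ge.
rewrite -EFinM lee_fin.
have S : (expR (-2) * (4^-1 * ln (n%:R : R) ^+ 2) <=
    \sum_(j < n.+1) ln (j%:R : R) * (j%:R * (j%:R `^ (- s)) ^+ 2))%R.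
  apply: (@le_trans _ _ (expR (-2) * \sum_(j < n.+1) ln (j%:R : R) / j%:R)%R).
    by rewrite ler_wpM2l ?expR_ge0// sum_ln_div_ge.
  rewrite mulr_sumr; apply: ler_sum => -[[|j] jn] _ /=; first by rewrite ln0// !(mul0r, mulr0).
  rewrite mulrCA ler_wpM2l ?ln_nat_ge0//.
  have j0 : (0 < j.+1%:R :> R)%R by rewrite ltr0n.
  have -> : (j.+1%:R * (j.+1%:R `^ (- s)) ^+ 2 = expR (- (2 * e * ln j.+1%:R)) * j.+1%:R^-1 :> R)%R.
    rewrite /powR gt_eqF// -expRM_natl.
    have := lnK j0; move: (ln _) => L <-; rewrite -expRN -!expRD /e.
    by congr expR; ring.
  rewrite ler_wpM2r ?invr_ge0 ?(ltW j0)// ler_expR lerN2.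
  have : (e * ln (j.+1%:R : R) <= 1)%R.
    rewrite -[leRHS](@divff _ e); last by rewrite gt_eqF//; case/andP: e0.
    apply: ler_wpM2l; first by case/andP: e0 => /ltW.
    by apply: le_trans n1; rewrite ler_ln ?posrE// ?ltr0n// ler_nat.
  lra.
have L2 : (4^-1 * (e^-1) ^+ 2 <= ln (n%:R : R) ^+ 2)%R.
  rewrite (_ : 4^-1 * _ = ((2 * e)^-1) ^+ 2)%R; last by rewrite invfM; move: (e^-1)%R => y; field.
  rewrite lerXn2r ?nnegrE ?ln_nat_ge0//.
  by rewrite invr_ge0 mulr_ge0//; case/andP: e0 => /ltW.
have G2 : (e ^+ 2 / 4 <= (4 * gP P s 0%R ^+ 2)^-1)%R.
  rewrite invfM mulrC ler_wpM2l// -exprVn lerXn2r ?nnegrE ?invr_ge0 ?(ltW g0)//.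
    by case/andP: e0 => /ltW.
  by rewrite -[leLHS]invrK lef_pV2 ?posrE ?invr_gt0//; case/andP: e0.
have X2 := expR_gt0 (- 2 : R).
apply: (@le_trans _ _ (e ^+ 2 / 4 * (16^-1 * energy_const R * (expR (-2) * (4^-1 * (4^-1 * (e^-1) ^+ 2)))))%R).
  have e1 : e != 0%R by rewrite gt_eqF//; case/andP: e0.
  rewrite le_eqVlt; apply/orP; left; apply/eqP; rewrite /liminf_const.
  move: e e1 (energy_const R) (expR (-2)) {e0 n1 n2 S L2 G2 C0 X2} => a a0 b c.
  by field.
apply: ler_pM => //.
- by rewrite divr_ge0// sqr_ge0.
- apply: mulr_ge0; first by rewrite mulr_ge0 ?(ltW C0).
  by apply: mulr_ge0; [exact: ltW|rewrite mulr_ge0// mulr_ge0// sqr_ge0].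
apply: ler_wpM2l; first by rewrite mulr_ge0 ?(ltW C0).
by apply: le_trans S; rewrite ler_wpM2l ?(ltW X2)// ler_wpM2l.
Qed.

End conclusion.

Lemma limf_einf_at_right_ge (R : realType) (F : R -> \bar R) (a b : R) (c : \bar R) :
  a < b -> (forall s, a < s < b -> (c <= F s)%E) -> (c <= limf_einf F a^'+)%E.
Proof.
move=> ab h; rewrite limf_einfE; apply: le_ereal_sup_tmp.
exists (ereal_inf (F @` [set s | a < s < b])); last first.
  by apply: le_ereal_inf_tmp => _ [s s12 <-]; exact: h.
exists [set s | a < s < b] => //.
near=> s; apply/andP; split; near: s; [exact: nbhs_right_gt|exact: nbhs_right_lt].
Unshelve. all: by end_near. Qed.

Theorem proposition1p9 (R : realType) (P : probability (conf R) R)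
    (hP : determinantal P (@bergman R)) :
  (0 < limf_einf
    (fun s : R => \int[P]_X
       ereal_sup [set ((cmod (gXf X s 0 f / (gP P s 0)%:C - f 0)) ^+ 2)%:E
                 | f in A2_ball (@Wcr R)])
    (1 : R)^'+)%E.
Proof.
apply: (@lt_le_trans _ _ (liminf_const R)%:E).
  rewrite lte_fin; apply: divr_gt0; last by rewrite ltr0n.
  by apply: mulr_gt0; [exact: energy_const_gt0|exact: expR_gt0].
apply: (@limf_einf_at_right_ge _ _ _ (3 / 2)); first lra.
exact: expectation_sup_ge_const.
Qed.
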